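(* For any $\alpha\in\mathbb{C}^*$ the subspace $\beta(\Psi_\alpha)$ of the space $\Psi$ is $\tilde G$-invariant. The traces $\mathrm{Tr}_\alpha$ of elements of $\tilde G$ in $\beta(\Psi_\alpha)$ with respect to the distinguished basis $(g_\alpha)_l=\beta(\Delta(l,g_\alpha))$, $l\in\mathbb{Z}$, are as follows: - $\mathrm{Tr}_\alpha((a,b,c,d))=0$ if and only if $b\ne0$; - $\mathrm{Tr}_\alpha((a,0,c,d))=q^{-c-a}\alpha^a\sum_{l\in\mathbb{Z}}q^{-al-\frac{dl(l+1)}{2}}\alpha^{dl}$.
   Context: **The field $K$.** Let $q$ be a power of a prime $p$, and let $K$ be a two-dimensional local field isomorphic to one of the following (fix such an isomorphism): (i) $K=\mathbb{F}_q((u))((t))$; (ii) $K=L((t))$, with $L$ a finite extension of $\mathbb{Q}_p$ with residue field $\mathbb{F}_q$ and $u$ a uniformizer of $L$. $K$ is a discrete valuation field with uniformizer $t$; $\mathcal{O}$ is its valuation ring, $\mathcal{O}(i)=t^i\mathcal{O}$ ($i\in\mathbb{Z}$), and $\bar K=\mathcal{O}/\mathcal{O}(1)$ is the residue field ($\mathbb{F}_q((u))$, resp. $L$), a local field with residue field $\mathbb{F}_q$, uniformizer $u$, valuation ring $\mathcal{O}_{\bar K}$. $\mathcal{O}'\subset\mathcal{O}$ is the subring of elements whose image in $\bar K$ lies in $\mathcal{O}_{\bar K}$. Every element of $K^*$ is uniquely $t^au^bg$ with $a,b\in\mathbb{Z}$, $g\in{\mathcal{O}'}^*$. Let $B\subset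 K$ be the subring $\mathbb{F}_q[[u]]((t))$, resp. $\mathcal{O}_L((t))$, where $\mathcal{O}_L$ is the valuation ring of $L$. **Measures.** For $i\le j$, $\mathcal{O}(i)/\mathcal{O}(j)$ is a locally compact totally disconnected group, a base of neighbourhoods of $0$ being the open compact subgroups $(u^kB\cap\mathcal{O}(i))/(u^kB\cap\mathcal{O}(j))$, $k\in\mathbb{Z}$. For such a group $A$: $\mathcal{D}(A)$ is the space of $\mathbb{C}$-valued locally constant compactly supported functions, $\mathcal{D}'(A)$ its full linear dual (distributions), $\mu(A)\subset\mathcal{D}'(A)$ the one-dimensional space of $\mathbb{C}$-valued Haar measures. An isomorphism $g$ of groups acts by $(gf)(x)=f(g^{-1}x)$, $(gT)(f)=T(g^{-1}f)$. Put $\mu(\mathcal{O}(r)\mid\mathcal{O}(s))=\mu(\mathcal{O}(s)/\mathcal{O}(r))$ if $r\ge s$ and $\mu(\mathcal{O}(r)/\mathcal{O}(s))^*$ if $r\le s$. There are canonical associative isomorphisms $\mu(\mathcal{O}(r)\mid\mathcal{O}(s))\otimes\mu(\mathcal{O}(s)\mid\mathcal{O}(w))\to\mu(\mathcal{O}(r)\mid\mathcal{O}(w))$ (from products of Haar measures and duality), and $g\in K^*$ maps $\mu(\mathcal{O}(r)\mid\mathcal{O}(s))$ to $\mu(g\mathcal{O}(r)\mid g\mathcal{O}(s))$. For $s\le r$, $\mu_{B,r,s}\in\mu(\mathcal{O}(s)/\mathcal{O}(r))$ is the Haar measure with value $1$ on $(B\cap\mathcal{O}(s))/(B\cap\mathcal{O}(r))$;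 for $s\ge r$, $\mu_{B,r,s}$ is the dual element of $\mu_{B,s,r}$. **Groups.** $\widehat{K^*}$ is the group of pairs $(g,\mu)$, $g\in K^*$, $0\ne\mu\in\mu(\mathcal{O}\mid g\mathcal{O})$, with $(g_1,\mu_1)(g_2,\mu_2)=(g_1g_2,\mu_1\otimes g_1(\mu_2))$. $\widetilde{K^*}$ is the subgroup of pairs with $\mu\in q^{\mathbb{Z}}\mu_{B,0,b}$, where $g\mathcal{O}=\mathcal{O}(b)$. The group ${\mathcal{O}'}^*$ embeds as a central subgroup by $g\mapsto(g,1)$. $G=\mathrm{Heis}(3,\mathbb{Z})$ is $\mathbb{Z}^3$ with $(a_1,b_1,c_1)(a_2,b_2,c_2)=(a_1+a_2,b_1+b_2,c_1+c_2+a_1b_2)$, and $G$ is identified with $\widetilde{K^*}/{\mathcal{O}'}^*$ by $(a,b,c)\mapsto$ class of $(u^at^b,q^{-c}\mu_{B,0,b})$. **Distributions on $K$.** $\mathcal{D}'_{\mathcal{O}}(K)=\varinjlim_s\varinjlim_{r>s}\mathcal{D}'(\mathcal{O}(s)/\mathcal{O}(r))\otimes_{\mathbb{C}}\mu(\mathcal{O}\mid\mathcal{O}(r))$. Transition maps: for $s'<s$, direct image of distributions under $\mathcal{O}(s)/\mathcal{O}(r)\hookrightarrow\mathcal{O}(s')/\mathcal{O}(r)$ (dual to restriction of functions); for $r<r'$, write $\mu(\mathcal{O}\mid\mathcal{O}(r))=\mu(\mathcal{O}\mid\mathcal{O}(r'))\otimes\mu(\mathcal{O}(r)/\mathcal{O}(r'))$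 and use the inverse image $\mathcal{D}'(\mathcal{O}(s)/\mathcal{O}(r))\otimes\mu(\mathcal{O}(r)/\mathcal{O}(r'))\to\mathcal{D}'(\mathcal{O}(s)/\mathcal{O}(r'))$ (dual to integration of functions along the fibres of $\mathcal{O}(s)/\mathcal{O}(r')\to\mathcal{O}(s)/\mathcal{O}(r)$). $(g,\mu)\in\widehat{K^*}$ acts by $T\otimes\nu\mapsto g(T)\otimes(\mu\otimes g(\nu))$. Hence $G$ acts on $\mathcal{D}'_{\mathcal{O}}(K)^{{\mathcal{O}'}^*}$. **The space $\Psi$.** For $\varphi\in\mathcal{D}'(\bar K)^{\mathcal{O}_{\bar K}^*}$ and $l\in\mathbb{Z}$ let $\varphi_l=t^l(\varphi)\otimes\mu_{B,0,l+1}\in\mathcal{D}'_{\mathcal{O}}(K)^{{\mathcal{O}'}^*}$, where $t^l(\varphi)\in\mathcal{D}'(\mathcal{O}(l)/\mathcal{O}(l+1))$. $\Psi$ is the $\mathbb{C}$-linear span of all $\varphi_l$. **The group $\tilde G$ and its action.** For $d\in\mathbb{Z}$ let $R_d$ be the automorphism of the field $K$ given by $R_d(\sum a_{i,j}u^it^j)=\sum a_{i,j}u^{i+jd}t^j$ ($a_{i,j}\in\mathbb{F}_q$) in case (i) and $R_d(\sum_j b_jt^j)=\sum_j b_ju^{jd}t^j$ ($b_j\in L$) in case (ii). It preserves each $\mathcal{O}(i)$ and induces (by transport of structure) maps, also denoted $R_d$, on $\mathcal{D}'(\mathcal{O}(i)/\mathcal{O}(j))$, $\mu(\mathcal{O}(r)\mid\mathcal{O}(s))$,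 $\mathcal{D}'_{\mathcal{O}}(K)$, on $\mathcal{D}'_{\mathcal{O}}(K)^{{\mathcal{O}'}^*}$, and on $\widetilde{K^*}$ and $G$; explicitly $R_d((a,b,c))=(a+db,\,b,\,c+\frac{b(b-1)d}{2})$. $\tilde G=G\rtimes\mathbb{Z}$ is the set of integer quadruples $(a,b,c,d)$ with $$(a_1,b_1,c_1,d_1)(a_2,b_2,c_2,d_2)=\left(a_1+a_2+d_1b_2,\ b_1+b_2,\ c_1+c_2+\tfrac{b_2(b_2-1)d_1}{2}+a_1b_2,\ d_1+d_2\right).$$ It acts on $\mathcal{D}'_{\mathcal{O}}(K)^{{\mathcal{O}'}^*}$ by $(a,b,c,d)\cdot V=(a,b,c)\cdot(R_d(V))$, and $\Psi$ is $\tilde G$-invariant. **The subspaces $\beta(\Psi_\alpha)$.** For $\alpha\in\mathbb{C}^*$, $\Phi_\alpha=\{\phi\in\mathcal{D}'(\bar K)^{\mathcal{O}_{\bar K}^*}: u(\phi)=\alpha\phi\}$ is one-dimensional, and $g_\alpha\in\Phi_\alpha$ is its unique element whose value on the characteristic function of $\mathcal{O}_{\bar K}$ is $1$. $\Psi_\alpha$ is the representation of $G$ induced from the character $\sigma_\alpha(a\oplus c)=q^{-c-a}\alpha^a$ (on the space $\Phi_\alpha$) of the subgroup $H\oplus C=\{(a,0,c)\}$, where $H=\{(a,0,0)\}$ and $C=\{(0,0,c)\}$: it consists of the functions $f:G\to\Phi_\alpha$, supported on finitely many left cosets of $H\oplus C$, with $f(xh)=\sigma_\alpha(h^{-1})f(x)$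 for $h\in H\oplus C$, and $G$ acts by $(g\cdot f)(x)=f(g^{-1}x)$. By restriction it is identified with the space of finitely supported functions $\mathbb{Z}=\{(0,b,0)\}\to\Phi_\alpha$; $\Delta(m,g_\alpha)$ is the function with value $g_\alpha$ at $m$ and $0$ at $n\neq m$; these form a basis of $\Psi_\alpha$. The map $\beta:\Psi_\alpha\to\Psi$ is linear with $\beta(\Delta(m,g_\alpha))=(g_\alpha)_m$, commutes with $G$, and is injective on $\Psi_\alpha$. Hence $\beta(\Psi_\alpha)$ is the subspace of $\Psi$ with basis $(g_\alpha)_l$, $l\in\mathbb{Z}$. This basis is called distinguished: it consists of common eigenvectors of all elements of $H$, with distinct basis elements having distinct eigenvalues for each nontrivial element of $H$, and this property determines the basis elements up to multiplication by elements of $\mathbb{C}^*$. **Traces.** $\mathrm{Tr}_\alpha$ denotes the trace (when it exists) with respect to the distinguished basis, i.e. the sum over $l\in\mathbb{Z}$ of the diagonal matrix entries.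
   Formalization: For a fixed α the claim ''Tr_α = 0 iff b≠0'' fails (α=-1, (0,0,0,1): terms l and -1-l cancel, sum 0); proved instead: Tr_α = 0 for every α∈C* iff b≠0, and for each α all diagonal entries vanish iff b≠0. *)

(* Defs.v *)
From HB Require Import structures.
From mathcomp Require Import all_boot all_order all_algebra finmap.
From mathcomp Require Import fieldext complex freeg.
From mathcomp Require Import boolp classical_sets functions cardinality fsbigop.
From mathcomp Require Import reals topology normedtype numfun summability.

Set Implicit Arguments.
Unset Strict Implicit.
Unset Printing Implicit Defensive.

Import Order.TTheory GRing.Theory Num.Theory.
Import numFieldNormedType.Exports.

Local Open Scope classical_set_scope.
Local Open Scope ring_scope.
Local Open Scope quotient_scope.

Section LinearAlgebra.
Context (C : nzRingType) (V : lmodType C).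

Definition subspace (W : set V) : Prop :=
  W 0 /\ forall a x y, W x -> W y -> W (a *: x + y).

Definition lspan (S : set V) : set V :=
  [set x | forall W : set V, subspace W -> S `<=` W -> W x].

(* The algebraic dual of a subspace [D], each functional on [D] being
   represented by its extension by 0 to the ambient space (so that equality of
   functionals on [D] is Leibniz equality). *)
Definition ldual (D : set V) : set (V -> C^o) :=
  [set T | (forall a x y, D x -> D y -> T (a *: x + y) = a * T x + T y) /\
           (forall x, ~ D x -> T x = 0)].

(* The representative, in the sense of [ldual], of a functional on [D]. *)
Definition on_dom (D : set V) (T : V -> C^o) : V -> C^o :=
  fun x => if `[< D x >] then T x else 0.

Definition is_basis (W : set V) (e : int -> V) : Prop :=
  W = lspan (range e) /\
  forall c : int -> C, finite_set [set l | c l != 0] ->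
    \sum_(l \in setT) c l *: e l = 0 -> forall l, c l = 0.

(* [M m l] is the coefficient of [e m] in [A (e l)]. *)
Definition is_matrix (W : set V) (e : int -> V) (A : V -> V)
    (M : int -> int -> C) : Prop :=
  is_basis W e /\
  forall l, finite_set [set m | M m l != 0] /\
            A (e l) = \sum_(m \in setT) M m l *: e m.

End LinearAlgebra.

Section Quotient.
Context (C : nzRingType) (V : lmodType C) (S : set V).

Definition span_pred : V -> bool := fun x => `[< lspan S x >].

Lemma span_pred_closed : submod_closed span_pred.
Proof.
split=> [|a x y]; rewrite /span_pred /in_mem /=.
  by apply/asboolP => W [].
move=> /asboolP Hx /asboolP Hy; apply/asboolP => W sW SW.
by apply: (sW.2); [exact: Hx | exact: Hy].
Qed.

HB.instance Definition _ := GRing.isSubmodClosed.Build C V span_pred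
  span_pred_closed.

Definition lquot : Type := Quotient.quot (GRing.ZmodClosed.clone V span_pred _).

HB.instance Definition _ := GRing.Zmodule.on lquot.
HB.instance Definition _ := EqQuotient.on lquot.

Definition lclass (v : V) : lquot := \pi v.

Lemma lclassK x : lclass (repr x) = x.
Proof. exact: reprK. Qed.

Lemma lclassP v w : lclass v = lclass w <-> lspan S (v - w).
Proof.
split=> [/eqP|H]; last apply/eqP; rewrite -Quotient.idealrBE.
  by move/asboolP.
exact/asboolP.
Qed.

Lemma lclassD v w : lclass (v + w) = lclass v + lclass w.
Proof. exact: Quotient.pi_add. Qed.

Definition lquot_scale (a : C) (x : lquot) : lquot := lclass (a *: repr x).

Lemma lquot_scaleE a v : lquot_scale a (lclass v) = lclass (a *: v).
Proof.
apply/lclassP; rewrite -scalerBr -[_ *: _]addr0 => W WV SW.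
by apply: WV.2 WV.1; have /lclassP := lclassK (lclass v); apply.
Qed.

Lemma lquot_scaleA a b x :
  lquot_scale a (lquot_scale b x) = lquot_scale (a * b) x.
Proof. by rewrite -[x]lclassK !lquot_scaleE scalerA. Qed.

Lemma lquot_scale1 : left_id 1 lquot_scale.
Proof. by move=> x; rewrite -[x]lclassK lquot_scaleE scale1r. Qed.

Lemma lquot_scaleDr : right_distributive lquot_scale +%R.
Proof.
move=> a x y; rewrite -[x]lclassK -[y]lclassK.
by rewrite -lclassD !lquot_scaleE scalerDr lclassD.
Qed.

Lemma lquot_scaleDl x : {morph lquot_scale^~ x : a b / a + b}.
Proof.
by move=> a b; rewrite -[x]lclassK !lquot_scaleE scalerDl lclassD.
Qed.

HB.instance Definition _ := GRing.Zmodule_isLmodule.Build C lquot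
  lquot_scaleA lquot_scale1 lquot_scaleDr lquot_scaleDl.

End Quotient.

(* A field [K] together with an isomorphism onto the field of formal Laurent
   series over [k], given by its coefficients. *)
Record laurent (k K : fieldType) := Laurent {
  lcoef : K -> int -> k;
  lcoef_bounded : forall x, exists N, forall n, n < N -> lcoef x n = 0;
  lcoef_inj : forall x y, lcoef x =1 lcoef y -> x = y;
  lcoef_surj : forall (a : int -> k) N, (forall n, n < N -> a n = 0) ->
    exists x, lcoef x =1 a;
  lcoefD : forall x y n, lcoef (x + y) n = lcoef x n + lcoef y n;
  (* The sum has finitely many nonzero terms by [lcoef_bounded]. *)
  lcoefM : forall x y n,
    lcoef (x * y) n = \sum_(i \in setT) lcoef x i * lcoef y (n - i)
}.

Section LaurentSeries.
Context (k K : fieldType) (X : laurent k K).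

Definition lseries (a : int -> k) : K := xget 0 [set x | lcoef X x =1 a].
Definition lconst (c : k) : K := lseries (fun n => if n == 0 then c else 0).
Definition lvar : K := lseries (fun n => (n == 1)%:R).

(* The fractional ideal generated by the [i]-th power of the variable. *)
Definition lfil (i : int) : set K :=
  [set x | forall n, n < i -> lcoef X x n = 0].

End LaurentSeries.

Section Valuations.
Context (k : fieldType) (v : k -> int).

(* The value [v 0] is irrelevant. *)
Definition discrete_valuation : Prop :=
  [/\ forall x y, x != 0 -> y != 0 -> v (x * y) = v x + v y,
      forall x y, x != 0 -> y != 0 -> x + y != 0 ->
        Order.min (v x) (v y) <= v (x + y)
    & exists2 x, x != 0 & v x = 1].

Definition vball (n : int) : set k := [set x | x = 0 \/ n <= v x].

Definition vcomplete : Prop :=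
  forall s : nat -> k,
    (forall n, exists N, forall i j, (N <= i)%N -> (N <= j)%N ->
       vball n (s i - s j)) ->
    exists x, forall n, exists N, forall i, (N <= i)%N -> vball n (s i - x).

End Valuations.

(* [Qp] is the completion of the rational numbers for the [p]-adic valuation,
   and [v] its valuation. *)
Definition is_padic_field (p : nat) (Qp : fieldType) (v : Qp -> int) : Prop :=
  [/\ discrete_valuation v,
      vcomplete v,
      forall n : nat, (0 < n)%N -> n%:R != 0 :> Qp /\ v n%:R = (logn p n)%:Z
    & forall (x : Qp) n, exists r : rat, vball v n (x - ratr r)].

(* [w] is the normalized valuation of the finite extension [L] of [Qp];
   it exists, is unique and is automatically complete. *)
Definition is_extended_valuation (Qp : fieldType) (v : Qp -> int)
    (L : fieldExtType Qp) (w : L -> int) : Prop :=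
  [/\ discrete_valuation w,
      vcomplete w
    & exists2 e : nat, (0 < e)%N &
        forall x : Qp, x != 0 -> w x%:A = e%:Z * v x].

(* The residue field of the valuation ring of [w] has [q] elements. *)
Definition has_residue_field (L : fieldType) (w : L -> int) (q : nat) : Prop :=
  exists (F : finFieldType) (res : L -> F),
    #|F| = q /\
    [/\ res 1 = 1,
        forall x y, vball w 0 x -> vball w 0 y ->
          res (x + y) = res x + res y /\ res (x * y) = res x * res y,
        forall c, exists2 x, vball w 0 x & res x = c
      & forall x, vball w 0 x -> (res x = 0 <-> vball w 1 x)].

(* [local_residue p q u A]: [k] is F_q((u)) or a finite extension of Q_p with
   residue field F_q and uniformizer [u], and [A] is its valuation ring. *)
Inductive local_residue (p q : nat) : forall k : fieldType, k -> set k -> Prop :=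
| EqualChar (F : finFieldType) (k : fieldType) (X : laurent F k) :
    #|F| = q -> local_residue p q (lvar X) (lfil X 0)
| MixedChar (Qp : fieldType) (v : Qp -> int) (L : fieldExtType Qp)
    (w : L -> int) (u : L) :
    is_padic_field p v -> is_extended_valuation v w ->
    has_residue_field w q -> w u = 1 -> u != 0 ->
    local_residue p q u (vball w 0).

(* A field isomorphic to F_q((u))((t)) or L((t)), the isomorphism being fixed. *)
Record field2d (p q : nat) := Field2d {
  res_field : fieldType;
  res_unif : res_field;
  res_int : set res_field;
  res_fieldP : local_residue p q res_unif res_int;
  big_field : fieldType;
  expansion : laurent res_field big_field
}.

(* The topological group [num / den], where [num] and [den] are subgroups of
   [V] and [nbh n] is the preimage in [num] of the [n]-th member of a base of
   neighbourhoods of 0 consisting of open subgroups. *)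
Record subquot (V : zmodType) := Subquot {
  num : set V;
  den : set V;
  nbh : int -> set V
}.

(* [V] with the topology generated by the translates of the sets [nbh A n].
   On [num A] it is the inverse image of the topology of [num A / den A], so
   that a subset of [num A] is compact iff its image in the quotient is. *)
Definition sqtop (V : zmodType) (A : subquot V) : Type := V.

HB.instance Definition _ (V : zmodType) (A : subquot V) :=
  Choice.on (sqtop A).
HB.instance Definition _ (V : zmodType) (A : subquot V) :=
  isSubBaseTopological.Build (sqtop A)
    [set U : set V | exists x n, U = [set y | nbh A n (y - x)]] id.

Section Distributions.
Context (R : realType) (V : zmodType) (A : subquot V).
Local Notation C := R[i].

(* Locally constant compactly supported functions on [num A / den A], seen as
   [den A]-invariant functions on [num A] extended by 0 to [V]. *)
Definition test : set (V -> C^o) :=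
  [set f | [/\ forall x, ~ num A x -> f x = 0,
               forall x y, den A y -> f (x + y) = f x,
               forall x : sqtop A, \forall y \near x, f y = f x
             & compact ([set x | f x != 0] : set (sqtop A))]].

Definition distr : set ((V -> C^o) -> C^o) := ldual test.

(* The space of C-valued Haar measures. *)
Definition haar : set ((V -> C^o) -> C^o) :=
  [set m | distr m /\
     forall a f, num A a -> test f -> m (fun x => f (x + a)) = m f].

End Distributions.

(* The action of a bijection [s] on distributions. *)
Definition dpush (R : realType) (V : Type) (s : V -> V)
    (T : (V -> R[i]^o) -> R[i]^o) : (V -> R[i]^o) -> R[i]^o :=
  fun f => T (f \o s).

Section TwoDimensional.
Context (R : realType) (p q : nat) (S : field2d p q).

Local Notation C := R[i].
Local Notation k := (res_field S).
Local Notation u := (res_unif S).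
Local Notation Ok := (@res_int p q S).
Local Notation K := (big_field S).
Local Notation X := (expansion S).
Local Notation O := (lfil X).

Definition uK : K := lconst X u.
Definition tK : K := lvar X.

Definition ringB : set K := [set x | forall n, Ok (lcoef X x n)].

Definition uB (n : int) : set K := [set uK ^ n * x | x in ringB].

Definition OO (s r : int) : subquot K :=
  {| num := O s; den := O r;
     nbh := fun n => [set x + y | x in uB n `&` O s & y in O r] |}.

Definition resG : subquot k :=
  {| num := setT; den := [set 0]; nbh := fun n => [set u ^ n * x | x in Ok] |}.

Definition dist : Type := (K -> C^o) -> C^o.
HB.instance Definition _ := GRing.Lmodule.on dist.

(* The elements of mu(O(r)|O(s)) are pairs with a second (resp. first)
   component equal to 0 if s <= r (resp. r < s). *)
Definition relm : Type := (dist * (dist -> C^o))%type.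
HB.instance Definition _ := GRing.Lmodule.on relm.

Definition mu (r s : int) : set relm :=
  if s <= r then [set (m, 0) | m in haar (OO s r)]
  else [set (0, l) | l in ldual (haar (OO r s))].

(* For [m] on O(r)/O(r'), the integral of [f] along the fibres of
   O(s)/O(r') -> O(s)/O(r). *)
Definition fibre_int (r : int) (m : dist) (f : K -> C^o) : K -> C^o :=
  fun x => m (fun y => if `[< O r y >] then f (x + y) else 0).

(* The inverse image of [T] (x) [m], for [T] on O(s)/O(r) and [m] a Haar
   measure on O(r)/O(r'); it is the product measure when [T] is a Haar measure. *)
Definition inv_image (s r r' : int) (T m : dist) : dist :=
  on_dom (test (OO s r')) (fun f => T (fibre_int r m f)).

(* The direct image of [T] under O(s)/O(r) -> O(s')/O(r). *)
Definition dir_image (s' s r : int) (T : dist) : dist :=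
  on_dom (test (OO s' r)) (fun f => T (fun x => if `[< O s x >] then f x else 0)).

(* [tens r s w a b c]: the image of [a] (x) [b] under the isomorphism
   mu(O(r)|O(s)) (x) mu(O(s)|O(w)) -> mu(O(r)|O(w)) is [c]. *)
Inductive tens (r s w : int) : relm -> relm -> relm -> Prop :=
| tens_hh m1 m2 : s <= r -> w <= s ->
    haar (OO s r) m1 -> haar (OO w s) m2 ->
    tens r s w (m1, 0) (m2, 0) (inv_image w s r m2 m1, 0)
| tens_hd_h n n' l2 : s <= r -> s < w -> w <= r ->
    haar (OO w r) n -> haar (OO s w) n' -> ldual (haar (OO s w)) l2 ->
    tens r s w (inv_image s w r n' n, 0) (0, l2) (l2 n' *: n, 0)
| tens_hd_d m1 l2 l3 : s <= r -> s < w -> r < w ->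
    haar (OO s r) m1 -> ldual (haar (OO s w)) l2 -> ldual (haar (OO r w)) l3 ->
    (forall n, haar (OO r w) n -> l3 n = l2 (inv_image s r w m1 n)) ->
    tens r s w (m1, 0) (0, l2) (0, l3)
| tens_dh_h n n' l1 : r < s -> w <= s -> w <= r ->
    ldual (haar (OO r s)) l1 -> haar (OO r s) n -> haar (OO w r) n' ->
    tens r s w (0, l1) (inv_image w r s n' n, 0) (l1 n *: n', 0)
| tens_dh_d m2 l1 l3 : r < s -> w <= s -> r < w ->
    ldual (haar (OO r s)) l1 -> haar (OO w s) m2 -> ldual (haar (OO r w)) l3 ->
    (forall n, haar (OO r w) n -> l3 n = l1 (inv_image r w s n m2)) ->
    tens r s w (0, l1) (m2, 0) (0, l3)
| tens_dd l1 l2 l3 : r < s -> s < w ->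
    ldual (haar (OO r s)) l1 -> ldual (haar (OO s w)) l2 ->
    ldual (haar (OO r w)) l3 ->
    (forall n n', haar (OO s w) n -> haar (OO r s) n' ->
       l3 (inv_image r s w n' n) = l1 n' * l2 n) ->
    tens r s w (0, l1) (0, l2) (0, l3).

Definition tensor (r s w : int) (a b : relm) : relm :=
  xget 0 [set c | tens r s w a b c].

(* The characteristic function of (B \cap O(s)) / (B \cap O(r)). *)
Definition charB (s r : int) : K -> C^o :=
  \1_[set x + y | x in ringB `&` O s & y in O r].

Definition haarB (s r : int) : dist :=
  xget 0 [set m : dist | haar (OO s r) m /\ m (charB s r) = 1].

Definition muB (r s : int) : relm :=
  if s <= r then (haarB s r, 0)
  else (0, xget 0 [set l | ldual (haar (OO r s)) l /\ l (haarB r s) = 1]).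

(* The action of a bijection [s] of [K], with inverse [s'], on the spaces
   [mu _ _]. *)
Definition rpush (s s' : K -> K) (a : relm) : relm :=
  (dpush s a.1, fun m => a.2 (dpush s' m)).

(* [(s, r, T, nu)] stands for [T] (x) [nu] in
   D'(O(s)/O(r)) (x) mu(O | O(r)). *)
Definition gen : Type := (int * int * dist * relm)%type.
HB.instance Definition _ := Choice.on gen.

Definition admissible (z : gen) : Prop :=
  let: (s, r, T, nu) := z in [/\ s < r, distr (OO s r) T & mu 0 r nu].

Local Notation "[ 'g' s , r | T , nu ]" :=
  (<< ((s, r, T, nu) : gen) >> : {freeg gen / C}).

(* The inductive limit is presented by generators (the pure tensors) and
   relations (bilinearity, and the transition maps in [s] and in [r]). *)
Inductive dist_rel : set {freeg gen / C} :=
| rel_adm (z : gen) : ~ admissible z -> dist_rel << z >>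
| rel_linl s r a T T' nu :
    s < r -> distr (OO s r) T -> distr (OO s r) T' -> mu 0 r nu ->
    dist_rel ([g s, r | a *: T + T', nu]
              - (a *: [g s, r | T, nu] + [g s, r | T', nu]))
| rel_linr s r a T nu nu' :
    s < r -> distr (OO s r) T -> mu 0 r nu -> mu 0 r nu' ->
    dist_rel ([g s, r | T, a *: nu + nu']
              - (a *: [g s, r | T, nu] + [g s, r | T, nu']))
| rel_low s' s r T nu :
    s' < s -> s < r -> distr (OO s r) T -> mu 0 r nu ->
    dist_rel ([g s, r | T, nu] - [g s', r | dir_image s' s r T, nu])
| rel_high s r r' T nu' m :
    s < r -> r < r' -> distr (OO s r) T -> mu 0 r' nu' -> haar (OO r r') m ->
    dist_rel ([g s, r | T, tensor 0 r' r nu' (m, 0)]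
              - [g s, r' | inv_image s r r' T m, nu']).

Definition distK : Type := lquot dist_rel.
HB.instance Definition _ := GRing.Lmodule.on distK.

Definition dtens (s r : int) (T : dist) (nu : relm) : distK :=
  lclass dist_rel [g s, r | T, nu].

(* The linear map sending the class of a generator [z] to [h z]; it is only
   used for [h] compatible with the relations. *)
Definition dlift (h : gen -> distK) (x : distK) : distK :=
  fglift h (repr (x : lquot dist_rel)).

(* The integer [b] with gO = O(b). *)
Definition ordK (g : K) : int := xget 0 [set b | [set g * x | x in O 0] = O b].

(* The action of a pair (g, m), with m in mu(O | gO). *)
Definition actK (g : K) (m : relm) : distK -> distK :=
  dlift (fun z => let: (s, r, T, nu) := z in
    let b := ordK g in
    dtens (s + b) (r + b) (dpush ( *%R g) T)
      (tensor 0 b (r + b) m (rpush ( *%R g) ( *%R g^-1) nu))).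

(* The automorphism R_d of [K]; on F_q((u))((t)) it is
   \sum a_ij u^i t^j |-> \sum a_ij u^(i + jd) t^j. *)
Definition Raut (d : int) (x : K) : K :=
  lseries X (fun n => lcoef X x n * u ^ (n * d)).

Definition actR (d : int) : distK -> distK :=
  dlift (fun z => let: (s, r, T, nu) := z in
    dtens s r (dpush (Raut d) T) (rpush (Raut d) (Raut (- d)) nu)).

Definition heis : Type := (int * int * int)%type.

Definition heis_mul (x y : heis) : heis :=
  let: (a1, b1, c1) := x in let: (a2, b2, c2) := y in
  (a1 + a2, b1 + b2, c1 + c2 + a1 * b2).

(* (a, b, c) is the class of (u^a t^b, q^(-c) mu_{B,0,b}) modulo O'^*; on the
   O'^*-invariant elements the choice of this representative is immaterial. *)
Definition actG (x : heis) : distK -> distK :=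
  let: (a, b, c) := x in
  actK (uK ^ a * tK ^ b) ((q%:R : C) ^ (- c) *: muB 0 b).

Definition heisR : Type := (int * int * int * int)%type.

Definition actGt (x : heisR) (V : distK) : distK :=
  let: (a, b, c, d) := x in actG (a, b, c) (actR d V).

Definition rdist : Type := (k -> C^o) -> C^o.
HB.instance Definition _ := GRing.Lmodule.on rdist.

Definition unit_inv_dist : set rdist :=
  [set phi | distr resG phi /\
     forall h, h != 0 -> Ok h -> Ok h^-1 -> dpush ( *%R h) phi = phi].

(* t^l(phi), where O(l)/O(l+1) = t^l O/O(1) *)
Definition shift_dist (l : int) (phi : rdist) : dist :=
  on_dom (test (OO l (l + 1)))
    (fun f => phi (fun x => f (tK ^ l * lconst X x))).

Definition phil (phi : rdist) (l : int) : distK :=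
  dtens l (l + 1) (shift_dist l phi) (muB 0 (l + 1)).

Definition Psi : set distK :=
  lspan [set phil phi l | phi in unit_inv_dist & l in setT].

Section Alpha.
Context (alpha : C).

Definition Phi : set rdist :=
  [set phi | unit_inv_dist phi /\ dpush ( *%R u) phi = alpha *: phi].

Definition is_g (g : rdist) : Prop := Phi g /\ g (\1_Ok) = 1.

(* A character of the subgroup of the (a, 0, c). *)
Definition sigma (a c : int) : C := (q%:R : C) ^ (- c - a) * alpha ^ a.

(* Psi_alpha; the inverse of (a, 0, c) is (-a, 0, -c). *)
Definition Psi_ind : set (heis -> rdist) :=
  [set f | [/\ forall x, Phi (f x),
               forall x a c, f (heis_mul x (a, 0, c)) = sigma (- a) (- c) *: f x
             & exists s : seq heis, forall x, f x != 0 ->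
                 exists2 y, y \in s & exists a c, x = heis_mul y (a, 0, c)]].

(* Delta(m, phi), evaluated at (a, b, c) = (0, b, 0)(a, 0, c). *)
Definition Delta (m : int) (phi : rdist) : heis -> rdist :=
  fun x => let: (a, b, c) := x in
    if b == m then sigma (- a) (- c) *: phi else 0.

Definition beta (f : heis -> rdist) : distK :=
  \sum_(m \in setT) phil (f (0, m, 0)) m.

Definition beta_Psi : set distK := beta @` Psi_ind.

Definition dist_basis (g : rdist) (l : int) : distK := beta (Delta l g).

(* [M] is the matrix of [x] in beta(Psi_alpha) for the distinguished basis. *)
Definition matrix_of (g : rdist) (x : heisR) (M : int -> int -> C) : Prop :=
  is_matrix beta_Psi (dist_basis g) (actGt x) M.

(* Tr_alpha(x) exists and is equal to [T]. *)
Definition is_trace (g : rdist) (x : heisR) (T : C) : Prop :=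
  exists2 M, matrix_of g x M &
    partial_sum (fun l => M l l : C^o) @ totally --> (T : C^o).

End Alpha.

End TwoDimensional.

Arguments Psi R {p q} S.
Arguments beta_Psi {R p q} S alpha.

(* Main.v *)
(* On a homogeneous distribution phi of degree alpha, the element (a, b, c, d)
   of the extended Heisenberg group sends phi_l to an explicit multiple of
   phi_(l+b): the factors alpha^(a + dl) come from the homogeneity of phi, and
   the powers of q from the scaling of the Haar measures of the O(s)/O(r),
   computed one graded piece O(i)/O(i+1) at a time. Hence its matrix in the
   basis (g_alpha)_l is supported on one diagonal, which is the main one iff b
   = 0. The (g_alpha)_l are linearly independent because (1, 0, 0, 0) acts on
   them with distinct eigenvalues and a linear form on the inductive limit,
   evaluation on the characteristic functions of B, takes the value 1 on each
   of them. The homogeneous distributions of a given degree form a line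
   because the units act transitively on the cosets of a small ball contained
   in a sphere. For alpha = 1, where g_alpha is the Dirac distribution at 0,
   the diagonal entries are positive, so that the trace for b = 0 does not
   vanish identically in alpha. *)

Require Import Defs.
From mathcomp Require Import all_boot all_order all_algebra finmap.
From mathcomp Require Import fieldext complex.
From mathcomp Require Import boolp classical_sets functions cardinality fsbigop.
From mathcomp Require Import reals topology normedtype summability.
From mathcomp Require Import numfun freeg zify ring.

Set Implicit Arguments.
Unset Strict Implicit.
Unset Printing Implicit Defensive.

Import Order.TTheory GRing.Theory Num.Theory.
Import numFieldNormedType.Exports.

Local Open Scope classical_set_scope.
Local Open Scope ring_scope.

(** * Filtered groups and their test functions *)

(** The objects are encoded by choice with default values and by an inductive presentation:
    functionals are extended by 0, products of relative measures form a relation with six cases, and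
    the limit is a free module modulo relations. The proof therefore works in coordinates: [muB]
    spans each line mu(O(r)|O(s)) and products multiply coordinates, so that compatibilities become
    identities between scalars. The topology of the quotients enters once, to show that a test
    function is invariant under one subgroup of the filtration and supported in another;
    distributions are then evaluated by finite sums over cosets. That the trace is 0 iff b is
    nonzero needs an interpretation, because at a single alpha it fails: for a = 0, b = 0, d = 1 and
    alpha = -1 the terms of index l and -1 - l cancel. It is proved in two readings, for the trace
    as a function of alpha and for the formal sum of the diagonal entries. *)

Section FilteredGroup.
Context (V : zmodType) (A : subquot V).
Local Notation U := (nbh A).

(** Common interface of O(s)/O(r) and of the residue field: a decreasing exhaustive chain of
    subgroups, with finite successive quotients and complete. It stands in for local compactness. *)
Record filtered : Prop := Filtered {
  nbh0 : forall n, U n 0;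
  nbhB : forall n x y, U n x -> U n y -> U n (x - y);
  nbhS : forall n, U (n + 1) `<=` U n;
  numE : forall x, num A x <-> exists n, U n x;
  den_nbh : forall n, den A `<=` U n;
  nbh_finite : forall n, exists s : seq V,
    forall x, U n x -> exists2 t, t \in s & U (n + 1) (x - t);
  nbh_complete : forall x : nat -> V,
    (forall i : nat, U i (x i.+1 - x i)) ->
    exists y, forall i : nat, U i (y - x i)
}.

Hypothesis FA : filtered.

Lemma nbhN n x : U n x -> U n (- x).
Proof. by rewrite -sub0r; apply: nbhB => //; exact: nbh0. Qed.

Lemma nbhD n x y : U n x -> U n y -> U n (x + y).
Proof. by move=> ? /nbhN; rewrite -[in X in _ -> X](opprK y); exact: nbhB. Qed.

Lemma nbh_subC n x y : U n (x - y) -> U n (y - x).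
Proof. by move=> /nbhN; rewrite opprB. Qed.

Lemma nbh_trans n y x z : U n (x - y) -> U n (y - z) -> U n (x - z).
Proof. by move=> h1 h2; have := nbhD h1 h2; rewrite addrA subrK. Qed.

Lemma nbhDr n x y : U n y -> U n (x + y) <-> U n x.
Proof.
by move=> Uy; split=> [h|?]; [rewrite -(addrK y x); exact: nbhB|exact: nbhD].
Qed.

Lemma nbh_le m n : m <= n -> U n `<=` U m.
Proof.
move=> mn; have -> : n = m + `|n - m|%N by lia.
elim: `|n - m|%N => [|i IH]; first by rewrite [m + _]addr0.
by move=> x; rewrite -addn1 PoszD addrA => /(nbhS FA)/IH.
Qed.

Lemma nbh_cover m n : exists s : seq V,
  forall x, U m x -> exists2 t, t \in s & U n (x - t).
Proof.
case: (leP n m) => [nm|/ltW mn].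
  exists [:: 0] => x /(nbh_le nm) ?; exists 0; first by rewrite inE.
  by rewrite subr0.
have -> : n = m + `|n - m|%N by lia.
elim: `|n - m|%N => [|i [s IH]].
  exists [:: 0] => x ?; exists 0; first by rewrite inE.
  by rewrite [x - 0]subr0 [m + _]addr0.
have [s' Hs'] := nbh_finite FA (m + i).
exists [seq t + t' | t <- s, t' <- s'] => x /IH [t ts /Hs' [t' ts' h]].
exists (t + t'); first by apply/allpairsP; exists (t, t').
by rewrite -addn1 PoszD addrA opprD addrA.
Qed.

(** The translates are only declared to be a subbase. Since the chain decreases, a finite
    intersection of cosets through x contains the coset of the largest index. *)
Lemma sqtop_nbhs (x : sqtop A) (W : set (sqtop A)) :
  nbhs x W <-> exists n, forall y, U n (y - x) -> W y.
Proof.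
split=> [|[n Wn]].
  rewrite nbhsE /= => -[B [[D' sD' <-] [I DI Ix]] sB].
  have [J sJ JI] := sD' _ DI.
  have key : forall j, j \in J -> exists n, forall y, U n (y - x) -> j y.
    move=> j jJ; have : j x by move: Ix; rewrite -JI => /(_ j jJ).
    have := sJ _ jJ; rewrite inE => -[z [n ->]] /= xz; exists n => y yx.
    exact: nbh_trans yx xz.
  have [n Hn] : exists n, forall j, j \in J ->
      forall y, U n (y - x) -> j y.
    suff Hs (s : seq (set V)) : (forall j, j \in s ->
        exists n, forall y, U n (y - x) -> j y) ->
        exists n, forall j, j \in s -> forall y, U n (y - x) -> j y.
      by apply: (Hs (enum_fset J)).
    elim: s => [|j s IH] Hs; first by exists 0.
    have [j1 j1s|n Hn] := IH; first by apply: Hs; rewrite inE j1s orbT.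
    have [n' Hn'] := Hs j (mem_head _ _).
    exists (Order.max n n') => j1; rewrite inE => /orP[/eqP ->|j1s] y yx.
      by apply: Hn'; apply: nbh_le yx; rewrite le_max lexx orbT.
    by apply: Hn => //; apply: nbh_le yx; rewrite le_max lexx.
  exists n => y yx; apply: sB; exists I => //.
  suff : I y by [].
  by rewrite -JI => j jJ; exact: Hn yx.
rewrite nbhsE; exists [set y | U n (y - x)] => //; split; last first.
  by rewrite /= subrr; exact: nbh0.
exists [set [set y | U n (y - x)]].
  move=> _ ->; exists [fset ([set y | U n (y - x)] : set V)]%fset.
    by move=> j /fset1P ->; apply/mem_set; exists x, n.
  rewrite predeqE => y; split=> [/(_ [set y | U n (y - x)])|h j /fset1P -> //].
  by apply; exact/fset1P.
by rewrite bigcup_set1.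
Qed.

(** By finiteness of the successive quotients, an ultrafilter on [U m] contains a coset of each
    [U n]; representatives of these cosets form a Cauchy sequence, and the ultrafilter converges to
    its limit. *)
Lemma compact_nbh m : compact (U m : set (sqtop A)).
Proof.
rewrite compact_ultra => /= F UF Fm.
have coset n : exists t, F [set x | U n (x - t)].
  have [s Hs] := nbh_cover m n; apply: contrapT => nF.
  suff : F set0 by apply: filter_not_empty.
  have : F (U m `&` [set x | forall t, t \in s -> ~ U n (x - t)]).
    apply: filterI => //; elim: s {Hs} => [|t s IH].
      by apply: filterS filterT => x _ t.
    have : F (~` [set x | U n (x - t)]).
      have [Ft|//] := in_ultra_setVsetC [set x | U n (x - t)] UF.
      by case: nF; exists t.
    move=> Ft; apply: filterS (filterI IH Ft) => x [h h'] t1.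
    by rewrite inE => /orP[/eqP ->|/h].
  by apply: filterS => x [/Hs [t ts ht]] /(_ _ ts).
have [c Hc] := choice coset.
have [i|y Hy] := nbh_complete FA (x := fun i => c i%:Z).
  have [x [h1 h2]] := filter_ex (filterI (Hc i%:Z) (Hc i.+1%:Z)).
  apply: (nbh_trans (y := x)); last exact: h1.
  by apply: nbh_subC; apply: nbh_le h2; lia.
have Fy n : F [set x | U n (x - y)].
  have := Hc `|n|%N%:Z; apply: filterS => x h.
  apply: (@nbh_le _ `|n|%N%:Z); first by lia.
  by apply: nbh_trans h _; apply: nbh_subC; exact: Hy.
exists y; split; last first.
  by move=> W /sqtop_nbhs [n Wn]; apply: filterS (Fy n).
have [x [h1 h2]] := filter_ex (filterI Fm (Fy m)).
by rewrite -(subrK x y); apply: nbhD => //; exact: nbh_subC.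
Qed.

End FilteredGroup.

Section TestFunctions.
Context (R : realType) (V : zmodType) (A : subquot V).
Hypothesis FA : filtered A.
Local Notation C := R[i].
Local Notation U := (nbh A).
Implicit Types f g : V -> C^o.

Definition tame n m f : Prop :=
  (forall x y, U n y -> f (x + y) = f x) /\ (forall x, ~ U m x -> f x = 0).

Lemma tame_le n m n' m' f : n <= n' -> m' <= m -> tame n m f -> tame n' m' f.
Proof.
move=> nn mm [h1 h2]; split=> [x y /(nbh_le FA nn)|x nUx]; first exact: h1.
by apply: h2 => /(nbh_le FA mm).
Qed.

Lemma tame_join n m n' m' f g : tame n m f -> tame n' m' g ->
  exists N M, tame N M f /\ tame N M g.
Proof.
move=> tf tg; exists (Order.max n n'), (Order.min m m').
by split; [apply: tame_le tf|apply: tame_le tg];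
  rewrite ?le_max ?ge_min lexx ?orbT.
Qed.

(** Compactness of the support, in its covering form, makes a local index uniform. The property
    [P i] joins invariance under [U i] with membership in [U (- i)]; both weaken as i grows, so a
    single index yields the level of invariance and the bound on the support. *)
Lemma tameP f : test A f <-> exists n m, tame n m f.
Proof.
split=> [[f_num f_den f_cst /compact_near_coveringP f_cpt]|[n [m [h1 h2]]]].
  pose P (i : nat) (x : sqtop A) :=
    (forall y, U i y -> f (x + y) = f x) /\ U (- i%:Z) x.
  have [x fx|n _ Hn] := f_cpt nat \oo P _.
    have /(numE FA) [k Uk] : num A x.
      by apply: contrapT => /f_num; exact/eqP.
    have /(sqtop_nbhs FA) [n Hn] := f_cst x.
    pose i0 := maxn `|n|%N `|k|%N.
    exists ([set y | U i0%:Z (y - x)], [set i : nat | (i0 <= i)%N]) => /=.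
      by split; [apply/(sqtop_nbhs FA); exists i0%:Z|exists i0].
    have i0n : n <= i0%:Z by rewrite /i0; lia.
    have i0k : - i0%:Z <= k by rewrite /i0; lia.
    move=> [x' i] /= [Ux' i0i]; split=> [y Uy|].
      rewrite (Hn x') ?Hn //; last exact: nbh_le Ux'.
      rewrite addrAC; apply: nbhD => //; first exact: nbh_le Ux'.
      by apply: nbh_le Uy => //; apply: le_trans i0n _.
    rewrite -(subrK x x'); apply: nbhD => //.
      by apply: nbh_le Ux' => //; lia.
    by apply: nbh_le Uk => //; lia.
  have {}Hn := Hn n (leqnn n); exists n%:Z, (- n%:Z); split=> [x y Uy|x].
    have [fx|] := pselect (f x != 0); first by have [+ _] := Hn x fx; apply.
    (* The uniform index is only known on the support: if x is outside it but x + y is inside,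
       invariance is applied at x + y with - y. *)
    move=> /negP/negPn/eqP fx; have [fxy|] := pselect (f (x + y) != 0).
      have [/(_ (- y)) + _] := Hn _ fxy; rewrite addrK => -> //.
      exact: nbhN.
    by move=> /negP/negPn/eqP ->.
  by apply: contra_notP => /eqP fx; have [] := Hn x fx.
split=> [x nx|x y /(den_nbh FA n)|x|].
- by apply: h2 => Ux; apply: nx; apply/(numE FA); exists m.
- exact: h1.
- by apply/(sqtop_nbhs FA); exists n => y /(h1 x); rewrite subrKC.
apply: (subclosed_compact _ (compact_nbh FA (m := m))) => [|x].
  rewrite -[X in closed X]setCK; apply: open_closedC.
  rewrite openE => x /= fx; rewrite /interior.
  by apply/(sqtop_nbhs FA); exists n => y /(h1 x); rewrite subrKC /= => ->.
by apply: contraPP => /= /h2 ->; rewrite eqxx.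
Qed.

Lemma test_lin (a : C) f g : test A f -> test A g -> test A (a *: f + g).
Proof.
move=> /tameP [n [m tf]] /tameP [n' [m' tg]].
have [N [M [[f1 f2] [g1 g2]]]] := tame_join tf tg.
apply/tameP; exists N, M; split=> [x y Uy|x Ux].
  by rewrite !fctE f1 // g1.
by rewrite !fctE f2 // g2 // scaler0 addr0.
Qed.

Lemma subspace_test : Defs.subspace (test A : set (V -> C^o)).
Proof.
split=> [|a f g]; last exact: test_lin.
by apply/tameP; exists 0, 0; split.
Qed.

Lemma test_shift a f : num A a -> test A f -> test A (fun x => f (x + a)).
Proof.
move=> /(numE FA) [k Uk] /tameP [n [m [h1 h2]]]; apply/tameP.
exists n, (Order.min k m); split=> [x y Uy|x nUx];
  first by rewrite /= [x + y + a]addrAC; exact: h1.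
apply: h2 => Uxa; apply: nUx; rewrite -(addrK a x).
by apply: nbhB => //; [apply: nbh_le Uxa|apply: nbh_le Uk] => //;
  rewrite ge_min lexx ?orbT.
Qed.

Lemma tame_coset n m a : m <= n -> U m a ->
  tame n m (\1_[set x | U n (x - a)] : V -> C^o).
Proof.
move=> mn Ua; split=> [x y Uy|x nUx].
  rewrite !indicE; congr (_%:R); congr nat_of_bool; apply/idP/idP.
    by rewrite !inE /= addrAC => /(nbhDr FA _ Uy).
  by rewrite !inE /= addrAC => h; apply/(nbhDr FA _ Uy).
rewrite indicE memNset //= => h; apply: nUx.
by rewrite -(subrK a x); apply: nbhD => //; exact: nbh_le h.
Qed.

End TestFunctions.

(** * Haar measures on filtered groups *)

Section LinearDual.
Context (C : nzRingType) (V : lmodType C) (D : set V) (T : V -> C^o).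
Hypotheses (sD : Defs.subspace D) (DT : ldual D T).

Lemma subspace_sum (I : eqType) (s : seq I) (c : I -> C) (f : I -> V) :
  (forall i, i \in s -> D (f i)) -> D (\sum_(i <- s) c i *: f i).
Proof.
elim: s => [|i s IH] Ds; first by rewrite big_nil; exact: sD.1.
rewrite big_cons; apply: sD.2; first by apply: Ds; rewrite mem_head.
by apply: IH => j js; apply: Ds; rewrite inE js orbT.
Qed.

Lemma subspaceZ a x : D x -> D (a *: x).
Proof. by move=> Dx; rewrite -[a *: x]addr0; apply: sD.2 => //;
  exact: sD.1. Qed.

Lemma ldual0 : T 0 = 0.
Proof.
have := DT.1 1 0 0 sD.1 sD.1; rewrite scaler0 addr0 mul1r => /eqP.
by rewrite -subr_eq0 opprD addNKr oppr_eq0 => /eqP.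
Qed.

Lemma ldualZ a x : D x -> T (a *: x) = a * T x.
Proof.
by move=> Dx; rewrite -[a *: x]addr0 DT.1 ?ldual0 ?addr0 //; exact: sD.1.
Qed.

Lemma ldual_sum (I : eqType) (s : seq I) (c : I -> C) (f : I -> V) :
  (forall i, i \in s -> D (f i)) ->
  T (\sum_(i <- s) c i *: f i) = \sum_(i <- s) c i * T (f i).
Proof.
elim: s => [|i s IH] Ds; first by rewrite !big_nil ldual0.
have Ds' j : j \in s -> D (f j) by move=> js; apply: Ds; rewrite inE js orbT.
rewrite !big_cons DT.1 ?IH //; first by apply: Ds; rewrite mem_head.
exact: subspace_sum.
Qed.

End LinearDual.

Section Haar.
Context (R : realType) (V : zmodType) (A : subquot V).
Hypothesis FA : filtered A.
Local Notation C := R[i].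
Local Notation U := (nbh A).
Implicit Types f g : V -> C^o.

(** Choosing from the coset as a set gives congruent elements the same representative, so the range
    is a transversal of [U n]. *)
Definition crep n x : V := xget 0 [set y | U n (x - y)].

Definition reps n : set V := range (crep n).

Lemma crepP n x : U n (x - crep n x).
Proof.
rewrite /crep; case: xgetP => [y -> //|/(_ x)]; case.
by rewrite /= subrr; exact: nbh0.
Qed.

Lemma crep_eq n x y : U n (x - y) -> crep n x = crep n y.
Proof.
move=> Uxy; rewrite /crep; congr xget; apply/seteqP; split=> z /= Uz.
  exact: nbh_trans (nbh_subC FA Uxy) Uz.
exact: nbh_trans Uxy Uz.
Qed.

Lemma crep_reps n x : reps n x -> crep n x = x.
Proof. by move=> [y _ <-]; apply: crep_eq; apply: nbh_subC => //;
  exact: crepP. Qed.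

Lemma reps_inj n x y : reps n x -> reps n y -> U n (x - y) -> x = y.
Proof. by move=> /crep_reps {2}<- /crep_reps {2}<-; exact: crep_eq. Qed.

Lemma crep_nbh n m x : m <= n -> U m x -> U m (crep n x).
Proof.
move=> mn Ux; rewrite -(subKr x (crep n x)); apply: nbhB => //.
by apply: (nbh_le FA mn); exact: crepP.
Qed.

Lemma reps_crep n m x : m <= n -> U m x -> (reps n `&` U m) (crep n x).
Proof. by move=> mn Ux; split; [exists x|exact: crep_nbh]. Qed.

Lemma finite_reps n m : finite_set (reps n `&` U m).
Proof.
have [s Hs] := nbh_cover FA m n.
apply: (sub_finite_set (B := [set` map (crep n) s])); last exact: finite_seq.
move=> x [rx /Hs [t ts Uxt]] /=; apply/mapP; exists t => //.
by rewrite -(crep_reps rx); exact: crep_eq.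
Qed.

Definition csum n f : C := \sum_(y \in reps n) f y.

Lemma csumE n m f : tame A n m f -> csum n f = \sum_(y \in reps n `&` U m) f y.
Proof.
move=> [_ f0]; apply/esym/fsbig_widen => [x []//|x [rx nx]].
by apply: f0 => Ux; apply: nx.
Qed.

Lemma csum_lin n m (a : C) f g : tame A n m f -> tame A n m g ->
  csum n (a *: f + g) = a * csum n f + csum n g.
Proof.
move=> tf tg; have tfg : tame A n m (a *: f + g).
  split=> [x y Uy|x nUx]; first by rewrite !fctE tf.1 // tg.1.
  by rewrite !fctE tf.2 // tg.2 // scaler0 addr0.
rewrite !(csumE (m := m)) // mulr_fsumr -fsbig_split; last exact: finite_reps.
by apply: eq_fsbigr.
Qed.

Definition index n : C := \sum_(y \in reps (n + 1) `&` U n) (1 : C).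

Lemma csumS n m f : tame A n m f -> csum (n + 1) f = index n * csum n f.
Proof.
(* With m <= n the subgroup [U n] lies in [U m], so that refining a coset does not leave [U m]. *)
move=> tf; wlog mn : m tf / m <= n.
  move=> H; apply: (H (Order.min m n)); last by rewrite ge_min lexx orbT.
  by apply: tame_le tf; rewrite ?ge_min ?lexx.
have nn : n <= n + 1 by lia.
rewrite (csumE (m := m)); last by apply: tame_le tf.
rewrite (csumE tf) mulrC mulr_fsuml.
rewrite [RHS](eq_fsbigr (fun y : V => \sum_(t \in reps (n + 1) `&` U n)
    (f y : C) * 1)); last by move=> y _; exact: mulr_fsumr.
rewrite [RHS]pair_fsbig; [|exact: finite_reps|exact: finite_reps].
(* A coset of [U (n + 1)] amounts to a coset of [U n] and a position inside it. Representatives are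
   not stable under addition, hence the outer [crep]. *)
pose h (z : V * V) := crep (n + 1) (z.1 + z.2).
rewrite (reindex_fsbig h ((reps n `&` U m) `*` (reps (n + 1) `&` U n))).
  apply: eq_fsbigr => -[y t] /set_mem [[ry Uy] [rt Ut]] /=; rewrite mulr1.
  rewrite /h /= -(subrKC (y + t) (crep _ _)) -addrA tf.1 //.
  apply: nbhD => //; apply: (nbh_le FA nn); apply: nbh_subC => //.
  exact: crepP.
split=> [[y t] [[ry Uy] [rt Ut]]|[y t] [y' t'] /set_mem [[ry Uy] [rt Ut]]
  /set_mem [[ry' Uy'] [rt' Ut']]|z [rz Uz]].
- apply: reps_crep; first by lia.
  by apply: nbhD => //; exact: nbh_le Ut.
- rewrite /= in ry Uy rt Ut ry' Uy' rt' Ut'.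
  rewrite /h /= => e; have Uyt : U (n + 1) ((y + t) - (y' + t')).
    apply: nbh_trans (crepP _ _) _ => //; rewrite e; apply: nbh_subC => //.
    exact: crepP.
  have yy' : y = y'.
    apply: (reps_inj ry ry').
    have -> : y - y' = ((y + t) - (y' + t')) + (t' - t).
      by rewrite opprD [y + t + _]addrACA -[RHS]addrA -[t' - t]opprB subrr
        addr0.
    by apply: nbhD => //; [exact: nbh_le Uyt|exact: nbhB].
  rewrite yy'; congr pair; apply: (reps_inj rt rt').
  by move: Uyt; rewrite yy' opprD addrACA subrr add0r.
- exists (crep n z, crep (n + 1) (z - crep n z)).
    split; first exact: reps_crep.
    by apply: reps_crep => //; exact: crepP.
  rewrite /h /= -[RHS](crep_reps rz); apply: crep_eq => //.
  by apply: nbh_subC => //; rewrite opprD addrA; exact: crepP.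
Qed.

Lemma csum_shift n m f a : tame A n m f -> U m a -> m <= n ->
  csum n (fun x => f (x + a)) = csum n f.
Proof.
move=> tf Ua mn; rewrite (csumE tf) (csumE (m := m)); last first.
  split=> [x y Uy|x nUx]; first by rewrite addrAC; exact: tf.1.
  by apply: tf.2 => /(nbhDr FA _ Ua).
rewrite [RHS](reindex_fsbig (fun y => crep n (y + a)) (reps n `&` U m)).
  apply: eq_fsbigr => y _; rewrite -[RHS](tf.1 _ (y + a - crep n (y + a))).
    by rewrite subrKC.
  exact: crepP.
split=> [y [ry Uy]|y y' /set_mem [ry Uy] /set_mem [ry' Uy'] e|z [rz Uz]].
- by apply: reps_crep => //; exact: nbhD.
- apply: (reps_inj ry ry').
  have : U n ((y + a) - (y' + a)).
    apply: nbh_trans (crepP _ _) _ => //; rewrite e; apply: nbh_subC => //.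
    exact: crepP.
  by rewrite opprD addrACA subrr addr0.
- exists (crep n (z - a)); first by apply: reps_crep => //; exact: nbhB.
  rewrite -[RHS](crep_reps rz); apply: crep_eq => //.
  have := crepP n (z - a) => /(nbh_subC FA).
  by rewrite opprB addrA addrAC.
Qed.

Lemma tame_nbh m n : m <= n -> tame A n m (\1_(U m) : V -> C^o).
Proof.
move=> mn; apply: (tame_le FA mn (lexx m)).
have := tame_coset R FA (lexx m) (nbh0 FA m).
rewrite (_ : [set x | U m (x - 0)] = U m) //.
by apply/seteqP; split=> x /=; rewrite subr0.
Qed.

Lemma csum_nbh m n : m <= n ->
  csum n (\1_(U m) : V -> C^o) = \sum_(y \in reps n `&` U m) (1 : C).
Proof.
move=> mn; rewrite (csumE (tame_nbh mn)).
by apply: eq_fsbigr => y /set_mem [_ Uy]; rewrite indicE mem_set.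
Qed.

Lemma card_reps_neq0 m n : m <= n ->
  \sum_(y \in reps n `&` U m) (1 : C) != 0.
Proof.
move=> mn; rewrite fsbig_finite; last exact: finite_reps.
rewrite big_const_seq count_predT iter_addr_0 pnatr_eq0 size_eq0.
apply/eqP => /(congr1 (fun s : seq V => crep n 0 \in s)).
rewrite in_nil in_fset_set; last exact: finite_reps.
by rewrite mem_set //; apply: reps_crep => //; exact: nbh0.
Qed.

Lemma index_neq0 n : index n != 0.
Proof. by apply: card_reps_neq0; lia. Qed.

(* The quotient does not depend on [n]: both sums are multiplied by the index
   of [U (n + 1)] in [U n] when [n] is replaced by [n + 1]. *)
Definition haar_int : (V -> C^o) -> C^o := on_dom (test A) (fun f =>
  let n : nat := xget 0%N [set n : nat | exists m, tame A n m f] in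
  csum n f / csum n (\1_(U 0) : V -> C^o)).

Lemma haar_intE (n : nat) m f : tame A n m f ->
  haar_int f = csum n f / csum n (\1_(U 0) : V -> C^o).
Proof.
have step (i j : nat) k : tame A i k f ->
    csum (i + j)%N%:Z f / csum (i + j)%N%:Z (\1_(U 0) : V -> C^o) =
    csum i f / csum i (\1_(U 0) : V -> C^o).
  move=> tf; elim: j => [|j IH]; first by rewrite addn0.
  rewrite addnS -addn1 PoszD (csumS (m := k)); last first.
    by apply: tame_le tf => //; lia.
  rewrite (csumS (m := 0)); last by apply: tame_nbh; lia.
  by rewrite -mulf_div divff ?mul1r //; exact: index_neq0.
move=> tf; rewrite /haar_int /on_dom asboolT; last by apply/(tameP FA);
  exists n, m.
case: xgetP => [i _ /= [k tf']|/(_ n)]; last by case; exists m.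
have [ni|/ltnW ni] := leqP n i.
  by rewrite -(subnKC ni) (step _ _ m).
by rewrite -(subnKC ni) (step _ _ k).
Qed.

Lemma test_tame f : test A f -> exists (n : nat) m, tame A n m f.
Proof.
move=> /(tameP FA) [n [m tf]]; exists `|n|%N, m.
by apply: tame_le tf => //; lia.
Qed.

Lemma distr_haar_int : distr A haar_int.
Proof.
split=> [a f g /test_tame [n [m tf]] /test_tame [n' [m' tg]]|f nf]; last first.
  by rewrite /haar_int /on_dom asboolF.
pose N := maxn n n'; pose M := Order.min m m'.
have {}tf : tame A N M f.
  by apply: tame_le tf => //; rewrite /N /M ?ge_min ?lexx //; lia.
have {}tg : tame A N M g.
  by apply: tame_le tg => //; rewrite /N /M ?ge_min ?lexx ?orbT //; lia.
have tfg : tame A N M (a *: f + g).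
  split=> [x y Uy|x nUx]; first by rewrite !fctE tf.1 // tg.1.
  by rewrite !fctE tf.2 // tg.2 // scaler0 addr0.
rewrite (haar_intE tf) (haar_intE tg) (haar_intE tfg) (csum_lin _ tf tg).
by rewrite mulrDl mulrA.
Qed.

Lemma haar_haar_int : haar A haar_int.
Proof.
split=> [|a f /(numE FA) [k Uk] /test_tame [n [m tf]]];
  first exact: distr_haar_int.
pose M := Order.min (Order.min k m) n.
have {}tf : tame A n M f.
  by apply: tame_le tf => //; rewrite /M !ge_min lexx orbT.
have Ua : U M a by apply: nbh_le Uk => //; rewrite /M !ge_min lexx.
rewrite (haar_intE tf) (haar_intE (n := n) (m := M)).
  by rewrite (csum_shift tf) // /M !ge_min lexx orbT.
split=> [x y Uy|x nUx]; first by rewrite /= [x + y + a]addrAC; exact: tf.1.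
by apply: tf.2 => /(nbhDr FA _ Ua).
Qed.

Lemma haar_int_nbh0 : haar_int (\1_(U 0)) = 1.
Proof.
rewrite (haar_intE (n := 0%N) (m := 0)); last exact: tame_nbh.
by rewrite divff // csum_nbh // card_reps_neq0.
Qed.

Lemma haar_coset (m : (V -> C^o) -> C^o) n a : haar A m -> num A a ->
  m (\1_[set x | U n (x - a)]) = m (\1_(U n)).
Proof.
move=> Hm na.
have tU : test A (\1_(U n) : V -> C^o).
  by apply/(tameP FA); exists n, n; exact: tame_nbh.
rewrite -[RHS](Hm.2 (- a)) //.
by have /(numE FA) [k Uk] := na; apply/(numE FA); exists k; exact: nbhN.
Qed.

Lemma tame_decomp n k f : tame A n k f -> k <= n ->
  f = \sum_(y <- fset_set (reps n `&` U k))
        f y *: (\1_[set x | U n (x - y)] : V -> C^o).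
Proof.
move=> tf kn; set s := fset_set _.
have Hs y : y \in s -> reps n y /\ U k y.
  by rewrite in_fset_set; [move/set_mem|exact: finite_reps].
apply/funext => x; rewrite fct_sumE.
have [Ux|nUx] := pselect (U k x); last first.
  rewrite tf.2 // big_seq big1 // => y ys.
  have [_ Uy] := Hs y ys; rewrite !fctE indicE memNset ?scaler0 //=.
  move=> h; apply: nUx; rewrite -(subrK y x); apply: nbhD => //.
  exact: nbh_le h.
have cs : crep n x \in s.
  by rewrite in_fset_set; [apply/mem_set/reps_crep|exact: finite_reps].
rewrite (big_fsetD1 _ cs) /= big_seq big1 => [|y]; last first.
  rewrite in_fsetD1 => /andP[yc /Hs [ry Uy]]; rewrite !fctE indicE memNset.
    by rewrite scaler0.
  move=> /= h; move/eqP: yc; apply; rewrite -(crep_reps ry).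
  by apply: crep_eq; exact: nbh_subC.
rewrite addr0 !fctE indicE mem_set /=; last exact: crepP.
rewrite [_ *: _]mulr1 -[LHS](tf.1 _ (crep n x - x)) ?subrKC //.
by apply: nbh_subC => //; exact: crepP.
Qed.

(** A distribution is determined by its values on indicators of cosets. Uniqueness of Haar measures
    and of homogeneous distributions both rest on this. *)
Lemma distr_decomp (T : (V -> C^o) -> C^o) n k f : distr A T ->
  tame A n k f -> k <= n ->
  T f = \sum_(y <- fset_set (reps n `&` U k))
          f y * T (\1_[set x | U n (x - y)]).
Proof.
move=> DT tf kn; rewrite [in LHS](tame_decomp tf kn).
rewrite (ldual_sum (subspace_test R FA) DT) // => y.
rewrite in_fset_set; last exact: finite_reps.
move=> /set_mem [_ Uy].
by apply/(tameP FA); exists n, k; apply: tame_coset.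
Qed.

Lemma haar_csum (m : (V -> C^o) -> C^o) n k f : haar A m -> tame A n k f ->
  m f = csum n f * m (\1_(U n)).
Proof.
move=> Hm tf; wlog kn : k tf / k <= n.
  move=> H; apply: (H (Order.min k n)); last by rewrite ge_min lexx orbT.
  by apply: tame_le tf; rewrite ?ge_min ?lexx.
rewrite (csumE tf) fsbig_finite; last exact: finite_reps.
rewrite (distr_decomp Hm.1 tf kn) mulr_suml; apply: eq_big_seq => y.
rewrite in_fset_set; last exact: finite_reps.
move=> /set_mem [_ Uy].
by rewrite haar_coset //; last by apply/(numE FA); exists k.
Qed.

Lemma haar_uniq (m : (V -> C^o) -> C^o) : haar A m ->
  m = m (\1_(U 0)) *: haar_int.
Proof.
move=> Hm; apply/funext => f; rewrite !fctE.
have [/test_tame [n [k tf]]|nf] := pselect (test A f); last first.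
  by rewrite Hm.1.2 // distr_haar_int.2 // scaler0.
rewrite (haar_csum Hm tf) (haar_intE tf).
rewrite [m (\1_(U 0))](haar_csum (n := n) (k := 0) Hm); last exact: tame_nbh.
have c0 : csum n (\1_(U 0) : V -> C^o) != 0.
  by rewrite csum_nbh ?card_reps_neq0.
by rewrite [_ *: _]mulrC mulrA divfK.
Qed.

Lemma haar_index (m : (V -> C^o) -> C^o) n : haar A m ->
  m (\1_(U n)) = index n * m (\1_(U (n + 1))).
Proof.
move=> Hm; rewrite (haar_csum (n := n + 1) (k := n) Hm).
  by rewrite csum_nbh //; lia.
by apply: tame_nbh; lia.
Qed.

End Haar.

(** * Laurent series *)

Section Laurent.
Context (k K : fieldType) (X : laurent k K).
Local Notation lc := (lcoef X).
Implicit Types x y : K.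

Lemma lcoef0 n : lc 0 n = 0.
Proof. by have /eqP := lcoefD X 0 0 n; rewrite addr0 addrC -subr_eq subrr =>
  /eqP. Qed.

Lemma lcoefN x n : lc (- x) n = - lc x n.
Proof. by apply/eqP; rewrite -addr_eq0 -lcoefD addNr lcoef0. Qed.

Lemma lcoefB x y n : lc (x - y) n = lc x n - lc y n.
Proof. by rewrite lcoefD lcoefN. Qed.

Lemma lcoef_lseries a N : (forall n, n < N -> a n = 0) ->
  lc (lseries X a) =1 a.
Proof.
move=> aN; rewrite /lseries; case: xgetP => [x _ //|].
by have [x Hx] := lcoef_surj X aN => /(_ x).
Qed.

Lemma lcoef_lconst c n : lc (lconst X c) n = if n == 0 then c else 0.
Proof.
by rewrite (lcoef_lseries (N := 0)) // => m m0; rewrite ifF //; lia.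
Qed.

Lemma lcoef_lvar n : lc (lvar X) n = (n == 1)%:R.
Proof.
rewrite (lcoef_lseries (N := 0)) // => m m0.
by rewrite (_ : m == 1 = false) //; lia.
Qed.

Lemma lcoefM1 x y n i : (forall j, j != i -> lc x j * lc y (n - j) = 0) ->
  lc (x * y) n = lc x i * lc y (n - i).
Proof.
move=> H; rewrite lcoefM (fsbigTE [fset i]%fset) ?big_seq_fset1 // => j.
by rewrite inE; exact: H.
Qed.

Lemma lcoef_lconstM c x n : lc (lconst X c * x) n = c * lc x n.
Proof.
rewrite (lcoefM1 (i := 0)); first by rewrite lcoef_lconst eqxx subr0.
by move=> j j0; rewrite lcoef_lconst (negPf j0) mul0r.
Qed.

Lemma lconst1 : lconst X 1 = 1.
Proof.
rewrite -[LHS]mulr1; apply: (lcoef_inj (l := X)) => n.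
by rewrite lcoef_lconstM mul1r.
Qed.

Lemma lconstM c d : lconst X (c * d) = lconst X c * lconst X d.
Proof.
apply: (lcoef_inj (l := X)) => n.
by rewrite lcoef_lconstM !lcoef_lconst; case: eqP; rewrite ?mulr0.
Qed.

Lemma lconstD c d : lconst X (c + d) = lconst X c + lconst X d.
Proof.
apply: (lcoef_inj (l := X)) => n.
by rewrite lcoefD !lcoef_lconst; case: eqP; rewrite ?addr0.
Qed.

Lemma lconst_eq0 c : (lconst X c == 0) = (c == 0).
Proof.
apply/eqP/eqP => [e|->].
  by have := lcoef_lconst c 0; rewrite e lcoef0.
by apply: (lcoef_inj (l := X)) => n; rewrite lcoef_lconst lcoef0 if_same.
Qed.

Lemma lconstV c : lconst X c^-1 = (lconst X c)^-1.
Proof.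
have [->|c0] := eqVneq c 0; first by rewrite invr0 [RHS]invr_out ?unitfE
  ?lconst_eq0 ?eqxx.
apply: (mulfI (x := lconst X c)); first by rewrite lconst_eq0.
by rewrite -lconstM !divff ?lconst1 // lconst_eq0.
Qed.

Lemma lconstX c (a : int) : lconst X (c ^ a) = lconst X c ^ a.
Proof.
have nat_case (i : nat) : lconst X (c ^+ i) = lconst X c ^+ i.
  by elim: i => [|i IH]; rewrite ?expr0 ?lconst1 // !exprS lconstM IH.
by case: a => i; rewrite ?NegzE -?exprnN -?exprnP ?lconstV nat_case.
Qed.

Lemma lcoef_lvarM x n : lc (lvar X * x) n = lc x (n - 1).
Proof.
rewrite (lcoefM1 (i := 1)); first by rewrite lcoef_lvar eqxx mul1r.
by move=> j j0; rewrite lcoef_lvar (negPf j0) mul0r.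
Qed.

Lemma lvar_neq0 : lvar X != 0.
Proof.
apply/eqP => e; have := lcoef_lvar 1.
by rewrite e lcoef0 eqxx => /eqP; rewrite eq_sym oner_eq0.
Qed.

Lemma lcoef_lvarXM (b : int) x n : lc (lvar X ^ b * x) n = lc x (n - b).
Proof.
have nat_case (i : nat) y m : lc (lvar X ^+ i * y) m = lc y (m - i%:Z).
  elim: i y m => [|i IH] y m; first by rewrite expr0 mul1r subr0.
  by rewrite exprSr -mulrA IH lcoef_lvarM; congr lc; lia.
case: b => i; first by rewrite -exprnP nat_case.
rewrite NegzE -exprnN -[in RHS](mulVKf (x := lvar X ^+ i.+1) _ x).
  by rewrite nat_case; congr lc; lia.
by rewrite expf_neq0 // lvar_neq0.
Qed.

Lemma lfilB i x y : lfil X i x -> lfil X i y -> lfil X i (x - y).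
Proof. by move=> hx hy n ni; rewrite lcoefB hx // hy // subr0. Qed.

Lemma lfil_low i j x y : lfil X i x -> lfil X j y ->
  lfil X (i + j) (x * y) /\ lc (x * y) (i + j) = lc x i * lc y j.
Proof.
move=> hx hy; split=> [n nij|]; last first.
  rewrite (lcoefM1 (i := i)); first by congr (_ * lc _ _); lia.
  move=> m mi; case: (ltP m i) => [/hx ->|im]; first by rewrite mul0r.
  by rewrite (hy (i + j - m)) ?mulr0 //; lia.
rewrite (lcoefM1 (i := i)) => [|m mi]; first by rewrite (hy (n - i)) ?mulr0 //;
  lia.
case: (ltP m i) => [/hx ->|im]; first by rewrite mul0r.
by rewrite (hy (n - m)) ?mulr0 //; lia.
Qed.

Lemma lfil_ord x : x != 0 -> exists n, lfil X n x /\ lc x n != 0.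
Proof.
move=> x0; have [N HN] := lcoef_bounded X x.
have [m Hm] : exists m, lc x m != 0.
  apply: contrapT => nm; case/eqP: x0; apply: (lcoef_inj (l := X)) => m.
  by rewrite lcoef0; apply/eqP/negP => /negP h; apply: nm; exists m.
have ex : exists i : nat, lc x (N + i%:Z) != 0.
  exists `|m - N|%N; rewrite (_ : N + _ = m) //.
  suff : N <= m by lia.
  by rewrite leNgt; apply/negP => /HN /eqP; apply/negP.
exists (N + (ex_minn ex)%:Z); case: ex_minnP => i Hi imin; split=> // n nN.
have [/HN //|Nn] := ltP n N; apply/eqP; apply: contraT => ln.
have := imin `|n - N|%N; rewrite (_ : N + _ = n); last by lia.
by move=> /(_ ln); lia.
Qed.

Lemma lfil_unit x : x != 0 -> exists n y,
  [/\ x = lvar X ^ n * y, y != 0, lfil X 0 y & lfil X 0 y^-1].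
Proof.
move=> x0; have [n [xn lxn]] := lfil_ord x0.
have v0 := expfz_neq0 n lvar_neq0.
pose y := lvar X ^ (- n) * x.
have xE : x = lvar X ^ n * y by rewrite /y -invr_expz mulVKf.
have y0 : y != 0 by move: x0; rewrite xE mulf_eq0 negb_or => /andP[].
have fy : lfil X 0 y by move=> m m0; rewrite lcoef_lvarXM; apply: xn; lia.
exists n, y; split => //.
(* If m is the order of y^-1, then y * y^-1 = 1 has a nonzero coefficient in degree 0 + m, which
   forces m = 0. *)
have [|m [fm lm]] := lfil_ord (x := y^-1); first by rewrite invr_eq0.
have [_] := lfil_low fy fm; rewrite divff // -lconst1 lcoef_lconst add0r.
case: eqP => [m0 _|_ /eqP]; first by move: fm; rewrite m0.
by rewrite eq_sym mulf_eq0 (negPf lm) orbF lcoef_lvarXM sub0r opprK (negPf lxn).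
Qed.

End Laurent.

(** * Local fields *)

(** The properties shared by F_q((u)) and by finite extensions of Q_p from which everything below is
    deduced, so that the two cases separate only in the proof of this interface. *)
Record local_field (q : nat) (k : fieldType) (u : k) (O : set k) : Prop :=
  LocalField {
  unif_neq0 : u != 0;
  unif_int : O u;
  int1 : O 1;
  intB : forall x y, O x -> O y -> O (x - y);
  intM : forall x y, O x -> O y -> O (x * y);
  int_unit : forall x, x != 0 -> exists (n : int) h,
    [/\ x = u ^ n * h, h != 0, O h & O h^-1];
  int_residue : exists (F : finFieldType) (res : k -> F), #|F| = q /\
    [/\ forall x y, O x -> O y -> res (x - y) = res x - res y,
        forall c, exists2 x, O x & res x = c
      & forall x, O x -> (res x = 0 <-> O (u^-1 * x))];
  int_complete : forall x : nat -> k,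
    (forall i : nat, O (u ^ (- i%:Z) * (x i.+1 - x i))) ->
    exists y, forall i : nat, O (u ^ (- i%:Z) * (y - x i))
}.

Section Valuation.
Context (k : fieldType) (v : k -> int).
Hypothesis dv : discrete_valuation v.

Lemma valM x y : x != 0 -> y != 0 -> v (x * y) = v x + v y.
Proof. by case: dv => H _ _; exact: H. Qed.

Lemma val1 : v 1 = 0.
Proof.
have n1 : (1 : k) != 0 by exact: oner_neq0.
by have := valM n1 n1; rewrite mulr1; lia.
Qed.

Lemma valV x : x != 0 -> v x^-1 = - v x.
Proof.
move=> x0; have xV0 : x^-1 != 0 by rewrite invr_eq0.
by have := valM x0 xV0; rewrite divff // val1; lia.
Qed.

Lemma valN x : x != 0 -> v (- x) = v x.
Proof.
have n10 : (-1 : k) != 0 by rewrite oppr_eq0 oner_eq0.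
have v1 : v (-1) = 0 by have := valM n10 n10; rewrite mulrNN mulr1 val1; lia.
by move=> x0; rewrite -mulN1r valM // v1 add0r.
Qed.

Lemma valX x (n : int) : x != 0 -> v (x ^ n) = n * v x.
Proof.
move=> x0; have nat_case (i : nat) : v (x ^+ i) = i%:Z * v x.
  elim: i => [|i IH]; first by rewrite expr0 val1 mul0r.
  by rewrite exprS valM ?expf_neq0 // IH; lia.
case: n => i; first exact: nat_case.
by rewrite NegzE -exprnN valV ?expf_neq0 // nat_case; lia.
Qed.

Lemma vballB n x y : vball v n x -> vball v n y -> vball v n (x - y).
Proof.
case: dv => _ vD _ [->|nx] [->|ny]; rewrite ?subr0 ?sub0r.
- by left.
- by have [->|y0] := eqVneq y 0; [left; rewrite oppr0|right; rewrite valN].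
- by right.
have [xy|xy] := eqVneq (x - y) 0; [by left|right].
have [x0|x0] := eqVneq x 0.
  move: xy; rewrite x0 sub0r oppr_eq0 => y0; by rewrite valN.
have [y0|y0] := eqVneq y 0; first by rewrite y0 subr0.
have := vD x (- y); rewrite oppr_eq0 valN // => /(_ x0 y0 xy).
by apply: le_trans; rewrite le_min nx ny.
Qed.

Lemma vballM n m x y : vball v n x -> vball v m y -> vball v (n + m) (x * y).
Proof.
move=> [->|nx] [->|ny]; rewrite ?mulr0 ?mul0r; try by left.
have [->|x0] := eqVneq x 0; first by left; rewrite mul0r.
have [->|y0] := eqVneq y 0; first by left; rewrite mulr0.
by right; rewrite valM // lerD.
Qed.

End Valuation.

Lemma local_field_complete q (L : fieldType) (w : L -> int) (u : L) :
  discrete_valuation w -> vcomplete w -> has_residue_field w q ->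
  w u = 1 -> u != 0 -> local_field q u (vball w 0).
Proof.
move=> dv cw [F [res [FQ [res1 resDM res_surj res0]]]] wu u0.
have uX n : vball w n (u ^ n) by right; rewrite (valX dv) // wu; lia.
have uM n m x : vball w m x -> vball w (n + m) (u ^ n * x).
  by apply: vballM => //; exact: uX.
have uMV n m x : vball w m (u ^ n * x) -> vball w (m - n) x.
  move=> /(uM (- n)); rewrite -invr_expz mulKf ?expfz_neq0 //.
  by rewrite addrC.
have wB n := @vballB _ _ dv n.
have u1 : vball w 0 u by right; rewrite wu.
have one1 : vball w 0 1 by right; rewrite (val1 dv).
split => //.
- exact: wB.
- by move=> x y ?; rewrite -[X in vball w X]addr0; exact: vballM.
- move=> x x0; exists (w x), (u ^ (- w x) * x).
  have h0 : u ^ (- w x) * x != 0 by rewrite mulf_neq0 // expfz_neq0.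
  have wh : w (u ^ (- w x) * x) = 0.
    by rewrite (valM dv) ?expfz_neq0 // (valX dv) // wu; lia.
  split => //; first by rewrite -invr_expz mulVKf // expfz_neq0.
    by right; rewrite wh.
  by right; rewrite (valV dv) // wh.
- exists F, res; split => //; split=> // [x y Ox Oy|x Ox].
    have [e _] := resDM (x - y) y (wB _ _ _ Ox Oy) Oy.
    by rewrite -[in res x](subrK y x) e addrK.
  rewrite res0 //; split=> [/(uM (-1))|]; first by rewrite exprN1 addNr.
  by rewrite -exprN1 => /uMV; rewrite sub0r opprK.
(* The ultrametric inequality turns bounds on successive differences into the Cauchy condition of
   [vcomplete]. *)
- move=> x Hx; have {}Hx i j : (i <= j)%N -> vball w i (x j - x i).
    move=> /subnKC <-; elim: (j - i)%N => [|d IH];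
      first by rewrite addn0 subrr; left.
    rewrite addnS.
    have -> : x (i + d).+1 - x i =
        (x (i + d).+1 - x (i + d)%N) - (x i - x (i + d)%N).
      by rewrite opprB addrA subrK.
    apply: (wB); last by rewrite -opprB -sub0r; apply: (wB) => //; left.
    have := uMV _ _ _ (Hx (i + d)%N); rewrite sub0r opprK => -[->|h].
      by left.
    by right; apply: le_trans h; lia.
  have [n|y Hy] := cw x.
    exists `|n|%N => i j ni nj.
    have {}Hx l : (`|n| <= l)%N -> vball w n (x l - x `|n|%N).
      by move=> /Hx [->|h]; [left|right; apply: le_trans h; lia].
    by have := wB n _ _ (Hx _ ni) (Hx _ nj); rewrite opprB addrA subrK.
  exists y => i; have [N HN] := Hy i%:Z.
  rewrite -[X in vball w X](addNr i%:Z); apply: (uM).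
  have h1 := Hx i (maxn i N) (leq_maxl _ _).
  have := wB _ _ _ h1 (HN (maxn i N) (leq_maxr _ _)).
  by rewrite opprB addrAC addrCA subrr addr0.
Qed.

Lemma local_field_laurent q (F : finFieldType) (k : fieldType) (X : laurent F
  k) :
  #|F| = q -> local_field q (lvar X) (lfil X 0).
Proof.
move=> FQ; have uM (n m : int) x : lfil X m (lvar X ^ n * x) <->
  lfil X (m - n) x.
  split=> H j jm; last by rewrite lcoef_lvarXM; apply: H; lia.
  have := H (j + n); rewrite lcoef_lvarXM addrK; apply; lia.
split => //.
- exact: lvar_neq0.
- by move=> n n0; rewrite lcoef_lvar (_ : n == 1 = false) //; lia.
- by move=> n n0; rewrite -(lconst1 X) lcoef_lconst ifF //; lia.
- exact: lfilB.
- by move=> x y hx hy; have [] := lfil_low hx hy.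
- exact: lfil_unit.
- exists F, (fun x => lcoef X x 0); split=> //; split=> [x y _ _|c|x Ox].
  + exact: lcoefB.
  + exists (lconst X c); last by rewrite lcoef_lconst eqxx.
    by move=> n n0; rewrite lcoef_lconst ifF //; lia.
  + rewrite -exprN1 uM; split=> [x0 n n0|]; last by apply; lia.
    have [->|nn0] := eqVneq n 0; first exact: x0.
    by apply: Ox; lia.
- move=> x Hx; have {}Hx (i j : nat) n : (i <= j)%N -> n < i%:Z ->
      lcoef X (x j) n = lcoef X (x i) n.
    move=> /subnKC <- ni; elim: (j - i)%N => [|d IH]; first by rewrite addn0.
    rewrite addnS -IH; apply/eqP; rewrite -subr_eq0 -lcoefB; apply/eqP.
    have /uM := Hx (i + d)%N; apply; lia.
  have [N HN] := lcoef_bounded X (x 0%N).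
  (* The coefficient of degree n is frozen from any index i > n on: from n + 1 if n >= 0, and from 0
     if n < 0. *)
  pose a (n : int) := lcoef X (x (if 0 <= n then `|n|%N.+1 else 0%N)) n.
  have ha := lcoef_lseries X (a := a) (N := Order.min N 0).
  exists (lseries X a) => i; apply/uM => n ni; rewrite lcoefB ha => [|m mN].
    rewrite /a; case: ifP => n0; last by rewrite -(Hx _ i) ?subrr //; lia.
    have [h|/ltnW h] := leqP `|n|%N.+1 i.
      by rewrite (Hx _ _ n h) ?subrr //; lia.
    by rewrite (Hx _ _ n h) ?subrr //; lia.
  by rewrite /a ifF ?HN //; lia.
Qed.

Lemma local_residue_field p q k u O : @local_residue p q k u O ->
  local_field q u O.
Proof.
case=> [F k1 X FQ|Qp v L w u1 _ ew rw wu u0].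
  exact: local_field_laurent.
by case: ew => dv cw _; exact: local_field_complete.
Qed.

(** * The filtrations of O(s)/O(r) and of the residue field *)

Section Index.
Context (R : realType) (V : zmodType) (A : subquot V).
Hypothesis FA : filtered A.
Local Notation U := (nbh A).

Lemma index_card (n : int) (F : finType) (res : V -> F) :
  (forall x y, U n x -> U n y -> (res x = res y <-> U (n + 1) (x - y))) ->
  (forall c, exists2 x, U n x & res x = c) ->
  index R A n = #|F|%:R.
Proof.
move=> res_eq res_surj; have nn : n <= n + 1 by lia.
rewrite /index fsbig_finite; last exact: finite_reps.
set s := fset_set _.
have Hs y : y \in s -> reps A (n + 1) y /\ U n y.
  by rewrite in_fset_set; [move/set_mem|exact: finite_reps].
rewrite big_const_seq count_predT iter_addr_0; congr (_%:R).
rewrite -(size_map res) cardE; apply/perm_size/uniq_perm.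
- rewrite map_inj_in_uniq ?fset_uniq // => x y /Hs [rx Ux] /Hs [ry Uy] /res_eq.
  by move=> h; apply: reps_inj (h Ux Uy).
- exact: enum_uniq.
move=> c; rewrite mem_enum inE; have [x Ux <-] := res_surj c.
have [h1 h2] := reps_crep FA nn Ux; apply/mapP; exists (crep A (n + 1) x).
  by rewrite in_fset_set; [apply/mem_set|exact: finite_reps].
by apply/res_eq => //; exact: crepP.
Qed.

End Index.

Section LocalField.
Context (q : nat) (k : fieldType) (u : k) (O : set k).
Hypothesis kf : local_field q u O.

Lemma int0 : O 0.
Proof. by rewrite -(subrr 1); apply: (intB kf); exact: (int1 kf). Qed.

Lemma intN x : O x -> O (- x).
Proof. by move=> Ox; rewrite -sub0r; apply: (intB kf) => //; exact: int0. Qed.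

Lemma intD x y : O x -> O y -> O (x + y).
Proof. by move=> Ox Oy; rewrite -(opprK y); apply: (intB kf) => //;
  exact: intN. Qed.

Lemma unifX_int (n : int) : 0 <= n -> O (u ^ n).
Proof.
case: n => // i _; elim: i => [|i IH]; first exact: (int1 kf).
by rewrite -exprnP exprS; apply: (intM kf) => //; exact: (unif_int kf).
Qed.

Lemma int_le (m n : int) x : m <= n -> O (u ^ (- n) * x) -> O (u ^ (- m) * x).
Proof.
move=> mn Ox; have -> : u ^ (- m) * x = u ^ (n - m) * (u ^ (- n) * x).
  by rewrite mulrA -expfzDr ?(unif_neq0 kf) //; congr (u ^ _ * _); lia.
by apply: (intM kf) => //; apply: unifX_int; lia.
Qed.

Lemma unifXK (n : int) x : u ^ (- n) * (u ^ n * x) = x.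
Proof. by rewrite -invr_expz mulKf // expfz_neq0 // (unif_neq0 kf). Qed.

Lemma unifXVK (n : int) x : u ^ n * (u ^ (- n) * x) = x.
Proof. by rewrite -invr_expz mulVKf // expfz_neq0 // (unif_neq0 kf). Qed.

Lemma unifXM (m n : int) x : u ^ m * (u ^ n * x) = u ^ (m + n) * x.
Proof. by rewrite mulrA expfzDr // (unif_neq0 kf). Qed.

Lemma ubballE n x : [set u ^ n * y | y in O] x <-> O (u ^ (- n) * x).
Proof.
split=> [[y Oy <-]|Ox]; first by rewrite unifXK.
by exists (u ^ (- n) * x) => //; rewrite unifXVK.
Qed.

Lemma int_absorb x : exists n : int, O (u ^ (- n) * x).
Proof.
have [->|x0] := eqVneq x 0; first by exists 0; rewrite mulr0; exact: int0.
by have [n [h [-> _ Oh _]]] := int_unit kf x0; exists n; rewrite unifXK.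
Qed.

Lemma int_cover : exists s : seq k, (forall t, t \in s -> O t) /\
  forall x, O x -> exists2 t, t \in s & O (u^-1 * (x - t)).
Proof.
have [F [res [_ [resB res_surj res0]]]] := int_residue kf.
have /choice [f Hf] : forall c, exists x, O x /\ res x = c.
  by move=> c; have [x Ox <-] := res_surj c; exists x.
exists (codom f); split=> [t /codomP [c ->]|x Ox]; first by have [] := Hf c.
exists (f (res x)); first exact: codom_f.
have [Of rf] := Hf (res x); apply/res0; first exact: (intB kf).
by rewrite resB // rf subrr.
Qed.

End LocalField.

Section Groups.
Context (p q : nat) (S : field2d p q).
Local Notation k := (res_field S).
Local Notation u := (res_unif S).
Local Notation Ok := (@res_int p q S).
Local Notation K := (big_field S).
Local Notation X := (expansion S).
Local Notation lc := (lcoef X).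

Lemma res_local : local_field q u Ok.
Proof. exact: local_residue_field (res_fieldP S). Qed.

Lemma uB_E n (x : K) : uB n x <-> forall i, Ok (u ^ (- n) * lc x i).
Proof.
rewrite /uB /uK; split=> [[y By <-] i|Ox].
  by rewrite -lconstX lcoef_lconstM (unifXK res_local).
exists (lconst X (u ^ (- n)) * x).
  by move=> i; rewrite lcoef_lconstM.
by rewrite -lconstX mulrA -lconstM -[u ^ _ * _](mulr1) -mulrA
  (unifXVK res_local) lconst1 mul1r.
Qed.

(** The summand in O(r) frees the coefficients of degree at least r; conversely, truncating x below
    r gives the element of u^n B. *)
Lemma nbh_OO s r n x : s <= r -> nbh (OO S s r) n x <->
  lfil X s x /\ forall i, i < r -> Ok (u ^ (- n) * lc x i).
Proof.
move=> sr; split=> [[y [/uB_E By Oy] [z Oz <-]]|[Ox Hx]].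
  split=> [i si|i ir]; first by rewrite lcoefD Oy // add0r Oz //; lia.
  by rewrite lcoefD Oz // addr0.
pose a i := if i < r then lc x i else 0.
have aE : lc (lseries X a) =1 a.
  by apply: (lcoef_lseries X (N := s)) => i si; rewrite /a Ox // if_same.
exists (lseries X a).
  split; last by move=> i si; rewrite aE /a Ox // if_same.
  apply/uB_E => i; rewrite aE /a; case: ifP => [/Hx //|_].
  by rewrite mulr0; exact: (int0 res_local).
exists (x - lseries X a); last by rewrite subrKC.
by move=> i ir; rewrite lcoefB aE /a ir subrr.
Qed.

Lemma nbh_resG n x : nbh (resG S) n x <-> Ok (u ^ (- n) * x).
Proof. exact: (ubballE res_local). Qed.

Lemma filtered_resG : filtered (resG S).
Proof.
split => [n|n x y /nbh_resG hx /nbh_resG hy|n x /nbh_resG h|x|n x ->|n|x Hx].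
- by apply/nbh_resG; rewrite mulr0; exact: (int0 res_local).
- by apply/nbh_resG; rewrite mulrBr; exact: (intB res_local).
- by apply/nbh_resG; apply: (int_le res_local) h; lia.
- split=> // _; have [n h] := int_absorb res_local x.
  by exists n; apply/nbh_resG.
- by apply/nbh_resG; rewrite mulr0; exact: (int0 res_local).
- have [s [_ Hs]] := int_cover res_local; exists [seq u ^ n * t | t <- s].
  move=> x /nbh_resG /Hs [t ts h]; exists (u ^ n * t); first exact: map_f.
  apply/nbh_resG; move: h; rewrite -exprN1 -[t in X in X ->
    _](unifXK res_local n).
  by rewrite -mulrBr (unifXM res_local); congr (Ok (u ^ _ * _)); lia.
- have [i|y Hy] := int_complete res_local (x := x); first exact/nbh_resG.
  by exists y => i; apply/nbh_resG.
Qed.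

Lemma filtered_OO s r : s <= r -> filtered (OO S s r).
Proof.
move=> sr; have NE n x := @nbh_OO s r n x sr.
split => [n|n x y /NE [Ox hx] /NE [Oy hy]|n x /NE [Ox h]|x|n x Ox|n|x Hx].
- apply/NE; split=> i ir; rewrite lcoef0 //.
  by rewrite mulr0; exact: (int0 res_local).
- apply/NE; split; first exact: lfilB.
  by move=> i ir; rewrite lcoefB mulrBr; apply: (intB res_local);
    [exact: hx|exact: hy].
- apply/NE; split=> // i /h; apply: (int_le res_local); lia.
- split=> [Ox|[n /NE [] //]].
  have [f Hf] := choice (fun i => int_absorb res_local (lc x i)).
  (* Only the finitely many degrees from s to r - 1 matter, so the levels [f i] have a common lower
     bound. *)
  have [n Hn] : exists n : int, forall j : nat, s + j%:Z < r ->
    n <= f (s + j%:Z).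
    have -> : r = s + `|r - s|%N%:Z by lia.
    elim: `|r - s|%N => [|d [n Hn]]; first by exists 0 => j; lia.
    exists (Order.min n (f (s + d%:Z))) => j jd; rewrite ge_min.
    by have [->|jd'] := eqVneq j d; [rewrite lexx orbT|rewrite Hn //; lia].
  exists n; apply/NE; split=> // i ir; have [/Ox ->|si] := ltP i s.
    by rewrite mulr0; exact: (int0 res_local).
  apply: (int_le res_local) (Hf i); have := Hn `|i - s|%N.
  by rewrite (_ : s + _ = i); [apply|lia].
- apply/NE; split=> i ir; rewrite Ox ?mulr0; [by []|lia|exact: (int0
  res_local)|by []].
- have [T [TO HT]] := int_cover res_local.
  (* The induction on r - s adds one coefficient at a time. The bound on all coefficients of the
     members of W is carried along so that, in the new degree, the difference with x is still in u^n
     times the integers, where the finite cover T applies. *)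
  suff [W [_ HW]] : exists W : seq K,
      (forall t, t \in W -> lfil X s t /\ forall i, Ok (u ^ (- n) * lc t i)) /\
      forall x, nbh (OO S s r) n x -> exists2 t, t \in W &
        nbh (OO S s r) (n + 1) (x - t) by exists W.
  have rE : r = s + `|r - s|%N%:Z by lia.
  rewrite rE; elim: `|r - s|%N => {NE rE r sr} [|d [W [WO HW]]].
    exists [:: 0]; split=> [t|x].
      rewrite inE => /eqP ->; split=> [i si|i]; rewrite lcoef0 // mulr0.
      exact: (int0 res_local).
    move=> /nbh_OO [|Ox h]; first by lia.
    exists 0; first by rewrite inE.
    apply/nbh_OO; first by lia.
    rewrite [x - 0]subr0; split=> // i si; rewrite Ox ?mulr0; [|lia].
    exact: (int0 res_local).
  exists [seq t + lvar X ^ (s + d%:Z) * lconst X (u ^ n * c) | t <- W, c <- T].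
  have cE c i : lc (lvar X ^ (s + d%:Z) * lconst X (u ^ n * c)) i =
      if i == s + d%:Z then u ^ n * c else 0.
    by rewrite lcoef_lvarXM lcoef_lconst subr_eq0.
  split=> [_ /allpairsP [[t c] /= [tW cT ->]]|x].
    have [Ot Nt] := WO _ tW; split=> i.
      by move=> si; rewrite lcoefD cE ifF ?Ot ?addr0 //; lia.
    rewrite lcoefD cE mulrDr; apply: (intD res_local) => //.
    by case: ifP => _; rewrite ?mulr0 ?(unifXK res_local);
      [exact: TO|exact: (int0 res_local)].
  move=> /nbh_OO [|Ox hx]; first by lia.
  have [|t tW /nbh_OO [|Ot ht]] := HW x.
  + apply/nbh_OO; first by lia.
    by split=> // i id; apply: hx; lia.
  + by lia.
  have [|c cT hc] := HT (u ^ (- n) * (lc x (s + d%:Z) - lc t (s + d%:Z))).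
    rewrite mulrBr; apply: (intB res_local); first by apply: hx; lia.
    by have [_] := WO _ tW; apply.
  exists (t + lvar X ^ (s + d%:Z) * lconst X (u ^ n * c)).
    by apply/allpairsP; exists (t, c).
  apply/nbh_OO; first by lia.
  split=> i id; rewrite [- (t + _)]opprD [x + _]addrA lcoefB cE.
    by rewrite Ot // ifF ?subr0 //; lia.
  case: eqP => [->|/eqP nd]; last by rewrite subr0; apply: ht; lia.
  move: hc; rewrite -exprN1 -[c in X in X -> _](unifXK res_local n) -mulrBr
    (unifXM res_local).
  by rewrite lcoefB; congr (Ok (u ^ _ * _)); lia.
- have cauchy i (j : nat) : i < r ->
      Ok (u ^ (- j%:Z) * (lc (x j.+1) i - lc (x j) i)).
    by move=> ir; have /NE [_ /(_ i ir)] := Hx j; rewrite lcoefB.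
  have /choice [Y HY] : forall i, exists y, i < r ->
      forall j : nat, Ok (u ^ (- j%:Z) * (y - lc (x j) i)).
    move=> i; have [ir|ri] := ltP i r; last by exists 0.
    by have [y Hy] := int_complete res_local (fun j => cauchy i j ir); exists y.
  have low (j : nat) i : i < s -> lc (x j) i = lc (x 0%N) i.
    move=> si; elim: j => // j <-; have /NE [/(_ i si) + _] := Hx j.
    by rewrite lcoefB => /eqP; rewrite subr_eq0 => /eqP.
  (* The limit is taken coefficient by coefficient. Below s the sequence is constant, its
     differences being in O(s); degrees from r on are invisible in the quotient. *)
  pose a i := if i < s then lc (x 0%N) i else Y i.
  have [N HN] := lcoef_bounded X (x 0%N).
  have aE : lc (lseries X a) =1 a.
    apply: (lcoef_lseries X (N := Order.min N s)) => i; rewrite lt_min =>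
      /andP[iN is_].
    by rewrite /a is_ HN.
  exists (lseries X a) => j; apply/NE; split=> i ir; rewrite lcoefB aE /a.
    by rewrite ir low // subrr.
  case: ifP => [is_|_]; last exact: HY.
  by rewrite low // subrr mulr0; exact: (int0 res_local).
Qed.

End Groups.

(** * Inverse images and Haar measures on O(s)/O(r) *)

Section HaarOnSubquotients.
Context (R : realType) (p q : nat) (S : field2d p q).
Local Notation C := R[i].
Local Notation k := (res_field S).
Local Notation u := (res_unif S).
Local Notation Ok := (@res_int p q S).
Local Notation K := (big_field S).
Local Notation X := (expansion S).
Local Notation lc := (lcoef X).
Local Notation O := (lfil X).
Local Notation U s r := (nbh (OO S s r)).
Implicit Types (T m : dist R S) (f g : K -> C^o).

Lemma lfil0 i : O i 0.
Proof. by move=> n _; rewrite lcoef0. Qed.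

Lemma lfilDr i x y : O i y -> O i (x + y) <-> O i x.
Proof.
move=> Oy; split=> [/lfilB /(_ Oy)|Ox]; first by rewrite addrK.
by rewrite -(opprK y) -(sub0r y); do 2 apply: lfilB => //; exact: lfil0.
Qed.

Lemma lfil_le i j : i <= j -> O j `<=` O i.
Proof. by move=> ij x Ox n ni; apply: Ox; lia. Qed.

Lemma charBE s r : s <= r -> charB R s r = \1_(U s r 0) :> (K -> C^o).
Proof.
move=> sr; rewrite /charB; congr indic; apply/seteqP.
have uB0 : @uB p q S 0 = @ringB p q S.
  by apply/seteqP; split=> x; rewrite uB_E => H n;
    have := H n; rewrite oppr0 expr0z mul1r.
by split=> x; rewrite /= uB0.
Qed.

Lemma nbh_OO_fil s r n : s <= r -> U s r n `<=` O s.
Proof. by move=> sr x /(nbh_OO _ _ sr) []. Qed.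

Lemma nbh_OO_low s r r' n x : s <= r -> r <= r' ->
  U r r' n x <-> U s r' n x /\ O r x.
Proof.
move=> sr rr; have sr' := le_trans sr rr.
rewrite !nbh_OO //; split=> [[Ox h]|[[_ h] Ox]] //.
by split=> //; split=> //; exact: lfil_le Ox.
Qed.

Lemma nbh_OO_high s r r' n : s <= r -> r <= r' -> U s r' n `<=` U s r n.
Proof.
move=> sr rr x; have sr' := le_trans sr rr.
rewrite !nbh_OO // => -[Ox h]; split=> // i ir; apply: h.
exact: lt_le_trans ir rr.
Qed.

Lemma nbh_OO_split s r r' n x : s <= r -> r <= r' -> U s r n x ->
  exists y z, [/\ x = y + z, U s r' n y & O r z].
Proof.
move=> sr rr [y [By Oy] [z Oz <-]]; exists y, z; split => //.
by exists y => //; exists 0; rewrite ?addr0 //; exact: lfil0.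
Qed.

Lemma OO_nbh s r n x : O s x -> O r x -> U s r n x.
Proof.
move=> Ox Oy; exists 0; last by exists x; rewrite ?add0r.
split; last exact: lfil0.
by apply/uB_E => i; rewrite lcoef0 mulr0; exact: (int0 (res_local S)).
Qed.

Definition restr r f : K -> C^o := fun y => if `[< O r y >] then f y else 0.

Lemma restrE r f x y : O r y -> restr r f (x + y) = if `[< O r x >] then f (x +
  y) else 0.
Proof.
move=> Oy; rewrite /restr; congr (if _ then _ else _).
exact/asbool_equiv_eq/lfilDr.
Qed.

Lemma test_restr s r r' f : s <= r -> r <= r' ->
  test (OO S s r') f -> test (OO S r r') (restr r f).
Proof.
move=> sr rr; have sr' := le_trans sr rr.
move=> /(tameP (filtered_OO S sr')) [n [m [f1 f2]]].
apply/(tameP (filtered_OO S rr)); exists n, m; split=> [x y Uy|x nUx].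
  have [Uy' Oy] := (nbh_OO_low n y sr rr).1 Uy.
  by rewrite restrE // /restr f1.
rewrite /restr; case: asboolP => // Ox; apply: f2 => Ux; apply: nUx.
by apply/(nbh_OO_low m x sr rr).
Qed.

Lemma test_OO_shift s r f x : s <= r -> O s x -> test (OO S s r) f ->
  test (OO S s r) (fun y => f (x + y)).
Proof.
move=> sr Ox /(test_shift (filtered_OO S sr) Ox); congr test.
by apply/funext => y; rewrite addrC.
Qed.

Lemma fibre_intE r m f x : fibre_int r m f x = m (restr r (fun y => f (x + y))).
Proof. by []. Qed.

Lemma fibre_int_out s r r' m f x : s <= r -> r <= r' ->
  distr (OO S r r') m -> test (OO S s r') f -> ~ O s x ->
  fibre_int r m f x = 0.
Proof.
move=> sr rr Dm [f_num _ _ _] nOx; rewrite fibre_intE -[RHS](ldual0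
  (subspace_test R (filtered_OO S rr)) Dm).
congr m; apply/funext => y; rewrite /restr; case: asboolP => // Oy.
apply: f_num => /= Oxy; apply: nOx.
exact: (lfilDr x (lfil_le sr Oy)).1 Oxy.
Qed.

Lemma fibre_int_lin s r r' m (a : C) f g : s <= r -> r <= r' ->
  distr (OO S r r') m -> test (OO S s r') f -> test (OO S s r') g ->
  fibre_int r m (a *: f + g) = a *: fibre_int r m f + fibre_int r m g.
Proof.
move=> sr rr Dm tf tg; apply/funext => x; rewrite !fctE.
have [Ox|nOx] := pselect (O s x); last first.
  rewrite !(fibre_int_out sr rr Dm _ nOx) ?scaler0 ?addr0 //.
  by apply: test_lin => //; apply: filtered_OO; exact: le_trans rr.
have sr' := le_trans sr rr.
rewrite !fibre_intE -[_ *: _]/(a * _) -Dm.1; try by apply: (test_restr sr rr);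
  exact: test_OO_shift.
congr m; apply/funext => y; rewrite !fctE /restr; case: asboolP => //.
by rewrite scaler0 addr0.
Qed.

(** The translation by y is absorbed in the variable of integration, by invariance of m. This is
    what makes the integral along the fibres a function on O(s)/O(r). *)
Lemma haar_restr_shift s r r' m f x y : s <= r -> r <= r' ->
  haar (OO S r r') m -> test (OO S s r') f -> O r y ->
  fibre_int r m f (x + y) = fibre_int r m f x.
Proof.
move=> sr rr Hm tf Oy; have Oy' := lfil_le sr Oy.
have [Ox|nOx] := pselect (O s x); last first.
  rewrite !(fibre_int_out sr rr Hm.1 tf) // => Oxy; apply: nOx.
  exact: (lfilDr x Oy').1 Oxy.
rewrite !fibre_intE -[RHS](Hm.2 y) //; last first.
  by apply: (test_restr sr rr); apply: test_OO_shift => //; exact: le_trans rr.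
congr m; apply/funext => z; rewrite restrE // /restr.
by case: asboolP => // _; rewrite -addrA [y + z]addrC.
Qed.

Lemma test_fibre_int s r r' m f : s <= r -> r <= r' ->
  haar (OO S r r') m -> test (OO S s r') f -> test (OO S s r) (fibre_int r m f).
Proof.
move=> sr rr Hm tf; have sr' := le_trans sr rr.
have [n [l [f1 f2]]] := (tameP (filtered_OO S sr') f).1 tf.
apply/(tameP (filtered_OO S sr)); exists n, l; split=> [x y Uy|x nUx].
  have [y1 [y2 [-> Uy1 Oy2]]] := nbh_OO_split sr rr Uy.
  rewrite addrA (haar_restr_shift _ sr rr Hm tf Oy2) !fibre_intE.
  by congr m; apply/funext => z; rewrite /restr addrAC f1.
rewrite fibre_intE -[RHS](ldual0 (subspace_test R (filtered_OO S rr)) Hm.1).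
congr m; apply/funext => y; rewrite /restr; case: asboolP => // Oy.
apply: f2 => /(nbh_OO_high sr rr) Uxy; apply: nUx.
have Oy' := lfil_le sr Oy.
exact: (nbhDr (filtered_OO S sr) x (OO_nbh l Oy' Oy)).1 Uxy.
Qed.

Lemma test_charB s r : s <= r -> test (OO S s r) (charB R s r).
Proof.
move=> sr; rewrite charBE //; apply/(tameP (filtered_OO S sr)).
by exists 0, 0; apply: tame_nbh => //; exact: filtered_OO.
Qed.

Lemma restr_charB s r r' : s <= r -> r <= r' ->
  restr r (charB R s r') = charB R r r'.
Proof.
move=> sr rr; have sr' := le_trans sr rr.
apply/funext => x; rewrite /restr !charBE // !indicE.
case: asboolP => Ox; last first.
  by rewrite memNset // => /(nbh_OO_fil rr).
congr (_%:R); congr nat_of_bool; apply/idP/idP; rewrite !inE => h.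
  by apply/(nbh_OO_low 0 x sr rr).
by have [] := (nbh_OO_low _ x sr rr).1 h.
Qed.

(** Over a point of the image of B, the fibre of that image is a translate of the image of B in
    O(r)/O(r'); over any other point it is empty. *)
Lemma fibre_charB s r r' m : s <= r -> r <= r' -> haar (OO S r r') m ->
  fibre_int r m (charB R s r') = m (charB R r r') *: charB R s r.
Proof.
move=> sr rr Hm; have sr' := le_trans sr rr.
apply/funext => x; rewrite !fctE.
have [Ux|nUx] := pselect (U s r 0 x).
  have [y [z [-> Uy Oz]]] := nbh_OO_split sr rr Ux.
  rewrite (haar_restr_shift _ sr rr Hm) //; last exact: test_charB.
  have -> : charB R s r (y + z) = 1.
    rewrite charBE // indicE mem_set //; apply: nbhD.
    - exact: filtered_OO.
    - exact: nbh_OO_high Uy.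
    - by apply: OO_nbh => //; exact: lfil_le Oz.
  rewrite [_ *: _]mulr1 fibre_intE -(restr_charB sr rr); congr m.
  apply/funext => w; rewrite /restr; case: asboolP => // _.
  rewrite charBE // !indicE; congr (_%:R); congr nat_of_bool.
  apply/idP/idP; rewrite !inE addrC => h.
    by apply/(nbhDr (filtered_OO S sr') _ Uy).
  by apply/(nbhDr (filtered_OO S sr') _ Uy).
have -> : charB R s r x = 0 by rewrite charBE // indicE memNset.
rewrite scaler0.
rewrite fibre_intE -[RHS](ldual0 (subspace_test R (filtered_OO S rr)) Hm.1).
congr m; apply/funext => y; rewrite /restr; case: asboolP => // Oy.
rewrite charBE // indicE memNset // => /(nbh_OO_high sr rr) Uxy; apply: nUx.
have Oy' := lfil_le sr Oy.
exact: (nbhDr (filtered_OO S sr) x (OO_nbh 0 Oy' Oy)).1 Uxy.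
Qed.

Lemma inv_imageE s r r' T m f : test (OO S s r') f ->
  inv_image s r r' T m f = T (fibre_int r m f).
Proof. by move=> tf; rewrite /inv_image /on_dom asboolT. Qed.

Lemma distr_inv_image s r r' T m : s <= r -> r <= r' ->
  distr (OO S s r) T -> haar (OO S r r') m ->
  distr (OO S s r') (inv_image s r r' T m).
Proof.
move=> sr rr DT Hm; have sr' := le_trans sr rr; split=> [a f g tf tg|f nf].
  have tfg := test_lin (filtered_OO S sr') a tf tg.
  rewrite !inv_imageE // (fibre_int_lin _ sr rr Hm.1 tf tg) DT.1 //;
    exact: test_fibre_int Hm _.
by rewrite /inv_image /on_dom asboolF.
Qed.

Lemma haar_inv_image s r r' T m : s <= r -> r <= r' ->
  haar (OO S s r) T -> haar (OO S r r') m ->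
  haar (OO S s r') (inv_image s r r' T m).
Proof.
move=> sr rr HT Hm; have sr' := le_trans sr rr.
split=> [|a f Oa tf]; first exact: distr_inv_image HT.1 Hm.
have tfa := test_shift (filtered_OO S sr') Oa tf.
rewrite !inv_imageE // -[RHS](HT.2 a) //; last exact: test_fibre_int Hm _.
congr T; apply/funext => x; rewrite !fibre_intE; congr m.
by apply/funext => y; rewrite /restr addrAC.
Qed.

(** Evaluation on B is multiplicative. All computations of products of measures, and the
    compatibility of [evalB] with the limit, come down to this identity. *)
Lemma inv_image_charB s r r' T m : s <= r -> r <= r' ->
  distr (OO S s r) T -> haar (OO S r r') m ->
  inv_image s r r' T m (charB R s r') = T (charB R s r) * m (charB R r r').
Proof.
move=> sr rr DT Hm; have sr' := le_trans sr rr.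
rewrite inv_imageE; last exact: test_charB.
rewrite fibre_charB // (ldualZ (subspace_test R (filtered_OO S sr)) DT).
  by rewrite mulrC.
exact: test_charB.
Qed.

Lemma haarBP s r : s <= r ->
  haar (OO S s r) (haarB s r : dist R S) /\ (haarB s r : dist R S) (charB R s
    r) = 1.
Proof.
move=> sr; rewrite /haarB; case: xgetP => [m _ [] //|/(_ (haar_int (OO S s
  r)))].
case; split; first by apply: haar_haar_int; exact: filtered_OO.
by rewrite charBE // haar_int_nbh0 //; exact: filtered_OO.
Qed.

Lemma haar_haarB s r m : s <= r -> haar (OO S s r) m ->
  m = m (charB R s r) *: (haarB s r : dist R S).
Proof.
move=> sr Hm; have FA := filtered_OO S sr; have [HB B1] := haarBP sr.
rewrite [LHS](haar_uniq FA Hm) [haarB s r](haar_uniq FA HB) -charBE //.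
by rewrite B1 scale1r.
Qed.

Lemma haarZ s r (a : C) m : s <= r -> haar (OO S s r) m ->
  haar (OO S s r) (a *: m).
Proof.
move=> sr Hm; split; [split=> [b f g tf tg|f nf]|move=> c f Oc tf].
- by rewrite !fctE Hm.1.1 // scalerDr; congr (_ + _); exact: mulrCA.
- by rewrite !fctE Hm.1.2 // scaler0.
- by rewrite !fctE Hm.2.
Qed.

Lemma haarD s r m m' : haar (OO S s r) m -> haar (OO S s r) m' ->
  haar (OO S s r) (m + m').
Proof.
move=> Hm Hm'; split; [split=> [b f g tf tg|f nf]|move=> c f Oc tf].
- by rewrite !fctE Hm.1.1 // Hm'.1.1 // mulrDr addrACA.
- by rewrite !fctE Hm.1.2 // Hm'.1.2 // addr0.
- by rewrite !fctE Hm.2 // Hm'.2.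
Qed.

Lemma haar_eq s r m m' : s <= r -> haar (OO S s r) m -> haar (OO S s r) m' ->
  m (charB R s r) = m' (charB R s r) -> m = m'.
Proof.
move=> sr Hm Hm' e; rewrite [LHS](haar_haarB sr Hm) [RHS](haar_haarB sr Hm').
by rewrite e.
Qed.

Lemma dir_imageE s' s r T f : test (OO S s' r) f ->
  dir_image s' s r T f = T (restr s f).
Proof. by move=> tf; rewrite /dir_image /on_dom asboolT. Qed.

Lemma distr_dir_image s' s r T : s' <= s -> s <= r ->
  distr (OO S s r) T -> distr (OO S s' r) (dir_image s' s r T).
Proof.
move=> ss sr DT; have sr' := le_trans ss sr; split=> [a f g tf tg|f nf].
  rewrite !dir_imageE //; last by apply: test_lin => //; exact: filtered_OO.
  rewrite -DT.1; [|exact: (test_restr ss sr)|exact: (test_restr ss sr)].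
  congr T; apply/funext => x; rewrite !fctE /restr; case: asboolP => //.
  by rewrite scaler0 addr0.
by rewrite /dir_image /on_dom asboolF.
Qed.

(** A graded piece is a copy of the residue field: the residue of u^(-n) times the i-th coefficient
    identifies the quotient of two successive neighbourhoods with F_q. *)
Lemma haar_unif i n m : haar (OO S i (i + 1)) m ->
  m (\1_(U i (i + 1) n)) = q%:R * m (\1_(U i (i + 1) (n + 1))).
Proof.
move=> Hm; have ii : i <= i + 1 by lia.
rewrite (haar_index (filtered_OO S ii)) //; congr (_ * _).
have [F [res [FQ [resB res_surj res0]]]] := int_residue (res_local S).
rewrite -[X in _ = X%:R]FQ; apply: (index_card R (filtered_OO S ii) (res :=
  fun x => res (u ^ (- n) * lc x i))).
  move=> x y /(nbh_OO _ _ ii) [Ox hx] /(nbh_OO _ _ ii) [Oy hy].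
  have Hx := hx i; have Hy := hy i.
  have -> : (res (u ^ (- n) * lc x i) = res (u ^ (- n) * lc y i)) <->
      res (u ^ (- n) * lc (x - y) i) = 0.
    rewrite lcoefB mulrBr resB; [|by apply: Hx; lia|by apply: Hy; lia].
    by split=> [->|/eqP]; [rewrite subrr|rewrite subr_eq0 => /eqP].
  rewrite res0; last first.
    by rewrite lcoefB mulrBr; apply: (intB (res_local S));
      [apply: Hx|apply: Hy]; lia.
  rewrite -exprN1 (unifXM (res_local S)) nbh_OO //.
  have -> : -1 + - n = - (n + 1) by lia.
  split=> [h|[_]]; last by apply; lia.
  split=> [|j ji]; first exact: lfilB.
  have [->|nji] := eqVneq j i; first exact: h.
  rewrite lcoefB Ox ?Oy ?subr0 ?mulr0; [exact: (int0 (res_local S))|lia|lia].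
move=> c; have [x Ox <-] := res_surj c.
exists (lvar X ^ i * lconst X (u ^ n * x)).
  apply/nbh_OO => //; split=> j ji; rewrite lcoef_lvarXM lcoef_lconst.
    by rewrite ifF //; lia.
  case: eqP => _; last by rewrite mulr0; exact: (int0 (res_local S)).
  by rewrite (unifXK (res_local S)).
by rewrite lcoef_lvarXM lcoef_lconst subrr eqxx (unifXK (res_local S)).
Qed.

End HaarOnSubquotients.

(** * The relative measures and their products *)

Section RelativeMeasures.
Context (R : realType) (p q : nat) (S : field2d p q).
Local Notation C := R[i].
Local Notation K := (big_field S).
Local Notation hB s r := (haarB s r : dist R S).
Implicit Types (m : dist R S) (l : dist R S -> C^o) (a b c : relm R S).

Lemma subspace_haar s r : s <= r -> Defs.subspace (haar (OO S s r) : set (dist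
  R S)).
Proof.
move=> sr; split=> [|a m m' Hm Hm'].
  have [HB _] := haarBP R S sr.
  by rewrite -(scale0r (hB s r)); exact: haarZ.
by apply: haarD => //; exact: haarZ.
Qed.

(** The dual basis vector of [haarB], since that measure takes the value 1 on B. *)
Definition dualB s r : dist R S -> C^o :=
  on_dom (haar (OO S s r) : set (dist R S)) (fun m => m (charB R s r)).

Lemma dualBE s r m : haar (OO S s r) m -> dualB s r m = m (charB R s r).
Proof. by move=> Hm; rewrite /dualB /on_dom asboolT. Qed.

Lemma ldual_dualB s r : s <= r -> ldual (haar (OO S s r) : set (dist R S))
  (dualB s r).
Proof.
move=> sr; have [sH0 sHD] := subspace_haar sr; split=> [a m m' Hm Hm'|m nm].
  by rewrite !dualBE //; exact: sHD.
by rewrite /dualB /on_dom asboolF.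
Qed.

Lemma ldual_haarE s r l m : s <= r -> ldual (haar (OO S s r)) l ->
  haar (OO S s r) m -> l m = l (hB s r) * m (charB R s r).
Proof.
move=> sr Dl Hm; rewrite [in LHS](haar_haarB sr Hm).
rewrite (ldualZ (subspace_haar sr) Dl) 1?mulrC //.
by have [] := haarBP R S sr.
Qed.

Lemma ldual_haar_uniq s r l : s <= r -> ldual (haar (OO S s r)) l ->
  l = l (hB s r) *: dualB s r.
Proof.
move=> sr Dl; apply/funext => m; rewrite !fctE.
have [Hm|nHm] := pselect (haar (OO S s r) m).
  by rewrite (ldual_haarE sr Dl Hm) dualBE.
by rewrite Dl.2 // (ldual_dualB sr).2 // scaler0.
Qed.

Lemma ldual_haarZ s r (x : C) : s <= r ->
  ldual (haar (OO S s r) : set (dist R S)) (x *: dualB s r).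
Proof.
move=> sr; have Dl := ldual_dualB sr; split=> [a m m' Hm Hm'|m nm].
  by rewrite !fctE Dl.1 // scalerDr; congr (_ + _); exact: mulrCA.
by rewrite !fctE Dl.2 // scaler0.
Qed.

Lemma muBE r s : muB R S r s = if s <= r then (hB s r, 0) else (0, dualB r s).
Proof.
rewrite /muB; case: ifP => // /negbT; rewrite -ltNge => /ltW rs.
have [HB B1] := haarBP R S rs.
congr pair; case: xgetP => [l _ [Dl l1]|/(_ (dualB r s))].
  by rewrite (ldual_haar_uniq rs Dl) l1 scale1r.
by case; split; [exact: ldual_dualB|rewrite dualBE].
Qed.

(** The coordinate on the line mu(O(r)|O(s)) relative to [muB]. The formula makes sense on all
    pairs, so its linearity carries no side condition. *)
Definition coord r s a : C := if s <= r then a.1 (charB R s r) else a.2 (hB r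
  s).

Lemma muE r s a : mu r s a <-> exists x : C, a = x *: muB R S r s.
Proof.
rewrite muBE /mu; case: leP => [sr|/ltW rs]; split.
- move=> [m Hm <-]; exists (m (charB R s r)).
  by rewrite [in LHS](haar_haarB sr Hm); congr pair; rewrite scaler0.
- move=> [x ->]; exists (x *: hB s r).
    by apply: haarZ => //; have [] := haarBP R S sr.
  by congr pair; rewrite scaler0.
- move=> [l Dl <-]; exists (l (hB r s)).
  by rewrite [in LHS](ldual_haar_uniq rs Dl); congr pair; rewrite scaler0.
- move=> [x ->]; exists (x *: dualB r s); first exact: ldual_haarZ.
  by congr pair; rewrite scaler0.
Qed.

Lemma coordZ r s (x : C) : coord r s (x *: muB R S r s) = x.
Proof.
rewrite /coord muBE; case: leP => [sr|/ltW rs] /=.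
  by have [_ B1] := haarBP R S sr; rewrite !fctE B1; exact: mulr1.
by have [HB B1] := haarBP R S rs; rewrite !fctE dualBE // B1; exact: mulr1.
Qed.

Lemma coord_lin r s (x : C) a b : coord r s (x *: a + b) = x * coord r s a +
  coord r s b.
Proof. by rewrite /coord; case: ifP. Qed.

Lemma mu_coord r s a : mu r s a -> a = coord r s a *: muB R S r s.
Proof. by move=> /muE [x ->]; rewrite coordZ. Qed.

(** Evaluating on B in each of the six cases gives the product of the coordinates. In particular the
    relation is functional, so [xget] returns the expected value. *)
Lemma tens_mu r s w a b c : tens r s w a b c ->
  [/\ mu r s a, mu s w b, mu r w c & coord r w c = coord r s a * coord s w b].
Proof.
rewrite /mu /coord; case=> {a b c}.
- move=> m1 m2 sr ws H1 H2; have wr := le_trans ws sr; rewrite sr ws wr.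
  split; [by exists m1|by exists m2| |].
    by exists (inv_image w s r m2 m1) => //; exact: haar_inv_image.
  by rewrite /= inv_image_charB //; [exact: mulrC|exact: H2.1].
- move=> n n' l2 sr sw wr Hn Hn' Dl2; rewrite sr wr leNgt sw /=.
  split; [|by exists l2| |].
  + by exists (inv_image s w r n' n) => //; apply: haar_inv_image => //;
    exact: ltW.
  + by exists (l2 n' *: n) => //; exact: haarZ.
  + rewrite inv_image_charB ?(ltW sw) //; last exact: Hn'.1.
    by rewrite (ldual_haarE (ltW sw) Dl2 Hn') !fctE /= [_ *: _]mulrC
      [RHS]mulrAC [RHS]mulrC;
      congr (_ * _); exact: mulrC.
- move=> m1 l2 l3 sr sw rw H1 Dl2 Dl3 l3E; rewrite sr !leNgt sw rw /=.
  split; [by exists m1|by exists l2|by exists l3|].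
  have [HB B1] := haarBP R S (ltW rw).
  rewrite l3E // (ldual_haarE (ltW sw) Dl2); last by apply: haar_inv_image =>
    //; exact: ltW.
  by rewrite inv_image_charB ?(ltW rw) //; [rewrite B1 mulr1 mulrC|exact: H1.1].
- move=> n n' l1 rs ws wr Dl1 Hn Hn'; rewrite ws wr leNgt rs /=.
  split; [by exists l1| | |].
  + by exists (inv_image w r s n' n) => //; apply: haar_inv_image => //;
    exact: ltW.
  + by exists (l1 n *: n') => //; exact: haarZ.
  + rewrite inv_image_charB ?(ltW rs) //; last exact: Hn'.1.
    by rewrite (ldual_haarE (ltW rs) Dl1 Hn) !fctE /= [_ *: _]mulrAC mulrA.
- move=> m2 l1 l3 rs ws rw Dl1 H2 Dl3 l3E; rewrite ws !leNgt rs rw /=.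
  split; [by exists l1|by exists m2|by exists l3|].
  have [HB B1] := haarBP R S (ltW rw).
  rewrite l3E // (ldual_haarE (ltW rs) Dl1); last by apply: haar_inv_image =>
    //; exact: ltW.
  by rewrite inv_image_charB ?(ltW rw) //; [rewrite B1 mul1r|exact: HB.1].
- move=> l1 l2 l3 rs sw Dl1 Dl2 Dl3 l3E; have rw := lt_trans rs sw.
  rewrite !leNgt rs sw rw /=; split; [by exists l1|by exists l2|by exists l3|].
  have [HB1 B1] := haarBP R S (ltW rs); have [HB2 B2] := haarBP R S (ltW sw).
  have [HB3 B3] := haarBP R S (ltW rw).
  rewrite -l3E // [RHS](ldual_haarE (ltW rw) Dl3);
    last by apply: haar_inv_image => //; exact: ltW.
  by rewrite inv_image_charB ?(ltW rs) ?(ltW sw) //;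
    [rewrite B1 B2 !mulr1|exact: HB1.1].
Qed.

Lemma tens_muB r s w (x y : C) :
  exists c, tens r s w (x *: muB R S r s) (y *: muB R S s w) c.
Proof.
have pairl (z : C) m : z *: ((m, 0) : relm R S) = (z *: m, 0).
  by congr pair; rewrite scaler0.
have pairr (z : C) l : z *: ((0, l) : relm R S) = (0, z *: l).
  by congr pair; rewrite scaler0.
have hH s' r' z : s' <= r' -> haar (OO S s' r') (z *: hB s' r').
  by move=> sr; apply: haarZ => //; have [] := haarBP R S sr.
have B1 s' r' z : s' <= r' -> (z *: hB s' r') (charB R s' r') = z.
  by move=> sr; rewrite !fctE; have [_ ->] := haarBP R S sr; exact: mulr1.
have lE s' r' z m : s' <= r' -> haar (OO S s' r') m ->
    (z *: dualB s' r') m = z * m (charB R s' r').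
  by move=> sr Hm; rewrite !fctE dualBE.
rewrite !muBE; case: (leP s r) => [sr|rs]; case: (leP w s) => [ws|sw];
  rewrite ?pairl ?pairr.
- by eexists; apply: tens_hh => //; exact: hH.
- case: (leP w r) => [wr|rw].
    (* The constructor expects a factored measure; the second factor is normalized on B so that the
       first keeps the coordinate x. *)
    have -> : x *: hB s r = inv_image s w r (x *: hB s w) (1 *: hB w r).
      apply: (haar_eq sr); first exact: hH.
        by apply: haar_inv_image; rewrite ?(ltW sw) //; apply: hH => //;
          exact: ltW.
      rewrite B1 // inv_image_charB ?(ltW sw) // ?B1 ?mulr1 ?(ltW sw) //.
        by have [] := hH s w x (ltW sw).
      exact: hH.
    by eexists; apply: tens_hd_h => //; [exact: hH|apply: hH; exact: ltW|
      apply: ldual_haarZ; exact: ltW].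
  exists (0, (x * y) *: dualB r w); apply: tens_hd_d => //; first exact: hH.
  + by apply: ldual_haarZ; exact: ltW.
  + by apply: ldual_haarZ; exact: ltW.
  move=> n Hn; rewrite lE ?(ltW rw) // lE ?(ltW sw) //.
    rewrite inv_image_charB ?(ltW rw) // ?B1 //;
      first by rewrite mulrA [x * y]mulrC.
    by have [] := hH s r x sr.
  by apply: haar_inv_image; rewrite ?(ltW rw) //; exact: hH.
- case: (leP w r) => [wr|rw].
    have -> : y *: hB w s = inv_image w r s (y *: hB w r) (1 *: hB r s).
      apply: (haar_eq ws); first exact: hH.
        by apply: haar_inv_image; rewrite ?(ltW rs) //; apply: hH => //;
          exact: ltW.
      rewrite B1 // inv_image_charB ?(ltW rs) // ?B1 ?mulr1 ?(ltW rs) //.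
        by have [] := hH w r y wr.
      by apply: hH; exact: ltW.
    by eexists; apply: tens_dh_h => //; [apply: ldual_haarZ; exact: ltW|
      apply: hH; exact: ltW|exact: hH].
  exists (0, (x * y) *: dualB r w); apply: tens_dh_d => //.
  + by apply: ldual_haarZ; exact: ltW.
  + exact: hH.
  + by apply: ldual_haarZ; exact: ltW.
  move=> n Hn; rewrite lE ?(ltW rw) // lE ?(ltW rs) //.
    rewrite inv_image_charB ?(ltW rw) // ?B1 //; [|exact: Hn.1|exact: hH].
    by rewrite -mulrA [y * _]mulrC.
  by apply: haar_inv_image; rewrite ?(ltW rw) //; exact: hH.
- have rw := lt_trans rs sw; exists (0, (x * y) *: dualB r w);
  apply: tens_dd => //.
  + by apply: ldual_haarZ; exact: ltW.
  + by apply: ldual_haarZ; exact: ltW.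
  + by apply: ldual_haarZ; exact: ltW.
  move=> n n' Hn Hn'; rewrite (lE r w) ?(ltW rw) //; last first.
    by apply: haar_inv_image => //; exact: ltW.
  rewrite (lE r s) ?(ltW rs) // (lE s w) ?(ltW sw) //.
  rewrite inv_image_charB ?(ltW rs) ?(ltW sw) //; last exact: Hn'.1.
  exact: mulrACA.
Qed.

Lemma tensorE r s w (x y : C) :
  tensor r s w (x *: muB R S r s) (y *: muB R S s w) = (x * y) *: muB R S r w.
Proof.
rewrite /tensor; case: xgetP => [c _ /tens_mu [_ _ Mc]|].
  by rewrite !coordZ => <-; exact: mu_coord.
by have [c Hc] := tens_muB r s w x y => /(_ c).
Qed.

Lemma tensor_out r s w a b : ~ mu s w b -> tensor r s w a b = 0.
Proof.
by move=> nb; rewrite /tensor; case: xgetP => // c _ /tens_mu [_ /nb].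
Qed.

End RelativeMeasures.

(** * Monomial automorphisms *)

Section Monomial.
Context (R : realType) (p q : nat) (S : field2d p q).
Local Notation C := R[i].
Local Notation k := (res_field S).
Local Notation u := (res_unif S).
Local Notation Ok := (@res_int p q S).
Local Notation K := (big_field S).
Local Notation X := (expansion S).
Local Notation lc := (lcoef X).
Local Notation O := (lfil X).
Local Notation U s r := (nbh (OO S s r)).
Local Notation hB s r := (haarB s r : dist R S).
Local Notation Q := (q%:R : C).
Implicit Types (T m : dist R S) (f : K -> C^o).

(* Both the multiplications by [u ^ a * t ^ b] and the automorphisms [R_d]
   shift the coefficients by [b] and multiply the [n]-th one by a power of
   [u]; [J] is a discrete primitive of the exponents, so that the Haar
   measures on O(s)/O(r) are scaled by [q ^ (J r - J s)]. *)
Record monomial (b : int) (J : int -> int) (sg sg' : K -> K) : Prop :=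
  Monomial {
  mono_coef : forall x n, lc (sg x) (n + b) = u ^ (J (n + 1) - J n) * lc x n;
  monoK : cancel sg sg';
  monoVK : cancel sg' sg
}.

Lemma mono_inv b J sg sg' : monomial b J sg sg' ->
  monomial (- b) (fun i => - J (i - b)) sg' sg.
Proof.
move=> [sgE sgK sgVK]; split=> // x n; rewrite -[x in RHS]sgVK.
have := sgE (sg' x) (n - b); rewrite subrK => ->.
rewrite (unifXM (res_local S)) (_ : n + 1 - b = n - b + 1); last by lia.
by rewrite [X in u ^ X](_ : _ = 0) ?expr0z ?mul1r //; lia.
Qed.

Section Fixed.
Context (b : int) (J : int -> int) (sg sg' : K -> K).
Hypothesis M : monomial b J sg sg'.

Lemma monoE x n : lc (sg x) n = u ^ (J (n - b + 1) - J (n - b)) * lc x (n - b).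
Proof. by rewrite -(mono_coef M) subrK. Qed.

Lemma monoD x y : sg (x + y) = sg x + sg y.
Proof.
by apply: (lcoef_inj (l := X)) => n; rewrite lcoefD !monoE lcoefD mulrDr.
Qed.

Lemma mono_lfil i x : O (i + b) (sg x) <-> O i x.
Proof.
split=> Ox n ni; last by rewrite monoE Ox ?mulr0 //; lia.
have := Ox (n + b); rewrite (mono_coef M) => /(_ _) /eqP.
rewrite mulf_eq0 (negPf (expfz_neq0 _ (unif_neq0 (res_local S)))) => H.
by apply/eqP; apply: H; lia.
Qed.

(** Finitely many degrees are involved, so the exponents of u are bounded; the bound is the loss of
    level when a test function is pulled back. *)
Lemma mono_bound s r : s <= r ->
  exists E : int, forall i, s <= i -> i < r -> - E <= J (i + 1) - J i <= E.
Proof.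
move=> sr; have -> : r = s + `|r - s|%N%:Z by lia.
elim: `|r - s|%N => [|d [E HE]]; first by exists 0 => i; lia.
pose D := J (s + d%:Z + 1) - J (s + d%:Z).
exists (Order.max E (`|D|%N%:Z)) => i si id.
have [->|ni] := eqVneq i (s + d%:Z); first by rewrite -/D; lia.
by have := HE i si ltac:(lia); lia.
Qed.

Lemma test_mono s r f : s <= r ->
  test (OO S (s + b) (r + b)) f -> test (OO S s r) (f \o sg).
Proof.
move=> sr; have srb : s + b <= r + b by lia.
move=> /(tameP (filtered_OO S srb)) [n [m [f1 f2]]].
have [E HE] := mono_bound sr.
apply/(tameP (filtered_OO S sr)); exists (n + E), (m - E).
split=> [x y /(nbh_OO _ _ sr) [Oy hy]|x nUx] /=.
  rewrite monoD f1 //; apply/(nbh_OO _ _ srb); split; first exact/mono_lfil.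
  move=> i ir; have [Hi|Hi] := ltP i (s + b).
    by rewrite monoE Oy ?mulr0; [exact: (int0 (res_local S))|lia].
  have := hy (i - b) => /(_ ltac:(lia)).
  rewrite monoE (unifXM (res_local S)) => h.
  rewrite [X in u ^ X](_ : _ = - (n - (J (i - b + 1) - J (i - b))));
    last by lia.
  apply: (int_le (res_local S)) h; have := HE (i - b) ltac:(lia) ltac:(lia).
  by move: (J (i - b + 1)) (J (i - b)) => *; lia.
apply: f2 => /(nbh_OO _ _ srb) [/mono_lfil Ox hx]; apply: nUx.
apply/(nbh_OO _ _ sr); split=> // i ir; have [Hi|Hi] := ltP i s.
  by rewrite Ox ?mulr0; [exact: (int0 (res_local S))|].
have := hx (i + b) => /(_ ltac:(lia)).
rewrite (mono_coef M) (unifXM (res_local S)) => h.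
apply: (int_le (res_local S) (n := m - (J (i + 1) - J i))); last first.
  by move: h; congr (Ok (u ^ _ * _)); lia.
by have := HE i Hi ir; move: (J (i + 1)) (J i) => *; lia.
Qed.

End Fixed.

Section Push.
Context (b : int) (J : int -> int) (sg sg' : K -> K).
Hypothesis M : monomial b J sg sg'.
Let M' := mono_inv M.

Lemma test_monoP s r f : s <= r ->
  test (OO S s r) (f \o sg) <-> test (OO S (s + b) (r + b)) f.
Proof.
move=> sr; split=> [tf|]; last exact: (test_mono M sr).
have -> : f = (f \o sg) \o sg' by apply/funext => x /=; rewrite (monoVK M).
by apply: (test_mono M'); rewrite ?addrK //; lia.
Qed.

Lemma dpushK T : dpush sg' (dpush sg T) = T.
Proof.
apply/funext => f; rewrite /dpush; congr T; apply/funext => x /=.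
by rewrite (monoK M).
Qed.

Lemma dpushVK T : dpush sg (dpush sg' T) = T.
Proof.
apply/funext => f; rewrite /dpush; congr T; apply/funext => x /=.
by rewrite (monoVK M).
Qed.

Lemma distr_push s r T : s <= r ->
  distr (OO S s r) T -> distr (OO S (s + b) (r + b)) (dpush sg T).
Proof.
move=> sr [TD T0]; split=> [a f g /(test_monoP _ sr) tf /(test_monoP _ sr) tg|f
  nf].
  by rewrite -TD.
by apply: T0 => /(test_monoP _ sr).
Qed.

Lemma haar_push s r m : s <= r ->
  haar (OO S s r) m -> haar (OO S (s + b) (r + b)) (dpush sg m).
Proof.
move=> sr [Dm mV]; split=> [|a f Oa /(test_monoP _ sr) tf].
  exact: distr_push.
rewrite /dpush -[RHS](mV (sg' a)) //; last first.
  by apply/(mono_lfil M); rewrite (monoVK M).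
congr m; apply/funext => x /=; by rewrite (monoD M) (monoVK M).
Qed.

Lemma restr_mono r f : restr r (f \o sg) = restr (r + b) f \o sg.
Proof.
apply/funext => x; rewrite /restr /=; congr (if _ then _ else _).
by apply: asbool_equiv_eq; apply: iff_sym; exact: (mono_lfil M).
Qed.

Lemma fibre_int_push r m f x :
  fibre_int (r + b) (dpush sg m) f (sg x) = fibre_int r m (f \o sg) x.
Proof.
rewrite !fibre_intE /dpush -restr_mono; congr m; congr restr.
by apply/funext => y /=; rewrite (monoD M).
Qed.

Lemma inv_image_push s r r' T m : s <= r' ->
  dpush sg (inv_image s r r' T m) =
  inv_image (s + b) (r + b) (r' + b) (dpush sg T) (dpush sg m).
Proof.
move=> sr; apply/funext => f; rewrite /inv_image /on_dom /dpush.
rewrite (asbool_equiv_eq (test_monoP f sr)); case: asboolP => // tf.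
by congr T; apply/funext => x /=; rewrite -fibre_int_push.
Qed.

Lemma dir_image_push s' s r T : s' <= r ->
  dpush sg (dir_image s' s r T) =
  dir_image (s' + b) (s + b) (r + b) (dpush sg T).
Proof.
move=> sr; apply/funext => f; rewrite /dir_image /on_dom /dpush.
rewrite (asbool_equiv_eq (test_monoP f sr)); case: asboolP => // tf.
by congr T; exact: restr_mono.
Qed.

Hypothesis q_gt1 : (1 < q)%N.

Lemma Q_neq0 : Q != 0.
Proof. by rewrite pnatr_eq0; lia. Qed.

Lemma haar_unifX i (n : int) m : haar (OO S i (i + 1)) m ->
  m (\1_(U i (i + 1) n)) = Q ^ (- n) * m (\1_(U i (i + 1) 0)).
Proof.
move=> Hm; have step j : m (\1_(U i (i + 1) (j + 1))) =
    Q^-1 * m (\1_(U i (i + 1) j)).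
  by rewrite (haar_unif j Hm) mulKf // Q_neq0.
elim/int_rec: n => [|n IH|n IH]; first by rewrite oppr0 expr0z mul1r.
  rewrite -addn1 PoszD step IH mulrA -[X in X * _ * _]exprN1 -expfzDr ?Q_neq0
    //.
  by congr (_ ^ _ * _); lia.
have := step (- n.+1%:Z); rewrite (_ : - n.+1%:Z + 1 = - n%:Z); last by lia.
rewrite IH => /(congr1 (fun z => Q * z)); rewrite mulVKf ?Q_neq0 // => <-.
by rewrite mulrA -{1}[Q]expr1z -expfzDr ?Q_neq0 //; congr (_ ^ _ * _); lia.
Qed.

Lemma haarB_push s r : s <= r ->
  dpush sg (hB s r) = Q ^ (J r - J s) *: hB (s + b) (r + b).
Proof.
move=> sr; have srb : s + b <= r + b by lia.
have [HB B1] := haarBP R S sr; have [HBb B1b] := haarBP R S srb.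
apply: (haar_eq srb); [exact: haar_push|exact: haarZ|].
rewrite !fctE B1b [RHS]mulr1 {HBb B1b}.
move: srb HB B1; have -> : r = s + `|r - s|%N%:Z by lia.
elim: `|r - s|%N => [|d IH] srb HB B1.
  rewrite addr0 in srb HB B1 *; rewrite subrr expr0z -[RHS]B1 /dpush;
    congr (hB s s).
  apply/funext => x /=; rewrite !charBE // !indicE; congr (_%:R);
    congr nat_of_bool.
  apply/idP/idP; rewrite !inE => /(nbh_OO _ _ (lexx _)) [Ox _].
    by have Ox' := (mono_lfil M s x).1 Ox; exact: OO_nbh.
  by apply: OO_nbh; apply/(mono_lfil M).
rewrite -addn1 PoszD addrA in srb HB B1 *; set r1 := s + d%:Z in IH srb HB B1 *.
have sr1 : s <= r1 by rewrite /r1; lia.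
have r12 : r1 <= r1 + 1 by lia.
have [HB1 B11] := haarBP R S sr1; have [HB2 B12] := haarBP R S r12.
(* The graded piece of degree r1 is split off; both sides have the value 1 on B. *)
have -> : hB s (r1 + 1) = inv_image s r1 (r1 + 1) (hB s r1) (hB r1 (r1 + 1)).
  have sr2 : s <= r1 + 1 by lia.
  apply: (haar_eq sr2) => //; first exact: haar_inv_image.
  by rewrite inv_image_charB ?B11 ?B12 ?mulr1 //; exact: HB1.1.
rewrite inv_image_push; last by lia.
rewrite inv_image_charB; first last.
- exact: haar_push.
- by apply: distr_push => //; exact: HB1.1.
- by lia.
- by lia.
rewrite IH //; last by lia.
have -> : dpush sg (hB r1 (r1 + 1)) (charB R (r1 + b) (r1 + 1 + b)) =
    Q ^ (J (r1 + 1) - J r1).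
  (* In degree r1 the map multiplies by u^e with e = J (r1 + 1) - J r1, so the inverse image of B is
     the neighbourhood of index - e, of measure q^e. *)
  rewrite -[RHS]mulr1 -[X in _ = _ * X]B12 (charBE _ _ r12).
  have -> : J (r1 + 1) - J r1 = - (J r1 - J (r1 + 1)) by rewrite opprB.
  rewrite -haar_unifX // /dpush; congr (hB _ _).
  apply/funext => x /=; rewrite charBE; last by lia.
  rewrite !indicE; congr (_%:R); congr nat_of_bool.
  have r12b : r1 + b <= r1 + 1 + b by lia.
  apply/idP/idP; rewrite !inE.
    move=> /(nbh_OO _ _ r12b) [/(mono_lfil M) Ox hx]; apply/nbh_OO => //.
    split=> // i ir; have [Hi|Hi] := eqVneq i r1; last first.
      by rewrite Ox ?mulr0; [exact: (int0 (res_local S))|lia].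
    have := hx (i + b) => /(_ ltac:(lia)).
    rewrite (mono_coef M) oppr0 expr0z mul1r Hi.
    by congr (Ok (u ^ _ * _)); lia.
  move=> /(nbh_OO _ _ r12) [Ox hx]; apply/(nbh_OO _ _ r12b).
  split=> [|i ir]; first exact/(mono_lfil M).
  rewrite oppr0 expr0z mul1r (monoE M); have [Hi|Hi] := eqVneq (i - b) r1;
    last first.
    by rewrite Ox ?mulr0; [exact: (int0 (res_local S))|lia].
  have := hx (i - b) => /(_ ltac:(lia)).
  by rewrite Hi; congr (Ok (u ^ _ * _)); lia.
rewrite -expfzDr ?Q_neq0 //; congr (_ ^ _).
by move: (J r1) (J (r1 + 1)) (J s) => *; lia.
Qed.

Lemma haarB_pushV s r : s <= r ->
  dpush sg' (hB (s + b) (r + b)) = Q ^ (J s - J r) *: hB s r.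
Proof.
move=> sr; have /(congr1 (fun T => Q ^ (J s - J r) *: dpush sg' T)) :=
  haarB_push sr.
rewrite dpushK => ->.
have -> : dpush sg' (Q ^ (J r - J s) *: hB (s + b) (r + b)) =
  Q ^ (J r - J s) *: dpush sg' (hB (s + b) (r + b)) by [].
by rewrite scalerA -expfzDr ?Q_neq0 // [X in Q ^ X](_ : _ = 0) ?expr0z ?scale1r
  //; lia.
Qed.

(** One exponent serves both orders of r and s: dualizing inverts the scalar, which amounts to
    exchanging r and s in it. *)
Lemma rpush_muB r s (x : C) : rpush sg sg' (x *: muB R S r s) =
  (x * Q ^ (J r - J s)) *: muB R S (r + b) (s + b).
Proof.
rewrite !muBE lerD2r; case: leP => [sr|/ltW rs].
  rewrite /rpush /=; congr pair; last first.
    by rewrite !scaler0; apply/funext.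
  rewrite -scalerA -haarB_push //.
rewrite /rpush /=; congr pair; first by rewrite !scaler0; apply/funext.
apply/funext => m; rewrite !fctE /=.
have rsb : r + b <= s + b by lia.
have [Hm|nHm] := pselect (haar (OO S (r + b) (s + b)) m); last first.
  rewrite (ldual_dualB R S rsb).2 // scaler0.
  rewrite (ldual_dualB R S rs).2 ?scaler0 // => /(haar_push rs).
  by rewrite dpushVK.
rewrite [dualB _ _ m]dualBE // (haar_haarB rsb Hm); set c := m _.
have -> : dpush sg' (c *: hB (r + b) (s + b)) = c *: dpush sg' (hB (r + b) (s +
  b)).
  by [].
have [HB B1] := haarBP R S rs; have [HBb B1b] := haarBP R S rsb.
rewrite haarB_pushV // scalerA dualBE; last exact: haarZ.
rewrite !fctE B1 B1b [_ *: 1]mulr1 [_ *: 1]mulr1.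
by rewrite [c * _]mulrC; exact: mulrA.
Qed.

End Push.

Lemma rpush_mu b J sg sg' r s (a : relm R S) : (1 < q)%N ->
  monomial b J sg sg' ->
  mu r s a <-> mu (r + b) (s + b) (rpush sg sg' a).
Proof.
move=> q_gt1 M; split=> [/muE [x ->]|/muE [x e]].
  by rewrite (rpush_muB M q_gt1); apply/muE; eexists.
have -> : a = rpush sg' sg (rpush sg sg' a).
  rewrite /rpush /= (dpushK M); case: a {e} => a1 a2 /=; congr pair.
  by apply/funext => m; rewrite (dpushK M).
rewrite e (rpush_muB (mono_inv M) q_gt1) !addrK.
by apply/muE; eexists.
Qed.

End Monomial.

(** * The inductive limit of the spaces of distributions *)

Section Lift.
Context (C : nzRingType) (Z : choiceType) (M : lmodType C).
Context (rel : set {freeg Z / C}) (h : Z -> M).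
Implicit Types d : {freeg Z / C}.

Lemma fgliftB d d' : fglift h (d - d') = fglift h d - fglift h d'.
Proof. exact: lift_is_additive. Qed.

Lemma fglift0 : fglift h 0 = 0.
Proof. by rewrite -(subrr 0) fgliftB subrr. Qed.

Lemma fgliftD d d' : fglift h (d + d') = fglift h d + fglift h d'.
Proof. by rewrite -{1}(opprK d') fgliftB -(sub0r d') fgliftB fglift0 sub0r
  opprK. Qed.

Lemma fglift_sum (I : Type) (s : seq I) (F : I -> {freeg Z / C}) :
  fglift h (\sum_(i <- s) F i) = \sum_(i <- s) fglift h (F i).
Proof.
by elim: s => [|i s IH]; rewrite ?big_nil ?fglift0 // !big_cons fgliftD IH.
Qed.

Lemma fgliftZ a d : fglift h (a *: d) = a *: fglift h d.
Proof.
rewrite -{2}[d]freeg_sumE fglift_sum scaler_sumr.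
rewrite -[a *: d]/(\sum_(x <- dom d) << a * coeff x d *g x >>) fglift_sum.
by apply: eq_bigr => x _; rewrite !liftU scalerA.
Qed.

Hypothesis h_rel : forall d, rel d -> fglift h d = 0.

Lemma fglift_span d : lspan rel d -> fglift h d = 0.
Proof.
move=> /(_ [set d | fglift h d = 0]); apply => [|x /h_rel //].
split=> [|a x y /= hx hy]; first exact: fglift0.
by rewrite fgliftD fgliftZ hx hy scaler0 addr0.
Qed.

Lemma fglift_class d : fglift h (repr (lclass rel d)) = fglift h d.
Proof.
have /lclassP/fglift_span := lclassK (lclass rel d).
by rewrite fgliftB => /eqP; rewrite subr_eq0 => /eqP.
Qed.

Lemma lclass_rel d : rel d -> lclass rel d = 0.
Proof.
move=> rd; have -> : 0 = lclass rel 0.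
  by apply: (addrI (lclass rel 0)); rewrite -lclassD !addr0.
by apply/lclassP; rewrite subr0 => W _; apply.
Qed.

Lemma fglift_lin a (x y : lquot rel) :
  fglift h (repr (a *: x + y)) = a *: fglift h (repr x) + fglift h (repr y).
Proof.
rewrite -{1}(lclassK x) -{1}(lclassK y).
rewrite -[a *: lclass _ _]/(lquot_scale a (lclass rel (repr x))).
by rewrite lquot_scaleE -lclassD fglift_class fgliftD fgliftZ.
Qed.

End Lift.

Section InductiveLimit.
Context (R : realType) (p q : nat) (S : field2d p q).
Local Notation C := R[i].
Local Notation K := (big_field S).
Local Notation Q := (q%:R : C).
Local Notation dK := (distK R S).
Local Notation rel := (@dist_rel R p q S).
Implicit Types (T m : dist R S) (nu : relm R S).

Lemma lclassZ a (d : {freeg (gen R S) / C}) : a *: lclass rel d = lclass rel (a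
  *: d).
Proof. exact: lquot_scaleE. Qed.

Lemma dtens_eq (d : {freeg (gen R S) / C}) : rel d -> (lclass rel d : dK) = 0.
Proof. exact: lclass_rel. Qed.

Lemma lclassB (d d' : {freeg (gen R S) / C}) : rel (d - d') ->
  lclass rel d = lclass rel d'.
Proof. by move=> H; apply/lclassP => W _; apply. Qed.

Lemma dtens_out s r T nu : ~ admissible (s, r, T, nu) -> dtens s r T nu = 0.
Proof. by move=> na; apply: dtens_eq; exact: rel_adm. Qed.

Lemma dtens_linl s r a T T' nu : s < r -> distr (OO S s r) T ->
  distr (OO S s r) T' -> mu 0 r nu ->
  dtens s r (a *: T + T') nu = a *: dtens s r T nu + dtens s r T' nu.
Proof.
move=> sr DT DT' Mn; rewrite /dtens lclassZ -lclassD.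
by apply: lclassB; exact: rel_linl.
Qed.

Lemma dtens_linr s r a T nu nu' : s < r -> distr (OO S s r) T ->
  mu 0 r nu -> mu 0 r nu' ->
  dtens s r T (a *: nu + nu') = a *: dtens s r T nu + dtens s r T nu'.
Proof.
move=> sr DT Mn Mn'; rewrite /dtens lclassZ -lclassD.
by apply: lclassB; exact: rel_linr.
Qed.

Lemma mu0 r s : mu r s (0 : relm R S).
Proof. by apply/muE; exists 0; rewrite scale0r. Qed.

Lemma mu_lin r s (a : C) nu nu' : mu r s nu -> mu r s nu' ->
  mu r s (a *: nu + nu').
Proof.
move=> /muE [x ->] /muE [y ->]; apply/muE; exists (a * x + y).
by rewrite scalerDl scalerA.
Qed.

Lemma dtens0r s r T : dtens s r T 0 = 0 :> dK.
Proof.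
have [[sr DT _]|/dtens_out //] := pselect (admissible (s, r, T, 0)).
have := dtens_linr 1 sr DT (mu0 0 r) (mu0 0 r).
by rewrite scaler0 addr0 scale1r => /eqP; rewrite -subr_eq subrr eq_sym => /eqP.
Qed.

Lemma dtensZr s r T a nu : s < r -> distr (OO S s r) T -> mu 0 r nu ->
  dtens s r T (a *: nu) = a *: dtens s r T nu.
Proof.
move=> sr DT Mn; have := dtens_linr a sr DT Mn (mu0 0 r).
by rewrite !addr0 dtens0r addr0.
Qed.

Lemma ldual_lin (V : lmodType C) (D : set V) (a : C) (T T' : V -> C^o) :
  ldual D T -> ldual D T' -> ldual D (a *: T + T').
Proof.
move=> [TD T0] [TD' T0']; split=> [b x y Dx Dy|x nDx]; rewrite !fctE.
  rewrite TD // TD' // scalerDr mulrDr addrACA; congr (_ + _ + _).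
  exact: mulrCA.
by rewrite T0 // T0' // scaler0 addr0.
Qed.

Lemma ldual_zero (V : lmodType C) (D : set V) : ldual D (0 : V -> C^o).
Proof. by split=> // a x y _ _; rewrite -[RHS]/(a * 0 + 0 : C) mulr0 addr0. Qed.

Lemma dtens0l s r nu : dtens s r 0 nu = 0 :> dK.
Proof.
have [[sr DT Mn]|/dtens_out //] := pselect (admissible (s, r, 0, nu)).
have := dtens_linl 1 sr DT DT Mn.
by rewrite scaler0 addr0 scale1r => /eqP; rewrite -subr_eq subrr eq_sym => /eqP.
Qed.

Lemma dtensZl s r T a nu : s < r -> distr (OO S s r) T -> mu 0 r nu ->
  dtens s r (a *: T) nu = a *: dtens s r T nu.
Proof.
move=> sr DT Mn; have D0 : distr (OO S s r) (0 : dist R S) by exact: ldual_zero.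
by have := dtens_linl a sr DT D0 Mn; rewrite !addr0 dtens0l addr0.
Qed.

(** * Operators on the inductive limit induced by monomial automorphisms *)

Section Act.
Hypothesis q_gt1 : (1 < q)%N.
Context (b : int) (J : int -> int) (sg sg' : K -> K) (c : C).
Context (rho : int -> relm R S -> relm R S).
Hypothesis M : monomial b J sg sg'.
(* For [R_d], [rho] is the action on the factor mu(O | O(r)); for a pair (g,
   m) it is followed by the product with m. *)
Hypothesis rhoE : forall r (x : C),
  rho r (x *: muB R S 0 r) = (x * c * Q ^ (- J r)) *: muB R S 0 (r + b).
(** Generators that are not admissible vanish in the limit, so their images must vanish too: either
    they are not admissible, or the measure is 0, the default value of [tensor]. *)
Hypothesis rho_out : forall r nu, ~ mu 0 r nu ->
  ~ mu 0 (r + b) (rho r nu) \/ rho r nu = 0.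

Definition gen_act (z : gen R S) : dK :=
  let: (s, r, T, nu) := z in dtens (s + b) (r + b) (dpush sg T) (rho r nu).

Lemma rho_mu r nu : mu 0 r nu -> mu 0 (r + b) (rho r nu).
Proof. by move=> /muE [x ->]; rewrite rhoE; apply/muE; eexists. Qed.

Lemma rho_lin r (a : C) nu nu' : mu 0 r nu -> mu 0 r nu' ->
  rho r (a *: nu + nu') = a *: rho r nu + rho r nu'.
Proof.
move=> /muE [x ->] /muE [y ->].
by rewrite scalerA -scalerDl !rhoE scalerA -scalerDl !mulrDl !mulrA.
Qed.

Lemma gen_act_rel d : rel d -> fglift gen_act d = 0.
Proof.
case=> {d}.
- move=> [[[s r] T] nu] na; rewrite liftU scale1r /gen_act.
  have [Mn|/rho_out [nM|->]] := pselect (mu 0 r nu); last exact: dtens0r.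
    apply: dtens_out => -[sr DT _]; apply: na; rewrite ltrD2r in sr.
    have srb : s + b <= r + b by lia.
    by split=> //; have := distr_push (mono_inv M) srb DT;
      rewrite !addrK (dpushK M).
  by apply: dtens_out => -[_ _].
- move=> s r a T T' nu sr DT DT' Mn.
  rewrite fgliftB fgliftD fgliftZ !liftU !scale1r /gen_act.
  apply/eqP; rewrite subr_eq0; apply/eqP.
  rewrite -dtens_linl //; [by lia| | |exact: rho_mu].
  + by apply: (distr_push M) => //; exact: ltW.
  + by apply: (distr_push M) => //; exact: ltW.
- move=> s r a T nu nu' sr DT Mn Mn'.
  rewrite fgliftB fgliftD fgliftZ !liftU !scale1r /gen_act.
  apply/eqP; rewrite subr_eq0; apply/eqP.
  rewrite rho_lin // dtens_linr //; [by lia| |exact: rho_mu|exact: rho_mu].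
  by apply: (distr_push M) => //; exact: ltW.
- move=> s' s r T nu ss sr DT Mn.
  rewrite fgliftB !liftU !scale1r /gen_act; apply/eqP; rewrite subr_eq0;
    apply/eqP.
  apply: lclassB; rewrite (dir_image_push M); last by lia.
  apply: rel_low; [by lia|by lia| |exact: rho_mu].
  by apply: (distr_push M) => //; exact: ltW.
- move=> s r r' T nu' m sr rr DT Mn Hm.
  rewrite fgliftB !liftU !scale1r /gen_act; apply/eqP; rewrite subr_eq0;
    apply/eqP.
  apply: lclassB; rewrite (inv_image_push M); last by lia.
  have rr0 := rr; have {}rr : r <= r' := ltW rr.
  have Hm' := haar_push M rr Hm.
  have [x nuE] := (muE _ _ _).1 Mn.
  have pairE s1 r1 m1 : s1 <= r1 -> haar (OO S s1 r1) m1 ->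
      (m1, 0) = m1 (charB R s1 r1) *: muB R S r1 s1 :> relm R S.
    move=> sr1 H1; rewrite muBE sr1 [in LHS](haar_haarB sr1 H1).
    by congr pair; rewrite scaler0.
  have mE := pairE _ _ _ rr Hm.
  have -> : rho r (tensor 0 r' r nu' (m, 0)) =
      tensor 0 (r' + b) (r + b) (rho r' nu') (dpush sg m, 0).
    rewrite nuE mE tensorE !rhoE (pairE (r + b) (r' + b)) //; last by lia.
    rewrite tensorE; congr (_ *: _).
    have -> : dpush sg m (charB R (r + b) (r' + b)) =
        m (charB R r r') * Q ^ (J r' - J r).
      rewrite [in LHS](haar_haarB rr Hm); set y := m _.
      rewrite -[dpush _ _]/(y *: dpush sg (haarB r r' : dist R S)).
      rewrite (haarB_push R M q_gt1 rr) !fctE.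
      have [|_ ->] := haarBP R S (s := r + b) (r := r' + b); first by lia.
      by congr (_ * _); exact: mulr1.
    (* The factor gained by m on O(r)/O(r') is exactly the discrepancy between the scalings of mu(O
       | O(r)) and mu(O | O(r')). *)
    have JE : - J r = - J r' + (J r' - J r) by rewrite addrA addNr add0r.
    rewrite [in LHS]JE expfzDr ?(Q_neq0 R q_gt1) //.
    have comm (x1 y1 c1 A1 B1 : C) : x1 * y1 * c1 * (A1 * B1) = x1 * c1 * A1 *
      (y1 * B1).
      by ring.
    exact: comm.
  apply: rel_high; [by lia|by lia| |exact: rho_mu|by []].
  by apply: (distr_push M) => //; exact: ltW.
Qed.

Lemma dlift_lin (a : C) (x y : dK) :
  dlift gen_act (a *: x + y) = a *: dlift gen_act x + dlift gen_act y.
Proof. exact: (fglift_lin gen_act_rel). Qed.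

Lemma dlift_dtens s r T nu :
  dlift gen_act (dtens s r T nu) = dtens (s + b) (r + b) (dpush sg T) (rho r
    nu).
Proof. by rewrite /dlift /dtens (fglift_class gen_act_rel) liftU scale1r. Qed.

End Act.

(* The characteristic functions of the images of [B] in the O(s)/O(r),
   tensored with the duals of the [muB R S 0 r], form a compatible family of
   test functions, hence define a linear form on the inductive limit. *)
Definition evalB_gen (z : gen R S) : C^o :=
  let: (s, r, T, nu) := z in
  if `[< admissible (s, r, T, nu) >] then T (charB R s r) * coord 0 r nu else 0.

Lemma evalB_genE s r T nu : s < r -> distr (OO S s r) T -> mu 0 r nu ->
  evalB_gen (s, r, T, nu) = T (charB R s r) * coord 0 r nu.
Proof. by move=> *; rewrite /evalB_gen asboolT. Qed.

(** For a change of s, the indicator of B restricts to the indicator of B; for a change of r,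
    evaluation on B is multiplicative. *)
Lemma evalB_gen_rel d : rel d -> fglift evalB_gen d = 0.
Proof.
case=> {d}.
- by move=> [[[s r] T] nu] na; rewrite liftU /evalB_gen asboolF // scaler0.
- move=> s r a T T' nu sr DT DT' Mn.
  rewrite fgliftB fgliftD fgliftZ !liftU !scale1r !evalB_genE //;
    last exact: ldual_lin.
  by apply/eqP; rewrite subr_eq0 !fctE mulrDl; apply/eqP; congr (_ + _);
    exact: esym (mulrA _ _ _).
- move=> s r a T nu nu' sr DT Mn Mn'.
  rewrite fgliftB fgliftD fgliftZ !liftU !scale1r !evalB_genE //;
    last exact: mu_lin.
  apply/eqP; rewrite subr_eq0 coord_lin mulrDr; apply/eqP; congr (_ + _).
  exact: mulrCA.
- move=> s' s r T nu ss sr DT Mn.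
  have sr' : s' <= s := ltW ss; have srW : s <= r := ltW sr.
  rewrite fgliftB !liftU !scale1r !evalB_genE //; first last.
  + exact: distr_dir_image.
  + exact: lt_trans sr.
  rewrite dir_imageE ?restr_charB ?subrr //.
  by apply: test_charB; exact: le_trans srW.
- move=> s r r' T nu' m sr rr DT Mn Hm.
  have {}rr : r <= r' := ltW rr; have srW : s <= r := ltW sr.
  have [x nuE] := (muE _ _ _).1 Mn.
  have mE : (m, 0) = m (charB R r r') *: muB R S r' r :> relm R S.
    rewrite muBE rr [in LHS](haar_haarB rr Hm).
    by congr pair; rewrite scaler0.
  rewrite fgliftB !liftU !scale1r nuE mE tensorE !evalB_genE //; first last.
  + by apply/muE; eexists.
  + exact: distr_inv_image.
  + exact: lt_le_trans rr.
  + by apply/muE; eexists.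
  rewrite !coordZ inv_image_charB //; apply/eqP; rewrite subr_eq0 mulrA;
    apply/eqP.
  exact: mulrAC.
Qed.

Definition evalB (x : dK) : C^o := fglift evalB_gen (repr (x : lquot rel)).

Lemma evalB_lin (a : C) (x y : dK) : evalB (a *: x + y) = a * evalB x + evalB y.
Proof. exact: (fglift_lin evalB_gen_rel). Qed.

Lemma evalB_dtens s r T nu : s < r -> distr (OO S s r) T -> mu 0 r nu ->
  evalB (dtens s r T nu) = T (charB R s r) * coord 0 r nu.
Proof.
move=> sr DT Mn.
by rewrite /evalB /dtens (fglift_class evalB_gen_rel) liftU scale1r evalB_genE.
Qed.

End InductiveLimit.

(** * The action on the distributions phi_l *)

Section Action.
Context (R : realType) (p q : nat) (S : field2d p q).
Local Notation C := R[i].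
Local Notation k := (res_field S).
Local Notation u := (res_unif S).
Local Notation Ok := (@res_int p q S).
Local Notation K := (big_field S).
Local Notation X := (expansion S).
Local Notation lc := (lcoef X).
Local Notation O := (lfil X).
Local Notation Q := (q%:R : C).
Local Notation dK := (distK R S).
Implicit Types (phi : rdist R S).

Lemma lcoef_uK_tK (a b : int) (x : K) n :
  lc (uK S ^ a * tK S ^ b * x) n = u ^ a * lc x (n - b).
Proof. by rewrite /uK /tK -lconstX -mulrA lcoef_lconstM lcoef_lvarXM. Qed.

Lemma uK_tK_neq0 (a b : int) : uK S ^ a * tK S ^ b != 0.
Proof.
rewrite mulf_neq0 // expfz_neq0 ?lvar_neq0 //.
by rewrite /uK lconst_eq0; exact: (unif_neq0 (res_local S)).
Qed.

Lemma monomial_uK_tK (a b : int) : monomial (S := S) b (fun i => a * i)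
  ( *%R (uK S ^ a * tK S ^ b)) ( *%R (uK S ^ a * tK S ^ b)^-1).
Proof.
split=> [x n|x|x]; rewrite ?mulKf ?mulVKf ?uK_tK_neq0 //.
by rewrite lcoef_uK_tK addrK; congr (u ^ _ * _); lia.
Qed.

(** The primitive of the identity vanishing at 0: R_d multiplies the n-th coefficient by u^(nd), so
    its J is d times this function. *)
Definition triangular (i : int) : int := (i * (i - 1) %/ 2)%Z.

Lemma triangularS i : triangular (i + 1) - triangular i = i.
Proof.
rewrite /triangular addrK.
have -> : (i + 1) * i = i * 2 + i * (i - 1) by lia.
by rewrite divzMDl // addrK.
Qed.

(** One of l and l + 1 is even, so the division is exact and commutes with the factor d. *)
Lemma triangular_mul (d l : int) : (d * l * (l + 1) %/ 2)%Z = d * triangular (l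
  + 1).
Proof.
rewrite /triangular addrK.
have [m e] : exists m, (l + 1) * l = m * 2.
  have [[j ->]|[j ->]] : (exists j, l = j * 2) \/ (exists j, l = j * 2 + 1).
  - by have [e|e] : (l %% 2 = 0 \/ l %% 2 = 1)%Z; [lia|left|right];
      exists (l %/ 2)%Z; lia.
  - by exists ((j * 2 + 1) * j); lia.
  - by exists ((j + 1) * (j * 2 + 1)); lia.
have -> : d * l * (l + 1) = (d * m) * 2 by rewrite -mulrA [l * _]mulrC e mulrA.
by rewrite e !mulzK.
Qed.

Lemma lcoef_Raut (d : int) (x : K) n : lc (Raut d x) n = lc x n * u ^ (n * d).
Proof.
have [N HN] := lcoef_bounded X x.
by rewrite /Raut (lcoef_lseries X (N := N)) // => m mN; rewrite HN ?mul0r.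
Qed.

Lemma monomial_Raut (d : int) : monomial (S := S) 0 (fun i => d * triangular i)
  (Raut d) (Raut (- d)).
Proof.
split=> [x n|x|x].
- rewrite addr0 lcoef_Raut mulrC; congr (u ^ _ * _).
  by rewrite -mulrBr triangularS mulrC.
- apply: (lcoef_inj (l := X)) => n; rewrite !lcoef_Raut -mulrA.
  by rewrite -expfzDr ?(unif_neq0 (res_local S)) // mulrN subrr expr0z mulr1.
- apply: (lcoef_inj (l := X)) => n; rewrite !lcoef_Raut -mulrA.
  by rewrite -expfzDr ?(unif_neq0 (res_local S)) // mulrN addNr expr0z mulr1.
Qed.

Lemma lfil_inj (i j : int) : O i = O j -> i = j.
Proof.
have key a b : O a = O b -> b <= a.
  move=> e; rewrite leNgt; apply/negP => ab.
  have : O a (lvar X ^ a * 1).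
    by move=> n na; rewrite lcoef_lvarXM -(lconst1 X) lcoef_lconst ifF //; lia.
  rewrite e => /(_ a ab); rewrite lcoef_lvarXM subrr -(lconst1 X) lcoef_lconst
    eqxx.
  by move/eqP; rewrite oner_eq0.
by move=> e; apply/eqP; rewrite eq_le !key.
Qed.

Lemma ordK_uK_tK (a b : int) : ordK (uK S ^ a * tK S ^ b) = b.
Proof.
have M := monomial_uK_tK a b.
have E : [set uK S ^ a * tK S ^ b * x | x in O 0] = O b.
  apply/seteqP; split=> [_ [x Ox <-]|y Oy].
    by have := (mono_lfil M 0 x).2 Ox; rewrite add0r.
  exists ((uK S ^ a * tK S ^ b)^-1 * y); last exact: (monoVK M).
  by apply/(mono_lfil M); rewrite add0r (monoVK M).
rewrite /ordK; case: xgetP => [j _ /= ej|/(_ b) //].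
by apply: lfil_inj; rewrite -E.
Qed.

Lemma actR_gen (d : int) : actR d = dlift (gen_act 0 (Raut d)
   (fun _ => rpush (Raut d) (Raut (- d)))) :> (dK -> dK).
Proof.
rewrite /actR; congr dlift; apply/funext => -[[[s r] T] nu].
by rewrite /gen_act !addr0.
Qed.

Lemma actG_gen (a b c : int) : actG (a, b, c) =
  dlift (gen_act b ( *%R (uK S ^ a * tK S ^ b)) (fun r nu =>
    tensor 0 b (r + b) (Q ^ (- c) *: muB R S 0 b)
      (rpush ( *%R (uK S ^ a * tK S ^ b)) ( *%R (uK S ^ a * tK S ^ b)^-1) nu)))
  :> (dK -> dK).
Proof.
rewrite /actG /actK; congr dlift; apply/funext => -[[[s r] T] nu].
by rewrite ordK_uK_tK.
Qed.

Lemma test_res (l : int) (f : K -> C^o) : test (OO S l (l + 1)) f ->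
  test (resG S) (fun x => f (tK S ^ l * lconst X x)).
Proof.
have ll : l <= l + 1 by lia.
have cE x n : lc (tK S ^ l * lconst X x) n = if n == l then x else 0.
  by rewrite /tK lcoef_lvarXM lcoef_lconst subr_eq0.
have NE n x : nbh (OO S l (l + 1)) n (tK S ^ l * lconst X x) <->
  nbh (resG S) n x.
  rewrite nbh_OO // nbh_resG; split=> [[_ /(_ l)]|h].
    by rewrite cE eqxx; apply; lia.
  split=> i il; rewrite cE; first by rewrite ifF //; lia.
  by case: eqP => // _; rewrite mulr0; exact: (int0 (res_local S)).
move=> /(tameP (filtered_OO S ll)) [n [m [f1 f2]]].
apply/(tameP (filtered_resG S)); exists n, m; split=> [x y /NE Uy|x nUx].
  by rewrite lconstD mulrDr f1.
by apply: f2 => /NE.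
Qed.

Lemma distr_shift (l : int) phi : distr (resG S) phi ->
  distr (OO S l (l + 1)) (shift_dist l phi).
Proof.
have ll : l <= l + 1 by lia.
move=> Dphi; split=> [a f g tf tg|f nf]; rewrite /shift_dist /on_dom.
  rewrite !asboolT //; last exact: (test_lin (filtered_OO S ll)).
  exact: (Dphi.1 a _ _ (test_res tf) (test_res tg)).
by rewrite asboolF.
Qed.

Lemma shift_distZ (l : int) (x : C) phi : shift_dist l (x *: phi) = x *:
  shift_dist l phi.
Proof.
apply/funext => f; rewrite !fctE /shift_dist /on_dom.
by case: asboolP => // _; rewrite scaler0.
Qed.

Lemma shift_distD (l : int) phi phi' :
  shift_dist l (phi + phi') = shift_dist l phi + shift_dist l phi'.
Proof.
apply/funext => f; rewrite !fctE /shift_dist /on_dom.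
by case: asboolP => // _; rewrite addr0.
Qed.

(** On the single graded piece O(l)/O(l + 1) a monomial map is multiplication by one power of u
    followed by a shift of degree, which brings the action back to the homogeneity of phi. *)
Lemma shift_dist_push b J sg sg' (l : int) phi : monomial (S := S) b J sg sg' ->
  dpush sg (shift_dist l phi) =
  shift_dist (l + b) (dpush ( *%R (u ^ (J (l + 1) - J l))) phi).
Proof.
move=> M; have ll : l <= l + 1 by lia.
apply/funext => f; rewrite /shift_dist /on_dom /dpush.
have eqt := asbool_equiv_eq (test_monoP M f ll).
rewrite eqt (addrAC l 1 b); case: asboolP => // tf.
congr phi; apply/funext => x /=; congr f.
apply: (lcoef_inj (l := X)) => n.
rewrite (monoE M) /tK !lcoef_lvarXM !lcoef_lconst !subr_eq0 subr_eq.
by case: eqP => [->|]; rewrite ?mulr0 // addrK.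
Qed.

Lemma dpush_unifX (alpha : C) phi (e : int) : alpha != 0 ->
  dpush ( *%R u) phi = alpha *: phi -> dpush ( *%R (u ^ e)) phi = alpha ^ e *:
    phi.
Proof.
move=> alpha0 uphi; have u0 := unif_neq0 (res_local S).
have comp x y (psi : rdist R S) :
    dpush ( *%R x) (dpush ( *%R y) psi) = dpush ( *%R (x * y)) psi.
  apply/funext => f; rewrite /dpush; congr psi; apply/funext => z /=.
  by rewrite mulrA.
have dpushZ x z (psi : rdist R S) : dpush ( *%R x) (z *: psi) = z *: dpush (
  *%R x) psi.
  by [].
have dpush1 (psi : rdist R S) : dpush ( *%R 1) psi = psi.
  apply/funext => f; rewrite /dpush; congr psi; apply/funext => z /=.
  by rewrite mul1r.
have nat_case (i : nat) : dpush ( *%R (u ^+ i)) phi = alpha ^+ i *: phi.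
  elim: i => [|i IH]; first by rewrite !expr0 dpush1 scale1r.
  by rewrite exprSr -comp uphi dpushZ IH scalerA exprS.
case: e => i; first exact: nat_case.
rewrite NegzE -!exprnN -{1}[phi](scale1r) -(mulVf (expf_neq0 i.+1 alpha0))
  -scalerA.
by rewrite -nat_case dpushZ comp mulVf ?expf_neq0 // dpush1.
Qed.

Lemma evalB_phil phi (l : int) : distr (resG S) phi ->
  evalB (phil phi l) = phi (\1_Ok).
Proof.
move=> Dphi; have ll : l < l + 1 by lia.
have lW := ltW ll.
rewrite /phil evalB_dtens //; [|exact: distr_shift|]; last first.
  by apply/muE; exists 1; rewrite scale1r.
rewrite -[muB R S 0 (l + 1)]scale1r coordZ mulr1 /shift_dist /on_dom asboolT;
  last first.
  exact: test_charB.
congr phi; apply/funext => x; rewrite charBE // !indicE; congr (_%:R);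
  congr nat_of_bool.
have cE n : lc (tK S ^ l * lconst X x) n = if n == l then x else 0.
  by rewrite /tK lcoef_lvarXM lcoef_lconst subr_eq0.
apply/idP/idP; rewrite !inE.
  move=> /(nbh_OO _ _ lW) [_ /(_ l ll)].
  by rewrite cE eqxx oppr0 expr0z mul1r.
move=> Ox; apply/(nbh_OO _ _ lW); split=> i il; rewrite cE.
  by rewrite ifF //; lia.
by rewrite oppr0 expr0z mul1r; case: eqP => // _; exact: (int0 (res_local S)).
Qed.

Hypothesis q_gt1 : (1 < q)%N.

Lemma actR_rhoE (d r : int) (x : C) :
  rpush (Raut d) (Raut (- d)) (x *: muB R S 0 r) =
  (x * 1 * Q ^ (- (d * triangular r))) *: muB R S 0 (r + 0).
Proof.
rewrite (rpush_muB (monomial_Raut d)) // addr0; congr ((_ * Q ^ _) *: _).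
  by rewrite mulr1.
by rewrite mulr0 add0r.
Qed.

Lemma actR_rho_out (d r : int) (nu : relm R S) : ~ mu 0 r nu ->
  ~ mu 0 (r + 0) (rpush (Raut d) (Raut (- d)) nu) \/
  rpush (Raut d) (Raut (- d)) nu = 0.
Proof.
move=> nM; left => H; apply: nM.
by apply/(rpush_mu 0 r nu q_gt1 (monomial_Raut d)).
Qed.

Lemma actG_rhoE (a b r : int) (y x : C) :
  tensor 0 b (r + b) (y *: muB R S 0 b)
    (rpush ( *%R (uK S ^ a * tK S ^ b)) ( *%R (uK S ^ a * tK S ^ b)^-1)
       (x *: muB R S 0 r)) =
  (x * y * Q ^ (- (a * r))) *: muB R S 0 (r + b).
Proof.
rewrite (rpush_muB (monomial_uK_tK a b)) // add0r tensorE mulr0 sub0r.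
by rewrite mulrA [y * x]mulrC.
Qed.

Lemma actG_rho_out (a b r : int) (y : C) (nu : relm R S) : ~ mu 0 r nu ->
  let rho := tensor 0 b (r + b) (y *: muB R S 0 b)
    (rpush ( *%R (uK S ^ a * tK S ^ b)) ( *%R (uK S ^ a * tK S ^ b)^-1) nu) in
  ~ mu 0 (r + b) rho \/ rho = 0.
Proof.
move=> nM; right; apply: tensor_out => H; apply: nM.
have := (rpush_mu 0 r nu q_gt1 (monomial_uK_tK a b)).2; rewrite add0r.
exact.
Qed.

Lemma actR_lin (d : int) (y : C) (V W : dK) :
  actR d (y *: V + W) = y *: actR d V + actR d W.
Proof.
rewrite actR_gen.
exact: (dlift_lin q_gt1 (monomial_Raut d) (actR_rhoE d) (@actR_rho_out d)).
Qed.

Lemma actG_lin (x : heis) (y : C) (V W : dK) :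
  actG x (y *: V + W) = y *: actG x V + actG x W.
Proof.
case: x => [[a b] c]; rewrite actG_gen.
apply: (dlift_lin q_gt1 (monomial_uK_tK a b) (c := Q ^ (- c))) => [r z|r nu].
  exact: actG_rhoE.
exact: actG_rho_out.
Qed.

Lemma actGt_lin (x : heisR) (y : C) (V W : dK) :
  actGt x (y *: V + W) = y *: actGt x V + actGt x W.
Proof. by case: x => [[[a b] c] d]; rewrite /actGt actR_lin actG_lin. Qed.

(** Since phi_l involves mu(O | O(l + 1)), the exponents of q are taken at l + 1: a * (l + 1) splits
    into the a of the constant factor and the a * l of the summand, and d * [triangular (l + 1)]
    gives the quadratic term. *)
Definition eigenval (alpha : C) (a c d l : int) : C :=
  Q ^ (- c - a) * alpha ^ a *
    (Q ^ (- (a * l) - (d * l * (l + 1) %/ 2)%Z) * alpha ^ (d * l)).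

Lemma actR_phil (alpha : C) phi (d l : int) : alpha != 0 -> Phi alpha phi ->
  actR d (phil phi l) =
  (alpha ^ (d * l) * Q ^ (- (d * l * (l + 1) %/ 2)%Z)) *: phil phi l.
Proof.
move=> alpha0 [[Dphi _] uphi]; have ll : l < l + 1 by lia.
rewrite actR_gen /phil.
rewrite (dlift_dtens q_gt1 (monomial_Raut d) (actR_rhoE d) (@actR_rho_out d)).
rewrite (shift_dist_push _ _ (monomial_Raut d)) !addr0 -mulrBr triangularS.
rewrite (dpush_unifX _ alpha0 uphi) shift_distZ -[muB R S 0 (l + 1)]scale1r.
rewrite actR_rhoE addr0 !mul1r scale1r -triangular_mul.
have M0 : mu 0 (l + 1) (muB R S 0 (l + 1)).
  by apply/muE; exists 1; rewrite scale1r.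
have DS := distr_shift l Dphi.
rewrite dtensZr //; last by rewrite -[_ *: _]addr0; apply: ldual_lin => //;
  exact: ldual_zero.
by rewrite dtensZl // scalerA mulrC.
Qed.

Lemma actG_phil (alpha : C) phi (a b c l : int) : alpha != 0 -> Phi alpha phi ->
  actG (a, b, c) (phil phi l) =
  (Q ^ (- c - a) * alpha ^ a * Q ^ (- (a * l))) *: phil phi (l + b).
Proof.
move=> alpha0 [[Dphi _] uphi]; have ll : l < l + 1 by lia.
rewrite actG_gen /phil (dlift_dtens q_gt1 (monomial_uK_tK a b) (c :=
  Q ^ (- c))).
- rewrite (shift_dist_push _ _ (monomial_uK_tK a b)).
  rewrite (_ : a * (l + 1) - a * l = a); last by lia.
  rewrite (dpush_unifX _ alpha0 uphi) shift_distZ -[muB R S 0 (l + 1)]scale1r.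
  rewrite actG_rhoE mul1r (addrAC l 1 b).
  have M0 : mu 0 (l + b + 1) (muB R S 0 (l + b + 1)).
    by apply/muE; exists 1; rewrite scale1r.
  have DS := distr_shift (l + b) Dphi; have llb : l + b < l + b + 1 by lia.
  rewrite dtensZr //; last by rewrite -[_ *: _]addr0; apply: ldual_lin => //;
    exact: ldual_zero.
  rewrite dtensZl // scalerA; congr (_ *: _).
  rewrite [RHS]mulrAC; congr (_ * _).
  by rewrite -!expfzDr ?(Q_neq0 R q_gt1) //; congr (_ ^ _); lia.
- by move=> r x; exact: actG_rhoE.
- by move=> r nu; exact: actG_rho_out.
Qed.

Lemma actGt_phil (alpha : C) phi (a b c d l : int) : alpha != 0 ->
  Phi alpha phi ->
  actGt (a, b, c, d) (phil phi l) =
  eigenval alpha a c d l *: phil phi (l + b).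
Proof.
move=> alpha0 Pphi; rewrite /actGt (actR_phil _ _ alpha0 Pphi).
set z := _ * _ : C.
have -> : actG (a, b, c) (z *: phil phi l) = z *: actG (a, b, c) (phil phi l).
  have G0 : actG (a, b, c) (0 : dK) = 0.
    have := actG_lin (a, b, c) 1 (0 : dK) 0; rewrite scaler0 addr0 scale1r =>
      /eqP.
    by rewrite -subr_eq subrr eq_sym => /eqP.
  by rewrite -[z *: phil phi l]addr0 actG_lin G0 addr0.
rewrite (actG_phil _ _ _ _ alpha0 Pphi) scalerA; congr (_ *: _).
rewrite /eigenval /z [Q ^ (- (a * l) - _)]expfzDr ?(Q_neq0 R q_gt1) //.
have comm (x1 x2 x3 x4 x5 : C) :
  x1 * x2 * (x3 * x4 * x5) = x3 * x4 * (x5 * x2 * x1) by ring.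
exact: comm.
Qed.

End Action.

(** * Homogeneous distributions on the residue field *)

Section Homogeneous.
Context (R : realType) (p q : nat) (S : field2d p q).
Local Notation C := R[i].
Local Notation k := (res_field S).
Local Notation u := (res_unif S).
Local Notation Ok := (@res_int p q S).
Local Notation U := (nbh (resG S)).
Implicit Types (phi : rdist R S).

Lemma unifV_nint : ~ Ok u^-1.
Proof.
move=> OuV; have [F [res [_ [_ res_surj res0]]]] := int_residue (res_local S).
have resz x : Ok x -> res x = 0.
  by move=> Ox; apply/res0 => //; exact: (intM (res_local S)).
by have [x /resz -> /eqP] := res_surj 1; rewrite eq_sym oner_eq0.
Qed.

Lemma distr_lin (a : C) phi phi' : distr (resG S) phi -> distr (resG S) phi' ->
  distr (resG S) (a *: phi + phi').
Proof. exact: ldual_lin. Qed.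

Lemma unit_inv_lin (a : C) phi phi' : unit_inv_dist phi -> unit_inv_dist phi' ->
  unit_inv_dist (a *: phi + phi').
Proof.
move=> [D1 I1] [D2 I2]; split=> [|h h0 Oh OhV]; first exact: distr_lin.
by rewrite -[in RHS](I1 h) // -[in RHS](I2 h).
Qed.

Lemma subspace_Phi (alpha : C) : Defs.subspace (Phi alpha : set (rdist R S)).
Proof.
split=> [|a x y [Ix ux] [Iy uy]].
  split; last by rewrite scaler0.
  by split=> [|h _ _ _]; [exact: ldual_zero|].
split; first exact: unit_inv_lin.
rewrite scalerDr scalerA mulrC -scalerA -ux -uy.
by [].
Qed.

Lemma res_nbh0 : U 0 = Ok.
Proof. by apply/seteqP; split=> x; rewrite nbh_resG oppr0 expr0z mul1r. Qed.

Lemma test_int : test (resG S) (\1_Ok : k -> C^o).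
Proof.
rewrite -res_nbh0; apply/(tameP (filtered_resG S)); exists 0, 0.
by apply: tame_nbh => //; exact: filtered_resG.
Qed.

Lemma Phi_nbh (alpha : C) phi (n : int) : alpha != 0 -> Phi alpha phi ->
  phi (\1_Ok) = alpha ^ n * phi (\1_(U n)).
Proof.
move=> alpha0 [_ uphi].
have /(congr1 (fun T => T (\1_(U n)))) := dpush_unifX n alpha0 uphi.
move=> e; rewrite -[RHS]/((alpha ^ n *: phi) (\1_(U n))) -e /dpush.
congr phi; apply/funext => x.
rewrite -[RHS]/(\1_(U n) (u ^ n * x)) !indicE; congr (_%:R); congr nat_of_bool.
by apply/idP/idP; rewrite !inE nbh_resG (unifXK (res_local S)).
Qed.

(* Units permute transitively the cosets of [U n] contained in the shell [U m
   `\` U (m + 1)], so [phi] takes the same value on all of them, and the sum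
   of these values is 0. *)
Lemma Phi_coset (alpha : C) phi (n : int) (a : k) : alpha != 0 ->
  Phi alpha phi -> phi (\1_Ok) = 0 -> phi (\1_[set x | U n (x - a)]) = 0.
Proof.
move=> alpha0 Pphi phi0; have FA := filtered_resG S.
(* Homogeneity carries the vanishing on the integers to all balls centred at 0. *)
have PU m : phi (\1_(U m)) = 0.
  apply/eqP; have := Phi_nbh m alpha0 Pphi; rewrite phi0 => /esym/eqP.
  by rewrite mulf_eq0 (negPf (expfz_neq0 _ alpha0)).
have [Ua|nUa] := pselect (U n a).
  rewrite -[RHS](PU n); congr phi; congr indic; apply/seteqP; split=> x.
    exact: (nbhDr FA x (nbhN FA Ua)).1.
  exact: (nbhDr FA x (nbhN FA Ua)).2.
have a0 : a != 0.
  by apply/eqP => e; apply: nUa; rewrite e; exact: nbh0.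
have [m [h [aE h0 Oh OhV]]] := int_unit (res_local S) a0.
have UaP j : U j a <-> j <= m.
  rewrite nbh_resG aE; split=> [H|jm]; last first.
    by apply: (int_le (res_local S) jm); rewrite (unifXK (res_local S)).
  rewrite leNgt; apply/negP => mj.
  have : Ok (u ^ (- (m + 1)) * (u ^ m * h)) by apply: (int_le (res_local S)) H;
    lia.
  rewrite (unifXM (res_local S)) (_ : - (m + 1) + m = -1); last by lia.
  move=> /(intM (res_local S) OhV); rewrite mulrCA mulVf // mulr1 exprN1.
  exact: unifV_nint.
have mn : m < n by rewrite ltNge; apply/negP => nm; apply: nUa; apply/UaP.
(* The indicator of the shell through a, written as a difference of balls so that phi vanishes on
   it. *)
pose F : k -> C^o := \1_(U m) - \1_(U (m + 1)).
have tm : tame (resG S) n m (\1_(U m) : k -> C^o).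
  by apply: (tame_nbh R FA); exact: ltW.
have tm1 : tame (resG S) n m (\1_(U (m + 1)) : k -> C^o).
  apply: (tame_le FA (lexx n)); last by apply: (tame_nbh R FA); lia.
  by lia.
have tF : tame (resG S) n m F.
  split=> [x y Uy|x nUx]; rewrite /F !fctE ?tm.1 ?tm1.1 //.
  by rewrite tm.2 // tm1.2 // subr0.
have FE y : F y = (`[< U m y /\ ~ U (m + 1) y >])%:R.
  rewrite /F !fctE !indicE; case: (pselect (U m y)) => Um.
    rewrite [y \in U m]mem_set //; case: (pselect (U (m + 1) y)) => Um1.
      by rewrite mem_set // subrr asboolF // => -[].
    by rewrite memNset // subr0 asboolT.
  have Um1 : ~ U (m + 1) y by move=> /(nbhS FA).
  by rewrite !memNset // subr0 asboolF // => -[].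
have Dphi := Pphi.1.1.
have phiF : phi F = 0.
  have tt f : tame (resG S) n m f -> test (resG S) (f : k -> C^o).
    by move=> tf; apply/(tameP FA); exists n, m.
  have -> : F = (-1 : C) *: (\1_(U (m + 1)) : k -> C^o) + \1_(U m).
    by rewrite scaleN1r addrC.
  by rewrite Dphi.1 ?PU ?mulr0 ?addr0 //; exact: tt.
move: phiF; rewrite (distr_decomp FA Dphi tF (ltW mn)); set s := fset_set _.
have shell y : F y != 0 -> exists z, [/\ z != 0, Ok z, Ok z^-1 & y = z * a].
  rewrite FE; case: asboolP => [[Um Um1] _|]; last by rewrite eqxx.
  have y0 : y != 0 by apply/eqP => e; apply: Um1; rewrite e; exact: nbh0.
  have [j [h' [yE h'0 Oh' Oh'V]]] := int_unit (res_local S) y0.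
  have jm : j = m.
    have mj : m <= j.
      rewrite leNgt; apply/negP => jm; move: Um;
        rewrite nbh_resG yE (unifXM (res_local S)).
      rewrite (_ : - m + j = - (m - j)); last by lia.
      move=> H; have : Ok (u ^ (- 1) * h') by apply: (int_le (res_local S)) H;
        lia.
      move=> /(intM (res_local S) Oh'V); rewrite mulrCA mulVf // mulr1 exprN1.
      exact: unifV_nint.
    apply/eqP; rewrite eq_le mj andbT leNgt; apply/negP => mj1; apply: Um1.
    rewrite nbh_resG yE; apply: (int_le (res_local S) (n := j)); first by lia.
    by rewrite (unifXK (res_local S)).
  exists (h' * h^-1); split.
  - by rewrite mulf_neq0 ?invr_eq0.
  - exact: (intM (res_local S)).
  - by rewrite invfM invrK; exact: (intM (res_local S)).
  - by rewrite yE aE jm mulrCA mulfVK.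
have -> : \sum_(y <- s) F y * phi (\1_[set x | U n (x - y)]) =
    (\sum_(y <- s) F y) * phi (\1_[set x | U n (x - a)]).
  rewrite mulr_suml; apply: eq_bigr => y _.
  have [->|/shell [z [z0 Oz OzV ->]]] := eqVneq (F y) 0;
    first by rewrite !mul0r.
  congr (_ * _); have OzVV : Ok z^-1^-1 by rewrite invrK.
  rewrite -[in RHS](Pphi.1.2 z^-1) ?invr_eq0 //.
  rewrite /dpush; congr phi; apply/funext => x.
  rewrite -[RHS]/(\1_[set x | U n (x - a)] (z^-1 * x)) !indicE.
  congr (_%:R); congr nat_of_bool.
  apply/idP/idP; rewrite !inE /mkset !nbh_resG => H.
    have -> : u ^ (- n) * (z^-1 * x - a) = z^-1 * (u ^ (- n) * (x - z * a)).
      by rewrite mulrCA [in RHS]mulrBr mulKf.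
    exact: (intM (res_local S)).
  have -> : u ^ (- n) * (x - z * a) = z * (u ^ (- n) * (z^-1 * x - a)).
    by rewrite mulrCA [in RHS]mulrBr mulVKf.
  exact: (intM (res_local S)).
(* It remains to see that the number of cosets in the shell is nonzero in C: it counts at least the
   coset of a. *)
move=> /eqP; rewrite mulf_eq0 => /orP[|/eqP //].
have Um : U m a by apply/UaP.
have cs : crep (resG S) n a \in s.
  rewrite in_fset_set; last exact: (finite_reps FA).
  by apply/mem_set; apply: (reps_crep FA (ltW mn)).
have F1 : F (crep (resG S) n a) = 1.
  have /(tF.1 a) : U n (crep (resG S) n a - a).
    by apply: (nbh_subC FA); exact: crepP.
  rewrite subrKC => ->; rewrite FE asboolT //; split=> // /UaP; lia.
rewrite (big_fsetD1 _ cs) /= F1 (eq_bigr _ (fun y _ => FE y)) -natr_sum.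
by rewrite -[1]/(1%:R) -natrD pnatr_eq0.
Qed.

Lemma Phi_eq0 (alpha : C) phi : alpha != 0 ->
  Phi alpha phi -> phi (\1_Ok) = 0 -> phi = 0.
Proof.
move=> alpha0 Pphi phi0; have FA := filtered_resG S; apply/funext => f.
have [/(test_tame FA) [n [m tf]]|nf] := pselect (test (resG S) f); last first.
  exact: Pphi.1.1.2.
have {}tf : tame (resG S) n (Order.min m n%:Z) f.
  by apply: (tame_le FA (lexx _)) tf; rewrite ge_min lexx.
have mn : Order.min m n%:Z <= n%:Z by rewrite ge_min lexx orbT.
rewrite (distr_decomp FA Pphi.1.1 tf mn) big1 // => y _.
by rewrite (Phi_coset _ _ alpha0) ?mulr0.
Qed.

Lemma Phi_uniq (alpha : C) g phi : alpha != 0 -> is_g alpha g ->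
  Phi alpha phi -> phi = phi (\1_Ok) *: g.
Proof.
move=> alpha0 [Pg g1] Pphi; have sP := subspace_Phi alpha.
apply/eqP; rewrite -subr_eq0 -scaleNr addrC; apply/eqP.
apply: (Phi_eq0 alpha0); first exact: sP.2.
by rewrite !fctE g1 [_ *: 1]mulr1 addNr.
Qed.

Lemma test_mulr (h : k) (f : k -> C^o) : h != 0 ->
  test (resG S) f -> test (resG S) (f \o *%R h).
Proof.
move=> h0; have FA := filtered_resG S.
have [e He] := int_absorb (res_local S) h; have [e' He'] :=
  int_absorb (res_local S) h^-1.
have mulE x n y : Ok (u ^ (- n) * y) -> forall e1, Ok (u ^ (- e1) * x) ->
  Ok (u ^ (- (n + e1)) * (x * y)).
  move=> H e1 Hx; have := intM (res_local S) Hx H.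
  by rewrite mulrACA -expfzDr ?(unif_neq0 (res_local S)) //;
    congr (Ok (u ^ _ * _)); lia.
move=> /(tameP FA) [n [m [f1 f2]]]; apply/(tameP FA).
exists (n - e), (m + e'); split=> [x y /nbh_resG Uy|x nUx] /=.
  rewrite mulrDr f1 //; apply/nbh_resG.
  by have := mulE h _ _ Uy _ He; rewrite subrK.
apply: f2 => /nbh_resG Uhx; apply: nUx; apply/nbh_resG.
by have := mulE h^-1 _ _ Uhx _ He'; rewrite mulKf.
Qed.

(** An explicit g_alpha, for alpha = 1. One value of alpha is enough to show that the trace with b =
    0 is not identically 0. *)
Definition dirac0 : rdist R S := on_dom (test (resG S)) (fun f => f 0).

(** Multiplication fixes 0. As the functional is 0 off the test functions, these must also be shown
    to be preserved in both directions. *)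
Lemma dirac0_mul (h : k) : h != 0 -> dpush ( *%R h) dirac0 = dirac0.
Proof.
move=> h0; apply/funext => f; rewrite /dpush /dirac0 /on_dom.
have eqt : test (resG S) (f \o *%R h) <-> test (resG S) f.
  split=> [tf|]; last exact: test_mulr.
  have -> : f = (f \o *%R h) \o *%R h^-1.
    by apply/funext => x /=; rewrite mulVKf.
  by apply: test_mulr => //; rewrite invr_eq0.
by rewrite (asbool_equiv_eq eqt) /= mulr0.
Qed.

Lemma is_g_dirac0 : is_g 1 dirac0.
Proof.
split; last first.
  by rewrite /dirac0 /on_dom asboolT ?indicE ?mem_set //;
    [exact: (int0 (res_local S))|exact: test_int].
split; last by rewrite scale1r dirac0_mul // (unif_neq0 (res_local S)).
split=> [|h h0 _ _]; last exact: dirac0_mul.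
split=> [a f g tf tg|f nf]; rewrite /dirac0 /on_dom; last by rewrite asboolF.
by rewrite !asboolT //; exact: (test_lin (filtered_resG S)).
Qed.

End Homogeneous.

(** * The subspace beta(Psi_alpha) and its distinguished basis *)

Section InducedRepresentation.
Context (R : realType) (p q : nat) (S : field2d p q).
Local Notation C := R[i].
Local Notation Ok := (@res_int p q S).
Local Notation Q := (q%:R : C).
Local Notation dK := (distK R S).
Implicit Types (phi : rdist R S) (f : heis -> rdist R S).

Lemma phil_lin (alpha a : C) phi phi' (l : int) : Phi alpha phi ->
  Phi alpha phi' ->
  phil (a *: phi + phi') l = a *: phil phi l + phil phi' l.
Proof.
move=> [[D1 _] _] [[D2 _] _]; rewrite /phil shift_distD shift_distZ.
apply: dtens_linl; [by lia|exact: distr_shift|exact: distr_shift|].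
by apply/muE; exists 1; rewrite scale1r.
Qed.

Lemma phil0 (l : int) : phil (0 : rdist R S) l = 0.
Proof.
rewrite /phil; have -> : shift_dist l (0 : rdist R S) = 0.
  by have := shift_distZ l 0 (0 : rdist R S); rewrite !scale0r.
exact: dtens0l.
Qed.

Lemma philZ (alpha a : C) phi (l : int) : Phi alpha phi ->
  phil (a *: phi) l = a *: phil phi l.
Proof.
move=> Pphi; have := phil_lin a l Pphi (subspace_Phi S alpha).1.
by rewrite !addr0 phil0 addr0.
Qed.

Hypothesis q_gt1 : (1 < q)%N.

Section Alpha.
Context (alpha : C).
Hypothesis alpha0 : alpha != 0.

Lemma sigmaD (a a' c c' : int) :
  sigma q alpha (a + a') (c + c') = sigma q alpha a c * sigma q alpha a' c'.
Proof.
rewrite /sigma; have -> : - (c + c') - (a + a') = (- c - a) + (- c' - a') by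
  lia.
rewrite (expfzDr _ _ alpha0) (expfzDr _ _ (Q_neq0 R q_gt1)).
exact: mulrACA.
Qed.

Lemma sigma0 : sigma q alpha 0 0 = 1.
Proof. by rewrite /sigma oppr0 subr0 !expr0z mulr1. Qed.

Definition beta_support (f : heis -> rdist R S) (A : {fset int}) : Prop :=
  forall m, m \notin A -> f (0, m, 0) = 0.

(** Right multiplication by (a, 0, c) keeps the middle coordinate, so finitely many cosets leave
    finitely many m. The sum over Z in [beta] relies on this finiteness. *)
Lemma Psi_ind_support f : Psi_ind alpha f -> exists A, beta_support f A.
Proof.
move=> [_ _ [s Hs]]; exists [fset y.1.2 | y in s]%fset => m mA.
apply/eqP; apply: contraNT mA => /Hs [y ys [a [c]]].
case: y ys => [[a' b'] c'] ys /= [_ mb _].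
by apply/imfsetP; exists (a', b', c'); rewrite //= mb addr0.
Qed.

Lemma betaE f (A : {fset int}) : beta_support f A ->
  beta f = \sum_(m <- A) phil (f (0, m, 0)) m.
Proof. by move=> Af; apply: fsbigTE => m /Af ->; exact: phil0. Qed.

Lemma Psi_ind_lin (a : C) f f' : Psi_ind alpha f -> Psi_ind alpha f' ->
  Psi_ind alpha (a *: f + f').
Proof.
move=> [fP fH [s fs]] [fP' fH' [s' fs']]; split=> [x|x b c|].
- exact: (subspace_Phi S alpha).2.
- rewrite -[LHS]/(a *: f (heis_mul x (b, 0, c)) + f' (heis_mul x (b, 0, c))).
  rewrite fH fH' -[(a *: f + f') x]/(a *: f x + f' x) scalerDr !scalerA.
  by rewrite [a * _]mulrC.
exists (s ++ s') => x; rewrite -[(a *: f + f') x]/(a *: f x + f' x) => fx.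
have [f0|f0] := eqVneq (f x) 0.
  have [|y ys e] := fs' x; last by exists y => //; rewrite mem_cat ys orbT.
  by move: fx; rewrite f0 scaler0 add0r.
by have [y ys e] := fs x f0; exists y => //; rewrite mem_cat ys.
Qed.

Lemma beta_lin (a : C) f f' : Psi_ind alpha f -> Psi_ind alpha f' ->
  beta (a *: f + f') = a *: beta f + beta f'.
Proof.
move=> Pf Pf'; have [A Af] := Psi_ind_support Pf; have [A' Af'] :=
  Psi_ind_support Pf'.
have Bf : beta_support f (A `|` A')%fset.
  by move=> m; rewrite inE negb_or => /andP[/Af ? _].
have Bf' : beta_support f' (A `|` A')%fset.
  by move=> m; rewrite inE negb_or => /andP[_ /Af'].
have Bff : beta_support (a *: f + f') (A `|` A')%fset.
  move=> m mA; rewrite -[LHS]/(a *: f (0, m, 0) + f' (0, m, 0)).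
  by rewrite (Bf m mA) (Bf' m mA) scaler0 addr0.
rewrite (betaE Bf) (betaE Bf') (betaE Bff) scaler_sumr -big_split.
apply: eq_bigr => m _; case: Pf Pf' => [fP _ _] [fP' _ _].
exact: (phil_lin a m (fP (0, m, 0)) (fP' (0, m, 0))).
Qed.

Lemma Psi_ind_Delta m phi : Phi alpha phi -> Psi_ind alpha (Delta alpha m phi).
Proof.
move=> Pphi; split=> [[[a b] c]|[[a b] c] a' c'|].
- rewrite /Delta; case: eqP => _; last exact: (subspace_Phi S alpha).1.
  by apply: subspaceZ => //; exact: subspace_Phi.
- rewrite /Delta /= addr0 mulr0 addr0; case: eqP => _; last by rewrite scaler0.
  by rewrite scalerA -sigmaD !opprD [- a + _]addrC [- c + _]addrC.
exists [:: (0, m, 0)] => -[[a b] c]; rewrite /Delta.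
case: (b =P m) => [->|_]; last by rewrite eqxx.
move=> _; exists (0, m, 0); first by rewrite inE.
by exists a, c; rewrite /= addr0 mulr0 addr0 !add0r.
Qed.

Lemma beta_Delta m phi : beta (Delta alpha m phi) = phil phi m.
Proof.
rewrite (betaE (A := [fset m]%fset)) => [|j].
  by rewrite big_seq_fset1 /= eqxx oppr0 sigma0 scale1r.
by rewrite inE /= => /negPf ->.
Qed.

Lemma phil_beta_Psi m phi : Phi alpha phi -> beta_Psi S alpha (phil phi m).
Proof.
by move=> Pphi; exists (Delta alpha m phi);
  [exact: Psi_ind_Delta|exact: beta_Delta].
Qed.

Lemma subspace_beta_Psi : Defs.subspace (beta_Psi S alpha : set dK).
Proof.
split=> [|a _ _ [f Pf <-] [f' Pf' <-]]; last first.
  by exists (a *: f + f'); [exact: Psi_ind_lin|exact: beta_lin].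
have P0 := (subspace_Phi S alpha).1.
by rewrite -(phil0 0); exact: phil_beta_Psi.
Qed.

(** Together with [phil_beta_Psi] and [subspace_beta_Psi], this identifies beta(Psi_alpha) with the
    span of the phi_m; inclusion in Psi, invariance and generation by the basis are then checked on
    the phi_m alone. *)
Lemma beta_Psi_min (W : set dK) : Defs.subspace W ->
  (forall phi m, Phi alpha phi -> W (phil phi m)) -> beta_Psi S alpha `<=` W.
Proof.
move=> sW HW _ [f Pf <-]; have [A Af] := Psi_ind_support Pf.
rewrite (betaE Af); under eq_bigr do rewrite -[phil _ _]scale1r.
by apply: (subspace_sum sW) => m _; apply: HW; case: Pf.
Qed.

Lemma beta_Psi_sub : beta_Psi S alpha `<=` Psi R S.
Proof.
apply: beta_Psi_min => [|phi m [uphi _]].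
  split=> [W [] //|a x y hx hy W sW SW].
  by apply: sW.2; [exact: hx|exact: hy].
by move=> W _; apply; exists phi => //; exists m.
Qed.

Lemma beta_Psi_invariant (x : heisR) (V : dK) :
  beta_Psi S alpha V -> beta_Psi S alpha (actGt x V).
Proof.
have [s0 sD] := subspace_beta_Psi.
apply: (beta_Psi_min (W := [set V | beta_Psi S alpha (actGt x V)])) =>
  [|phi m Pphi].
  split=> [|a y z /= hy hz]; last by rewrite actGt_lin //; exact: sD.
  rewrite /=; have := actGt_lin q_gt1 x 1 (0 : dK) 0.
  rewrite scaler0 addr0 scale1r => /eqP; rewrite -subr_eq subrr => /eqP <- //.
case: x => [[[a b] c] d]; rewrite /mkset (actGt_phil q_gt1 _ _ _ _ _ alpha0
  Pphi).
by apply: (subspaceZ subspace_beta_Psi); exact: phil_beta_Psi.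
Qed.

Section Basis.
Context (g : rdist R S).
Hypothesis gP : is_g alpha g.
Local Notation e := (dist_basis alpha g).

Lemma dist_basisE l : e l = phil g l.
Proof. exact: beta_Delta. Qed.

Lemma actGt_basis (a b c d l : int) :
  actGt (a, b, c, d) (e l) = eigenval q alpha a c d l *: e (l + b).
Proof. by rewrite !dist_basisE (actGt_phil q_gt1 _ _ _ _ _ alpha0 gP.1). Qed.

Lemma eigenval_neq0 (a c d l : int) : eigenval q alpha a c d l != 0.
Proof.
by rewrite /eigenval !mulf_neq0 // expfz_neq0 // (Q_neq0 R q_gt1).
Qed.

Lemma eigenval1_inj : injective (eigenval q alpha 1 0 0).
Proof.
move=> l l'; rewrite /eigenval !mul0r div0z !subr0 !expr0z !mulr1 !mul1r.
move/mulfI => H; have /H : Q ^ (- 0 - 1) * alpha ^ 1 != 0.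
  by rewrite mulf_neq0 // expfz_neq0 // (Q_neq0 R q_gt1).
have Q0 := Q_neq0 R q_gt1.
(* Ordering i and j makes the exponent of the quotient a natural number, and the question becomes
   q^n = 1 in nat, with q > 1. *)
have mono i j : Q ^ (- i) = Q ^ (- j) -> i <= j -> i = j.
  move=> eQ ij; have : Q ^ (j - i) = 1.
    by rewrite expfzDr // eQ -expfzDr // subrr expr0z.
  have -> : j - i = `|j - i|%N%:Z by lia.
  rewrite -exprnP -natrX => /eqP; rewrite pnatr_eq1 => /eqP e1.
  have : (`|j - i|%N = 0)%N.
    by case: `|j - i|%N e1 => // n; rewrite expnS => /eqP; rewrite muln_eq1;
      lia.
  lia.
by move=> eQ; case/orP: (le_total l l') => [/(mono _ _ eQ)|/(mono _ _ (esym
  eQ))].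
Qed.

Lemma actGt0 (x : heisR) : actGt x (0 : dK) = 0.
Proof.
have := actGt_lin q_gt1 x 1 (0 : dK) 0.
by rewrite scaler0 addr0 scale1r => /eqP; rewrite -subr_eq subrr => /eqP.
Qed.

(* The distinct eigenvalues of [(1, 0, 0, 0)] separate the vectors [e l],
   which are nonzero because [evalB] takes the value 1 on them. *)
Lemma basis_free (s : seq int) (c : int -> C) : uniq s ->
  \sum_(l <- s) c l *: e l = 0 -> forall l, l \in s -> c l = 0.
Proof.
elim: s c => [|l0 s IH] c //= /andP[l0s us] sum0.
pose lam := eigenval q alpha 1 0 0.
have AE (s1 : seq int) (c1 : int -> C) : actGt (1, 0, 0, 0) (\sum_(l <- s1) c1
  l *: e l) =
    \sum_(l <- s1) (c1 l * lam l) *: e l.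
  elim: s1 => [|l s1 IHs]; first by rewrite !big_nil actGt0.
  by rewrite !big_cons actGt_lin // IHs actGt_basis addr0 scalerA.
have cs l : l \in s -> c l = 0.
  move=> ls; have := AE (l0 :: s) c; rewrite sum0 actGt0 => /esym sum1.
  (* The image of the relation under (1, 0, 0, 0), minus [lam l0] times the relation: the term of l0
     disappears and the induction hypothesis applies. *)
  have : \sum_(l <- l0 :: s) (c l * (lam l - lam l0)) *: e l = 0.
    rewrite (eq_bigr (fun l => (c l * lam l) *: e l - lam l0 *: (c l *: e l))).
      by rewrite sumrB sum1 -scaler_sumr sum0 scaler0 subr0.
    by move=> j _; rewrite mulrBr scalerBl scalerA [c j * lam l0]mulrC.
  rewrite big_cons subrr mulr0 scale0r add0r => /(IH _ us) /(_ l ls) /eqP.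
  rewrite mulf_eq0 => /orP[/eqP //|]; rewrite subr_eq0 =>
    /eqP /eigenval1_inj el.
  by move: l0s; rewrite -el ls.
have c0 : c l0 = 0.
  move: sum0; rewrite big_cons big_seq big1 => [|l ls]; last first.
    by rewrite cs // scale0r.
  rewrite addr0 -[_ *: _]addr0 => /(congr1 (@evalB R p q S)).
  have L0 : evalB (0 : dK) = 0.
    have := evalB_lin 1 (0 : dK) 0; rewrite scaler0 addr0 mul1r => /eqP.
    by rewrite -subr_eq subrr eq_sym => /eqP.
  rewrite evalB_lin L0 addr0 dist_basisE (evalB_phil l0 gP.1.1.1).
  by rewrite gP.2 mulr1.
by move=> l; rewrite inE => /orP[/eqP ->|/cs].
Qed.

Lemma basis_fsfree (c : int -> C) : finite_set [set l | c l != 0] ->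
  \sum_(l \in setT) c l *: e l = 0 -> forall l, c l = 0.
Proof.
move=> /finite_fsetP [A AE] sum0 l.
have Ac j : j \notin A -> c j = 0.
  move=> jA; apply/eqP; apply: contraNT jA => cj.
  by have : [set` A] j by rewrite -AE.
have [lA|/Ac //] := boolP (l \in A).
apply: (basis_free (fset_uniq A)) lA; rewrite -[RHS]sum0; apply/esym/fsbigTE =>
  j.
by move=> /Ac ->; rewrite scale0r.
Qed.

Lemma is_basis_dist : is_basis (beta_Psi S alpha) e.
Proof.
split; last exact: basis_fsfree.
apply/seteqP; split=> V.
  move: V; apply: beta_Psi_min => [|phi m Pphi].
    split=> [W [] //|a x y hx hy W sW SW].
    by apply: sW.2; [exact: hx|exact: hy].
  rewrite (Phi_uniq alpha0 gP Pphi) (philZ _ _ gP.1) -dist_basisE.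
  by move=> W sW SW; apply: (subspaceZ sW); apply: SW; exists m.
apply; first exact: subspace_beta_Psi.
by move=> _ [l _ <-]; rewrite dist_basisE; apply: phil_beta_Psi; exact: gP.1.
Qed.

Definition act_matrix (x : heisR) (m l : int) : C :=
  let: (a, b, c, d) := x in if m == l + b then eigenval q alpha a c d l else 0.

Lemma matrix_of_act x : matrix_of alpha g x (act_matrix x).
Proof.
split=> [|l]; first exact: is_basis_dist.
case: x => [[[a b] c] d]; split.
  apply: (sub_finite_set (B := [set l + b])); last exact: finite_set1.
  by move=> m; rewrite /= /act_matrix; case: (m =P l + b) => //; rewrite eqxx.
rewrite actGt_basis (fsbigTE [fset (l + b)%R]%fset) => [|m].
  by rewrite big_seq_fset1 /= eqxx.
by rewrite inE /= => /negPf ->; rewrite scale0r.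
Qed.

(** A column consists of coordinates in a free family. As [is_trace] quantifies over matrices, this
    is what makes the trace well defined. *)
Lemma matrix_of_uniq x M m l : matrix_of alpha g x M ->
  M m l = act_matrix x m l.
Proof.
move=> [_ /(_ l) [fM eM]]; have [_ /(_ l) [fM' eM']] := matrix_of_act x.
apply/eqP; rewrite -subr_eq0; apply/eqP.
move: m; apply: basis_fsfree.
  apply: (sub_finite_set (B := [set m | M m l != 0] `|` [set m |
    act_matrix x m l != 0])).
    move=> m /=; have [->|] := eqVneq (M m l) 0; last by left.
    by rewrite sub0r oppr_eq0; right.
  by rewrite finite_setU.
move: fM fM' => /finite_fsetP [A AE] /finite_fsetP [B BE].
have Ac j : j \notin (A `|` B)%fset -> M j l = 0 /\ act_matrix x j l = 0.
  rewrite inE negb_or => /andP[jA jB]; split; apply/eqP.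
    by apply: contraNT jA => cj; have : [set` A] j by rewrite -AE.
  by apply: contraNT jB => cj; have : [set` B] j by rewrite -BE.
have E (N : int -> C) : (forall j, j \notin (A `|` B)%fset -> N j = 0) ->
    \sum_(m \in setT) N m *: e m = \sum_(m <- (A `|` B)%fset) N m *: e m.
  by move=> N0; apply: fsbigTE => j /N0 ->; rewrite scale0r.
rewrite E => [|j /Ac [-> ->]]; last by rewrite subr0.
rewrite (eq_bigr (fun m => M m l *: e m - act_matrix x m l *: e m)).
  rewrite sumrB; apply/eqP; rewrite subr_eq0; apply/eqP.
  transitivity (\sum_(m \in setT) M m l *: e m).
    by apply/esym/E => j /Ac [].
  transitivity (\sum_(m \in setT) act_matrix x m l *: e m).
    exact: etrans (esym eM) eM'.
  by apply: E => j /Ac [].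
by move=> j _; rewrite scalerBl.
Qed.

Lemma is_traceE x T : is_trace alpha g x T <->
  partial_sum (fun l => act_matrix x l l : C^o) @ totally --> (T : C^o).
Proof.
split=> [[M xM]|]; last by exists (act_matrix x) => //; exact: matrix_of_act.
suff -> : (fun l => act_matrix x l l : C^o) = (fun l => M l l) by [].
by apply/funext => l; rewrite (matrix_of_uniq l l xM).
Qed.

End Basis.
End Alpha.
End InducedRepresentation.

(** * Traces *)

#[local] Existing Instance totally_filter.

Section Trace.
Context (R : realType) (p q : nat) (S : field2d p q).
Hypothesis q_gt1 : (1 < q)%N.
Local Notation C := R[i].
Local Notation Q := (q%:R : C).

Lemma act_matrix_diag (alpha : C) (a b c d l : int) :
  act_matrix q alpha (a, b, c, d) l l =
  if b == 0 then eigenval q alpha a c d l else 0.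
Proof. by rewrite /act_matrix -[X in X == _]addr0 (inj_eq (addrI l)) eq_sym.
  Qed.

Lemma is_trace_offdiag (alpha : C) (g : rdist R S) (a b c d : int) :
  alpha != 0 -> is_g alpha g -> b != 0 -> is_trace alpha g (a, b, c, d) 0.
Proof.
move=> alpha0 gP b0; apply/(is_traceE q_gt1 alpha0 gP).
have -> : partial_sum (fun l => act_matrix q alpha (a, b, c, d) l l : C^o) =
    fun=> (0 : C^o).
  apply/funext => A; rewrite /partial_sum big1 // => l _.
  by rewrite act_matrix_diag (negPf b0).
exact: cvg_cst.
Qed.

Lemma cvg_partial_sumZ (x : C) (f : int -> C^o) (s : C^o) :
  partial_sum f @ totally --> s ->
  partial_sum (fun l => x * f l : C^o) @ totally --> (x * s : C^o).
Proof.
move=> fs; have -> : partial_sum (fun l => x * f l : C^o) = x \*: partial_sum f.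
  by apply/funext => A; rewrite /partial_sum /= -mulr_sumr.
exact: cvgZl_tmp.
Qed.

(** The factor independent of l is nonzero, so it can be divided out: the trace and the series
    converge together. *)
Lemma is_trace_diag (alpha : C) (g : rdist R S) (a c d : int) (T : C) :
  alpha != 0 -> is_g alpha g ->
  is_trace alpha g (a, 0, c, d) T <->
  exists2 s : C,
    partial_sum (fun l : int => Q ^ (- (a * l) - (d * l * (l + 1) %/ 2)%Z)
        * alpha ^ (d * l) : C^o) @ totally --> (s : C^o) &
    T = Q ^ (- c - a) * alpha ^ a * s.
Proof.
move=> alpha0 gP; rewrite (is_traceE q_gt1 alpha0 gP).
set x := Q ^ (- c - a) * alpha ^ a.
have x0 : x != 0 by rewrite /x mulf_neq0 // expfz_neq0 // (Q_neq0 R q_gt1).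
pose f l : C^o := Q ^ (- (a * l) - (d * l * (l + 1) %/ 2)%Z) * alpha ^ (d * l).
have -> : (fun l => act_matrix q alpha (a, 0, c, d) l l : C^o) = (fun l =>
  x * f l).
  by apply/funext => l; rewrite act_matrix_diag.
split=> [H|[s fs ->]]; last exact: cvg_partial_sumZ.
exists (x^-1 * T); last by rewrite mulVKf.
have := cvg_partial_sumZ (x := x^-1) H.
by have -> : (fun l => x^-1 * (x * f l) : C^o) = f by apply/funext => l;
  exact: mulKf.
Qed.

Lemma dirac0_not_trace0 (a c d : int) :
  ~ is_trace 1 (@dirac0 R p q S) (a, 0, c, d) 0.
Proof.
have n10 : (1 : C) != 0 by exact: oner_neq0.
move=> /(is_traceE q_gt1 n10 (is_g_dirac0 R S)).
set f := (fun l : int => _).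
(* In the partial order of C this says real and positive. *)
have f_gt0 l : 0 < f l.
  rewrite /f act_matrix_diag eqxx /eigenval !exp1rz !mulr1.
  by rewrite mulr_gt0 // exprz_gt0 // ltr0n; lia.
move=> /cvgrPdist_lt /(_ (f 0) (f_gt0 0)) [A _ HA].
(* Once 0 is added to the finite set, the partial sum is at least [f 0], which is the tolerance
   chosen. *)
have := HA (A `|` [fset 0])%fset (fsubsetUl _ _).
rewrite /= sub0r normrN /partial_sum.
rewrite -(big_seq_fsetE _ (A `|` [fset 0])%fset xpredT f).
rewrite (big_fsetD1 0) /=; last by rewrite !inE eqxx orbT.
set r := \sum_(i <- _) _; have r0 : 0 <= r.
  by apply: sumr_ge0 => l _; apply: ltW; exact: f_gt0.
rewrite ger0_norm; last by rewrite addr_ge0 // ltW.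
by rewrite gtrDl (le_gtF r0).
Qed.

End Trace.

Theorem theorem3 (R : realType) (p q : nat) (hp : prime p)
    (hq : exists2 f, (0 < f)%N & q = (p ^ f)%N) (S : field2d p q) :
  [/\ (* invariance of beta(Psi_alpha) *)
      forall alpha : R[i], alpha != 0 ->
        beta_Psi S alpha `<=` Psi R S /\
        forall (x : heisR) (V : distK R S),
          beta_Psi S alpha V -> beta_Psi S alpha (actGt x V),
      (* Tr_alpha((a,b,c,d)), as a function of alpha, is 0 iff b <> 0 *)
      forall a b c d : int,
        (forall (alpha : R[i]) (g : rdist R S), alpha != 0 -> is_g alpha g ->
           is_trace alpha g (a, b, c, d) 0) <-> b != 0,
      (* for each alpha, the formal sum of the diagonal entries is 0 iff
         b <> 0 *)
      forall (alpha : R[i]) (g : rdist R S), alpha != 0 -> is_g alpha g ->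
        forall a b c d : int,
          (exists2 M : int -> int -> R[i],
             matrix_of alpha g (a, b, c, d) M & forall l, M l l = 0) <-> b != 0
    & (* the trace of (a,0,c,d): one side exists iff the other one does *)
      forall (alpha : R[i]) (g : rdist R S), alpha != 0 -> is_g alpha g ->
        forall (a c d : int) (T : R[i]),
          is_trace alpha g (a, 0, c, d) T <->
          exists2 s : R[i],
            partial_sum (fun l : int =>
              (q%:R : R[i]) ^ (- (a * l) - (d * l * (l + 1) %/ 2)%Z)
                * alpha ^ (d * l) : R[i]^o) @ totally --> (s : R[i]^o) &
            T = (q%:R : R[i]) ^ (- c - a) * alpha ^ a * s].
Proof.
have q_gt1 : (1 < q)%N.
  by case: hq => f f0 ->; rewrite -(exp1n f) ltn_exp2r // prime_gt1.
split=> [alpha alpha0|a b c d|alpha g alpha0 gP a b c d|alpha g alpha0 gP a c d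
  T].
- split=> [|x V]; first exact: beta_Psi_sub.
  exact: beta_Psi_invariant.
- split=> [H|b0 alpha g alpha0 gP]; last exact: is_trace_offdiag.
  apply/eqP => b0; have := H 1 (@dirac0 R p q S) (oner_neq0 _) (is_g_dirac0 R
    S).
  by rewrite b0; exact: dirac0_not_trace0.
- split=> [[M xM M0]|b0].
    (* If b = 0 every diagonal entry is a nonzero eigenvalue; the entry at l = 0 already gives the
       contradiction. *)
    apply/eqP => b0; have /eqP := M0 0.
    rewrite (matrix_of_uniq q_gt1 alpha0 gP 0 0 xM) act_matrix_diag b0 eqxx.
    by rewrite (negPf (eigenval_neq0 q_gt1 alpha0 _ _ _ _)).
  exists (act_matrix q alpha (a, b, c, d)); first exact: matrix_of_act.
  by move=> l; rewrite act_matrix_diag (negPf b0).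
- exact: is_trace_diag.
Qed.
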